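(* Let $d\ge1$. A bounded set $K\subseteq L^2(\mathbb{R}^d)$ is relatively compact in $L^2(\mathbb{R}^d)$ if and only if $$\lim_{\xi\to+\infty}\ \sup_{f\in K}\int_{\complement Q_\xi}|Rf(x,\omega)|^2\,dx\,d\omega=0.$$
   Context: Functions are complex-valued. The Fourier transform on $\mathbb{R}^d$ is $\hat f(\omega)=\int_{\mathbb{R}^d}f(x)e^{-2\pi i x\cdot\omega}\,dx$, extended to $L^2(\mathbb{R}^d)$ as a unitary operator. The Rihaczek distribution of $f\in L^2(\mathbb{R}^d)$ is $$Rf(x,\omega)=e^{-2\pi i x\cdot\omega}f(x)\overline{\hat f(\omega)},\qquad x,\omega\in\mathbb{R}^d.$$ For $\xi>0$, $Q_\xi=\{(x,\omega)\in\mathbb{R}^{2d}: |x|\le\xi,\ |\omega|\le\xi\}$, where $|\cdot|$ is the Euclidean norm on $\mathbb{R}^d$, and $\complement Q_\xi=\mathbb{R}^{2d}\setminus Q_\xi$. *)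

(* Defs.v *)
From HB Require Import structures.
From mathcomp Require Import all_boot all_order all_algebra generic_quotient.
From mathcomp Require Import ring_quotient complex.
From mathcomp Require Import all_classical all_reals all_analysis.
From mathcomp Require Import measurable_realfun.

Set Implicit Arguments.
Unset Strict Implicit.
Unset Printing Implicit Defensive.

Import Order.TTheory GRing.Theory Num.Theory.
Import numFieldNormedType.Exports.
Import ComplexField.Normc.

Local Open Scope classical_set_scope.
Local Open Scope ring_scope.
Local Open Scope complex_scope.

Section lebesgue_tuple.
Context {R : realType}.
Local Notation R1 := (measurableTypeR R).

Definition cons_pair n (p : R1 * n.-tuple R1) : n.+1.-tuple R1 :=
  [tuple of p.1 :: p.2].

Lemma measurable_cons_pair n : measurable_fun [set: R1 * n.-tuple R1]
  (@cons_pair n).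
Proof. exact: measurable_cons. Qed.

Definition uncons n (t : n.+1.-tuple R1) : R1 * n.-tuple R1 :=
  (thead t, [tuple of behead t]).

Lemma measurable_uncons n : measurable_fun [set: n.+1.-tuple R1] (@uncons n).
Proof.
apply/measurable_fun_pairP; split; first exact: measurable_tnth.
exact: measurable_behead.
Qed.

Lemma cons_pairK n : cancel (@cons_pair n) (@uncons n).
Proof. by case=> x t; congr pair; exact/val_inj. Qed.

Section step.
Variables (n : nat) (mu : {sigma_finite_measure set (n.-tuple R1) -> \bar R}).

Definition lebesgue_cons : set (n.+1.-tuple R1) -> \bar R :=
  pushforward (lebesgue_measure \x mu)%E (@cons_pair n).

Let lebesgue_cons0 : lebesgue_cons set0 = 0%E.
Proof. by rewrite /lebesgue_cons /pushforward preimage_set0 measure0. Qed.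

Let lebesgue_cons_ge0 A : (0 <= lebesgue_cons A)%E.
Proof. by rewrite /lebesgue_cons /pushforward; exact: measure_ge0. Qed.

Let lebesgue_cons_sigma_additive : semi_sigma_additive lebesgue_cons.
Proof.
have mc A : measurable A -> measurable (@cons_pair n @^-1` A).
  by move=> mA; rewrite -[X in measurable X]setTI; exact: measurable_cons_pair.
move=> F mF tF mUF; rewrite /lebesgue_cons /pushforward preimage_bigcup.
apply: measure_semi_sigma_additive.
- by move=> i; exact: mc.
- apply/trivIsetP => /= i j _ _ ij; rewrite -preimage_setI.
  by move/trivIsetP : tF => /(_ _ _ _ _ ij) ->//; rewrite preimage_set0.
- by rewrite -preimage_bigcup; exact: mc.
Qed.

HB.instance Definition _ := isMeasure.Build _ _ _ lebesgue_cons
  lebesgue_cons0 lebesgue_cons_ge0 lebesgue_cons_sigma_additive.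

Lemma lebesgue_cons_sigma_finite : sigma_finite setT lebesgue_cons.
Proof.
have /sigma_finiteP[F [TF ndF Foo]] := sigma_finiteT (@lebesgue_measure R).
have /sigma_finiteP[G [TG ndG Goo]] := sigma_finiteT mu.
exists (fun k => @uncons n @^-1` (F k `*` G k)).
  rewrite -preimage_bigcup (_ : \bigcup_k _ = setT) ?preimage_setT//.
  rewrite -subTset -setXTT TF TG => -[x y] [/= [i _ Fx] [j _ Gy]].
  exists (maxn i j) => //; split.
  - by move: x Fx; exact/subsetPset/ndF/leq_maxl.
  - by move: y Gy; exact/subsetPset/ndG/leq_maxr.
move=> k; have [mF Fk] := Foo k; have [mG Gk] := Goo k; split.
  rewrite -[X in measurable X]setTI; apply: measurable_uncons => //.
  exact: measurableX.
rewrite /lebesgue_cons /pushforward -comp_preimage (_ : _ \o _ = id) ?preimage_id; last first.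
  by apply/funext => p; exact: cons_pairK.
by rewrite product_measure1E// lte_mul_pinfty// ge0_fin_numE.
Qed.

HB.instance Definition _ := Measure_isSigmaFinite.Build _ _ _ lebesgue_cons
  lebesgue_cons_sigma_finite.
End step.

(* The n-fold product of the Lebesgue measure on R, transported at each step
   along R * R^n -> R^(n+1), (x, t) |-> x :: t. *)
Fixpoint lebesgue_tuple (n : nat) :
    {sigma_finite_measure set (n.-tuple R1) -> \bar R} :=
  if n is m.+1 then lebesgue_cons (lebesgue_tuple m)
  else dirac ([tuple] : 0.-tuple R1).

End lebesgue_tuple.

Section L2.
Context d (T : measurableType d) (R : realType).
Variable mu : {measure set T -> \bar R}.
Implicit Types f g : T -> R[i].

Definition cmeasurable f :=
  measurable_fun setT (@complex.Re R \o f) /\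
  measurable_fun setT (@complex.Im R \o f).

Definition cabs f : T -> R := @normc R \o f.

Lemma measurable_cabs f : cmeasurable f -> measurable_fun setT (cabs f).
Proof.
move=> [mr mi].
rewrite (_ : cabs f = (@powR R ^~ 2^-1) \o
    (fun x => complex.Re (f x) ^+ 2 + complex.Im (f x) ^+ 2)).
  apply: measurableT_comp; first exact: measurable_powR.
  by apply: measurable_funD; apply: measurable_funX.
apply/funext => x; rewrite /cabs /= powR12_sqrt ?addr_ge0 ?sqr_ge0//.
by case: (f x).
Qed.

Definition L2pred : {pred T -> R[i]} :=
  mem [set f | cmeasurable f /\ finite_norm mu 2%:E (cabs f)].

Lemma L2predP f :
  reflect (cmeasurable f /\ finite_norm mu 2%:E (cabs f)) (f \in L2pred).
Proof. by apply: (iffP idP) => [/set_mem|/mem_set]. Qed.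

Lemma le_Lnorm2 (u v : T -> R) : measurable_fun setT u ->
  measurable_fun setT v -> (forall x, 0 <= u x <= v x) ->
  ('N[mu]_2%:E[EFin \o u] <= 'N[mu]_2%:E[EFin \o v])%E.
Proof.
move=> mu_ mv uv; rewrite unlock /Lnorm.
have P (w : T -> R) : measurable_fun setT w ->
    measurable_fun setT (fun x => (`|(w x)%:E| `^ 2)%E).
  move=> mw; apply/measurable_EFinP => /=.
  apply: (@measurableT_comp _ _ _ _ _ _ (@powR R ^~ 2)) => //.
  exact: measurableT_comp.
have Ige0 (w : T -> R) :
    (\int[mu]_x (`|(w x)%:E| `^ 2))%E \in `[0%E, +oo%E].
  rewrite in_itv /= leey andbT.
  by apply: integral_ge0 => x _ /=; rewrite lee_fin powR_ge0.
apply: gt0_ler_poweR; [by rewrite invr_ge0|exact: Ige0|exact: Ige0|].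
apply: ge0_le_integral; [by []|..].
- by move=> x _; exact: poweR_ge0.
- exact: P.
- exact: P.
move=> x _; have /andP[u0 uvx] := uv x.
rewrite /= lee_fin ge0_ler_powR// ?nnegrE//.
by rewrite !ger0_norm// (le_trans u0).
Qed.

Lemma cabs_ge0 f x : 0 <= cabs f x.
Proof. by rewrite /cabs /=; case: (f x) => a b; exact: sqrtr_ge0. Qed.

Lemma cabs_LfunP f : f \in L2pred -> cabs f \in Lfun mu 2%:E.
Proof.
move=> /L2predP[mf ff]; apply/andP; split; apply/mem_set => //.
exact: measurable_cabs.
Qed.

Lemma cmeasurableD f g : cmeasurable f -> cmeasurable g -> cmeasurable (f + g).
Proof.
move=> [fr fi] [gr gi]; split.
- rewrite (_ : _ \o _ = (@complex.Re R \o f) \+ (@complex.Re R \o g)).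
    exact: measurable_funD.
  by apply/funext => x /=; exact: raddfD.
- rewrite (_ : _ \o _ = (@complex.Im R \o f) \+ (@complex.Im R \o g)).
    exact: measurable_funD.
  by apply/funext => x /=; exact: raddfD.
Qed.

Lemma cmeasurableN f : cmeasurable f -> cmeasurable (- f).
Proof.
move=> [fr fi]; split.
- rewrite (_ : _ \o _ = \- (@complex.Re R \o f)).
    exact: measurable_funN.
  by apply/funext => x /=; exact: raddfN.
- rewrite (_ : _ \o _ = \- (@complex.Im R \o f)).
    exact: measurable_funN.
  by apply/funext => x /=; exact: raddfN.
Qed.

Lemma cabsN f : cabs (- f) = cabs f.
Proof. by apply/funext => x; exact: normcN. Qed.

Lemma Lnorm2_cabsD f g : f \in L2pred -> g \in L2pred ->
  ('N[mu]_2%:E[EFin \o cabs (f + g)%R] <=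
   'N[mu]_2%:E[EFin \o cabs f] + 'N[mu]_2%:E[EFin \o cabs g])%E.
Proof.
move=> /L2predP[mf _] /L2predP[mg _].
have cf := measurable_cabs mf; have cg := measurable_cabs mg.
apply: le_trans (eminkowski _ cf cg _); last by rewrite lee_fin ler1n.
apply: le_Lnorm2.
- exact/measurable_cabs/cmeasurableD.
- exact: measurable_funD.
- by move=> x; rewrite cabs_ge0/=; exact: le_normcD.
Qed.

Lemma L2pred_zmod_closed : zmod_closed L2pred.
Proof.
have L20 : 0 \in L2pred.
  apply/L2predP; split.
    by split; rewrite (_ : _ \o _ = cst 0).
  rewrite /cabs (_ : _ \o _ = cst 0); last first.
    by apply/funext => x /=; exact: normc0.
  by apply: finite_norm_cst0; rewrite lee_fin ler1n.
split=> // f g Lf Lg.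
have LNg : - g \in L2pred.
  move/L2predP : Lg => [mg fg]; apply/L2predP; split; first exact: cmeasurableN.
  by rewrite cabsN.
apply/L2predP; split.
  by apply: cmeasurableD; [case/L2predP : Lf|case/L2predP : LNg].
apply: le_lt_trans (Lnorm2_cabsD Lf LNg) _; apply: lte_add_pinfty.
- by case/L2predP : Lf.
- by case/L2predP : LNg.
Qed.

HB.instance Definition _ :=
  GRing.isZmodClosed.Build (T -> R[i]) L2pred L2pred_zmod_closed.

Record L2fun := MkL2fun { L2fun_val :> T -> R[i] ; _ : L2fun_val \in L2pred }.

HB.instance Definition _ := [isSub for L2fun_val].
HB.instance Definition _ := [Choice of L2fun by <:].
HB.instance Definition _ := [SubChoice_isSubZmodule of L2fun by <:].

Definition L2null : {pred L2fun} :=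
  mem [set u : L2fun | {ae mu, forall x, u x = 0}].

Lemma L2nullP (u : L2fun) : reflect {ae mu, forall x, u x = 0} (u \in L2null).
Proof. by apply: (iffP idP) => [/set_mem|/mem_set]. Qed.

Lemma L2null_zmod_closed : zmod_closed L2null.
Proof.
split; first exact/L2nullP/aeW.
move=> u v /L2nullP u0 /L2nullP v0; apply/L2nullP.
apply: filterS2 u0 v0 => x ux vx.
by rewrite -[LHS]/(u x - v x) ux vx subr0.
Qed.

HB.instance Definition _ :=
  GRing.isZmodClosed.Build L2fun L2null L2null_zmod_closed.

(* Classes, modulo almost everywhere equality, of Borel measurable complex
   functions with finite 2-norm. *)
Definition L2 : Type := Quotient.quot L2null.
HB.instance Definition _ := GRing.Zmodule.on L2.
HB.instance Definition _ := ZmodQuotient.on L2.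

Definition L2_to_fun (f : L2) : T -> R[i] := L2fun_val (repr f).
Coercion L2_to_fun : L2 >-> Funclass.

Lemma L2funP (u : L2fun) : (u : T -> R[i]) \in L2pred.
Proof. exact: valP. Qed.

Definition L2fun_abs (u : L2fun) : LfunType mu (lee1n 2) :=
  Lfun_Sub (lee1n 2) (cabs_LfunP (L2funP u)).

Definition L2norm (f : L2) : R := fine 'N[mu]_2%:E[EFin \o cabs f].

Lemma L2norm_pi (u : L2fun) :
  L2norm (\pi_L2 u)%qT = fine 'N[mu]_2%:E[EFin \o cabs u].
Proof.
rewrite /L2norm /L2_to_fun; set v := repr _.
have /L2nullP uv : v - u \in L2null.
  by rewrite Quotient.idealrBE reprK.
have mP (w : L2fun) : measurable_fun setT
    (fun x => (`|(EFin \o cabs w) x| `^ 2)%E).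
  apply/measurable_EFinP => /=.
  apply: (@measurableT_comp _ _ _ _ _ _ (@powR R ^~ 2)) => //.
  apply: measurableT_comp => //.
  by apply: measurable_cabs; case/L2predP : (L2funP w).
rewrite unlock /Lnorm; congr (fine (_ `^ _)%E).
apply: ae_eq_integral => //.
apply: filterS uv => x vux _; rewrite /cabs /=.
suff -> : v x = u x by [].
by apply/eqP; rewrite -subr_eq0; apply/eqP.
Qed.

Lemma L2normE (u : L2fun) : (L2norm (\pi_L2 u)%qT)%:E =
  'N[mu]_2%:E[EFin \o cabs u]%E.
Proof. by rewrite L2norm_pi -(finite_norm_fine (L2fun_abs u)). Qed.

Lemma L2norm_triangle (f g : L2) : L2norm (f + g) <= L2norm f + L2norm g.
Proof.
rewrite -[f]reprK -[g]reprK -raddfD /= -lee_fin EFinD !L2normE.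
exact: Lnorm2_cabsD (L2funP _) (L2funP _).
Qed.

Lemma L2norm_eq0 (f : L2) : L2norm f = 0 -> f = 0.
Proof.
rewrite -[f]reprK; set u := repr f => u0.
rewrite -(raddf0 (\pi_L2)%qT); apply/eqP; rewrite -Quotient.idealrBE subr0.
apply/L2nullP; move: u0; rewrite L2norm_pi => u0.
have := @fine_Lnormr_eq0 _ _ _ mu _ _ (L2fun_abs u) u0.
by apply: filterS => x /(_ Logic.I) /eq0_normc.
Qed.

Lemma L2norm_natmul (f : L2) k : L2norm (f *+ k) = L2norm f *+ k.
Proof.
rewrite -[f]reprK; set u := repr f.
rewrite -raddfMn !L2norm_pi -(Lnormr_natmul (L2fun_abs u)).
congr (fine (Lnorm _ _ _)); apply/funext => x; congr EFin.
have -> : (L2fun_abs u *+ k) x = cabs u x *+ k.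
  by elim: k => // k IH; rewrite (mulrS (L2fun_abs u)) (mulrS (cabs u x)) -IH.
rewrite [LHS]/cabs /= -normcMn; congr normc.
by elim: k => // k IH; rewrite (mulrS u) (mulrS (u x)) -IH.
Qed.

Lemma L2normN (f : L2) : L2norm (- f) = L2norm f.
Proof. by rewrite -[f]reprK -raddfN !L2norm_pi cabsN. Qed.

HB.instance Definition _ := Num.Zmodule_isNormed.Build R L2
  L2norm_triangle L2norm_eq0 L2norm_natmul L2normN.
HB.instance Definition _ := PseudoMetric.copy L2 (pseudoMetric_normed L2).
HB.instance Definition _ := isPointed.Build L2 0.
HB.instance Definition _ := NormedZmod_PseudoMetric_eq.Build R L2 erefl.
End L2.

Section rihaczek.
Context {R : realType} {n : nat}.
Local Notation Rn := (n.-tuple (measurableTypeR R)).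
Local Notation lambda := (@lebesgue_tuple R n).
Local Notation L2Rn := (L2 lambda).

Definition dotp (x w : Rn) : R := \sum_(i < n) tnth x i * tnth w i.

Definition enorm (x : Rn) : R := Num.sqrt (dotp x x).

(* e^(i t) *)
Definition expi (t : R) : R[i] := cos t +i* sin t.

Definition cintegral (f : Rn -> R[i]) : R[i] :=
  (\int[lambda]_x complex.Re (f x)) +i* (\int[lambda]_x complex.Im (f x)).

Definition fourier_integral (f : Rn -> R[i]) (w : Rn) : R[i] :=
  cintegral (fun x => f x * expi (- (2 * pi * dotp x w))).

(* The graph, in L^2 x L^2, of the integral Fourier transform on L^1 /\ L^2. *)
Definition fourier_graph : set (L2Rn * L2Rn) :=
  [set p : L2Rn * L2Rn | lambda.-integrable setT (EFin \o cabs p.1) /\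
    {ae lambda, forall w, p.2 w = fourier_integral p.1 w}].

(* The Fourier transform on L^2 is the extension by continuity from the dense
   subspace L^1 /\ L^2: by Plancherel's theorem the closure of fourier_graph is
   the graph of a (unitary) operator, so that exactly one g qualifies for each f
   and the default value 0 of xget is never used. *)
Definition fourier (f : L2Rn) : L2Rn :=
  xget 0 [set g : L2Rn | closure fourier_graph (f, g)].

(* Defined through the representatives of the classes f and fourier f; two
   choices of representatives give functions that agree almost everywhere. *)
Definition rihaczek (f : L2Rn) (z : Rn * Rn) : R[i] :=
  expi (- (2 * pi * dotp z.1 z.2)) * f z.1 * (fourier f z.2)^*.

Definition Qset (xi : R) : set (Rn * Rn) :=
  [set z | enorm z.1 <= xi /\ enorm z.2 <= xi].

Definition rihaczek_tail (xi : R) (f : L2Rn) : \bar R :=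
  (\int[lambda \x lambda]_(z in ~` Qset xi) (cabs (rihaczek f) z ^+ 2)%:E)%E.

End rihaczek.

(* Supremum of a set of nonnegative extended reals, taken in [0, +oo], so that
   the supremum of the empty set is 0 (and not -oo as for ereal_sup). *)
Definition sup_ge0 {R : realType} (A : set (\bar R)) : \bar R :=
  ereal_sup (0%E |` A).

(* Main.v *)
Require Import Defs.
From HB Require Import structures.
From mathcomp Require Import all_boot all_order all_algebra generic_quotient.
From mathcomp Require Import ring_quotient complex.
From mathcomp Require Import all_classical all_reals all_analysis.
From mathcomp Require Import measurable_realfun ring lra.

Set Implicit Arguments.
Unset Strict Implicit.
Unset Printing Implicit Defensive.

Import Order.TTheory GRing.Theory Num.Theory.
Import numFieldNormedType.Exports.

Local Open Scope classical_set_scope.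
Local Open Scope ring_scope.

(** Two facts reduce the theorem to the Riesz-Kolmogorov phenomenon.

    First, |R f (x, w)| = |f x| |F f w|, where F is the Fourier transform, so
    integrals of |R f|^2 over rectangles factor.  Write a and b for the parts of
    |f|^2 and |F f|^2 carried by the complement of the ball of radius xi, and N
    for their common total mass.  The complement of Q_xi contains
    { |x| > xi } x R^n and R^n x { |w| > xi } and is their union, hence
    max(a, b) N <= rihaczek_tail <= N (a + b).  As a, b <= N, the lower bound
    gives max(a, b)^2 <= rihaczek_tail: over a bounded set, Rihaczek tails
    vanish uniformly if and only if the tails of f and of F f both do
    (rihaczek_tail_lt, rihaczek_tail_le).

    Second, a bounded set K in L^2 is precompact if and only if the tails of f
    and F f vanish uniformly on K.  If K is precompact, a finite net of K
    controls all the tails, because F is an isometry (precompact_uniform_tails).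
    Conversely, let all these tails be small beyond xi.  Cut each f off to the
    ball of radius xi: this costs little, and the transform of the cut-off
    function is bounded and Lipschitz with constants that depend only on xi and
    the bound of K.  Such functions, read on the ball of radius xi, fall into
    finitely many classes of small uniform diameter, by rounding their values at
    the points of a finite grid (equilipschitz_finite_code).  Two elements of K
    in one class have close transforms inside the ball, both transforms are
    small outside, and by isometry the two elements are close.  So K is totally
    bounded (precompact_of_uniform_tails), and L^2 is complete.

    All this needs that F is a well-defined linear isometry of L^2, which rests
    on Plancherel's identity for integrable square-integrable functions.  On the
    line, for a real function u with transform U, weighting |U|^2 by exp(-e w) on
    the half line and exchanging integrals turns the energy of U into a double
    integral of u(x) u(y) against a Poisson kernel; writing
    2 u(x) u(y) = u(x)^2 + u(y)^2 - (u(x) - u(y))^2 gives the exact balance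

      2 int_0^oo exp(-e w) |U(w)|^2 dw + oscillation e u = int u^2,

    and the oscillation tends to 0 with e (energy_balance, oscillation_cvg0).
    Fubini's theorem carries the identity to R^n by induction on n, after which
    completeness of L^2 and density of the integrable functions give the
    operator. *)

(** * Elementary integrals on the half line *)

Section half_line.
Context {R : realType}.
Notation mu := (@lebesgue_measure R).

Lemma ge0_FTC2_half_line (f F : R -> R) (l : R) :
  (forall x, 0 <= f x) -> continuous f ->
  (forall x : R, is_derive x 1 F (f x)) -> F x @[x --> +oo] --> l ->
  (\int[mu]_(x in `[0%R, +oo[) (f x)%:E = (l - F 0)%:E)%E.
Proof.
move=> f0 cf dF Fl; rewrite EFinB.
have cF : continuous F.
  by move=> x; apply/differentiable_continuous/derivable1_diffP; case: (dF x).
apply: ge0_continuous_FTC2y => //.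
- exact: continuous_subspaceT.
- exact/cvg_at_right_filter/cF.
- by move=> x _; rewrite derive1E; case: (dF x).
Qed.

Lemma cvgy_expR_bounded (e M : R) (g : R -> R) : 0 < e ->
  (forall x, `|g x| <= M) -> expR (- (e * x)) * g x @[x --> +oo] --> 0.
Proof.
move=> e0 gM; apply: norm_cvg0.
have Ee : expR (- (e * x)) * M @[x --> +oo] --> 0.
  rewrite -(mul0r M); apply: cvgMl.
  apply: (@cvg_comp _ _ _ (fun x : R => e * x) (fun z => expR (- z))
    _ (pinfty_nbhs R)); last exact: cvgr_expR.
  exact: gt0_cvgMry.
apply: (squeeze_cvgr _ (cvg_cst 0) Ee).
apply: nearW => x; rewrite normr_ge0/= normrM gtr0_norm ?expR_gt0//.
by rewrite ler_wpM2l// expR_ge0.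
Qed.

Lemma is_derive_expRNM (e x : R) :
  is_derive x 1 (fun x => expR (- (e * x))) (- e * expR (- (e * x))).
Proof.
have H : is_derive x 1 (fun x => - (e * x)) (- e).
  have -> : (fun x => - (e * x)) = (- e) *: (@id R).
    by apply/funext => y; rewrite /= -mulNr.
  by apply: is_derive_eq; rewrite /GRing.scale/= mulr1.
have := is_derive1_comp (is_derive_expR _) H.
by rewrite mulrC.
Qed.

Lemma integral_expRN (e : R) : 0 < e ->
  (\int[mu]_(x in `[0%R, +oo[) (expR (- (e * x)))%:E = e^-1%:E)%E.
Proof.
move=> e0.
apply: eq_trans (@ge0_FTC2_half_line _ (fun x => - (e^-1 * expR (- (e * x)))) 0 _ _ _ _) _.
- by move=> x; exact: expR_ge0.
- move=> x; apply: continuous_comp; last exact: continuous_expR.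
  by apply: cvgN; apply: cvgMr; exact: cvg_id.
- move=> x.
  have H := is_derive_expRNM e x.
  have -> : (fun x => - (e^-1 * expR (- (e * x)))) =
    (- e^-1) *: (fun x => expR (- (e * x))).
    by apply/funext => y; rewrite /= fctE -mulNr.
  apply: is_derive_eq; rewrite /GRing.scale/=.
  by field; rewrite gt_eqF.
- rewrite -oppr0; apply: cvgN.
  have := @cvgy_expR_bounded e `|e^-1| (cst e^-1) e0 (fun _ => lexx _).
  by under eq_fun do rewrite mulrC.
- by rewrite mulr0 oppr0 expR0 mulr1 opprK add0r.
Qed.

Lemma is_derive_cosM (c x : R) :
  is_derive x 1 (fun x => cos (c * x)) (- (c * sin (c * x))).
Proof.
have H : is_derive x 1 (fun x => c * x) c.
  have -> : (fun x => c * x) = c *: (@id R) by [].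
  by apply: is_derive_eq; rewrite /GRing.scale/= mulr1.
have := is_derive1_comp (is_derive_cos _) H.
by rewrite mulrC mulrN.
Qed.

Lemma is_derive_sinM (c x : R) :
  is_derive x 1 (fun x => sin (c * x)) (c * cos (c * x)).
Proof.
have H : is_derive x 1 (fun x => c * x) c.
  have -> : (fun x => c * x) = c *: (@id R) by [].
  by apply: is_derive_eq; rewrite /GRing.scale/= mulr1.
have := is_derive1_comp (is_derive_sin _) H.
by rewrite mulrC.
Qed.

(** The summand 1 keeps the integrand nonnegative, so that the fundamental
    theorem of calculus applies on the half line without a domination argument;
    the transform of the cosine alone is recovered by subtraction. *)
Lemma integral_expRN_1Dcos (e c : R) : 0 < e ->
  (\int[mu]_(x in `[0%R, +oo[) (expR (- (e * x)) * (1 + cos (c * x)))%:E =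
   (e^-1 + e / (e ^+ 2 + c ^+ 2))%:E)%E.
Proof.
move=> e0.
have e2 : 0 < e ^+ 2 + c ^+ 2 by rewrite ltr_wpDr ?sqr_ge0// exprn_gt0.
(* exp(-e x) g(x) is a primitive of the integrand. *)
pose g x := - e^-1 + (c * sin (c * x) - e * cos (c * x)) / (e ^+ 2 + c ^+ 2).
apply: eq_trans (@ge0_FTC2_half_line _ (fun x => expR (- (e * x)) * g x) 0 _ _ _ _) _.
- move=> x; rewrite mulr_ge0 ?expR_ge0//.
- move=> x; apply: cvgM.
    apply: (@continuous_comp _ _ _ (fun x => - (e * x)) expR).
      by apply: cvgN; apply: cvgMr; exact: cvg_id.
    exact: continuous_expR.
  apply: cvgD; first exact: cvg_cst.
  apply: (@continuous_comp _ _ _ (fun x => c * x) cos).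
    by apply: cvgMr; exact: cvg_id.
  exact: continuous_cos.
- move=> x.
  have H := is_derive_expRNM e x.
  have Hc := is_derive_cosM c x.
  have Hs := is_derive_sinM c x.
  have -> : (fun x => expR (- (e * x)) * g x) =
      (fun x => expR (- (e * x))) * g by [].
  have Hg : is_derive x 1 g
      ((c * (c * cos (c * x)) + e * (c * sin (c * x))) / (e ^+ 2 + c ^+ 2)).
    have -> : g = cst (- e^-1) + (e ^+ 2 + c ^+ 2)^-1 *:
        (c *: (fun x => sin (c * x)) - e *: (fun x => cos (c * x))).
      by apply/funext => y; rewrite /g/= !fctE/= /GRing.scale/= mulrC.
    have := is_deriveD (is_derive_cst (- e^-1) x 1)
      (is_deriveZ (e ^+ 2 + c ^+ 2)^-1
        (is_deriveB (is_deriveZ c Hs) (is_deriveZ e Hc))).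
    by move/is_derive_eq; apply; rewrite /GRing.scale/= add0r mulrC; ring.
  have /is_derive_eq := is_deriveM H Hg; apply.
  rewrite /g /GRing.scale/=.
  by field; rewrite !gt_eqF.
- apply: (@cvgy_expR_bounded _ (e^-1 + (`|c| + e) / (e ^+ 2 + c ^+ 2))) => // x.
  rewrite /g (le_trans (ler_normD _ _))// lerD//.
    by rewrite normrN gtr0_norm// invr_gt0.
  rewrite normrM [`|_^-1|]gtr0_norm ?invr_gt0// ler_wpM2r ?invr_ge0 ?(ltW e2)//.
  rewrite (le_trans (ler_normB _ _))// lerD// normrM.
    by rewrite -[leRHS]mulr1 ler_wpM2l// ler_norml sin_geN1 sin_le1.
  rewrite [`|e|]gtr0_norm// -[leRHS]mulr1 ler_wpM2l// ?(ltW e0)//.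
  by rewrite ler_norml cos_geN1 cos_le1.
- rewrite /g !mulr0 oppr0 expR0 sin0 cos0; congr EFin; field.
  by rewrite !gt_eqF.
Qed.

Lemma integral_poisson1 :
  (\int[mu]_(x in `[0%R, +oo[) ((1 + (2 * pi * x) ^+ 2)^-1)%:E = (4^-1)%:E)%E.
Proof.
have p0 : 0 < 2 * pi :> R by rewrite mulr_gt0 ?pi_gt0.
have d0 x : 1 + (2 * pi * x) ^+ 2 != 0 :> R.
  by rewrite gt_eqF// ltr_pwDl// sqr_ge0.
apply: eq_trans (@ge0_FTC2_half_line _ (fun x => (2 * pi)^-1 * atan (2 * pi * x)) 4^-1 _ _ _ _) _.
- by move=> x; rewrite invr_ge0 addr_ge0// sqr_ge0.
- move=> x; apply: cvgV => //; apply: cvgD; first exact: cvg_cst.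
  by under eq_fun do rewrite expr2; apply: cvgM; apply: cvgMr; exact: cvg_id.
- move=> x.
  have H : is_derive x 1 (fun x => 2 * pi * x) (2 * pi).
    have -> : (fun x : R => 2 * pi * x) = (2 * pi) *: (@id R) by [].
    by apply: is_derive_eq; rewrite /GRing.scale/= mulr1.
  have H1 := is_derive1_comp (is_derive1_atan _) H.
  have -> : (fun x => (2 * pi)^-1 * atan (2 * pi * x)) =
    (2 * pi)^-1 *: (@atan R \o (fun x : R => 2 * pi * x)).
    by [].
  apply: is_derive_eq; rewrite /GRing.scale/=.
  by rewrite mulrCA mulVf ?mulr1// gt_eqF.
- have -> : 4^-1 = (2 * pi)^-1 * (pi / 2) :> R.
    have pn : (pi : R) != 0 by rewrite gt_eqF ?pi_gt0.
  by move: (@pi R) pn => p pn; field.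
  apply: cvgMr.
  apply: (@cvg_comp _ _ _ (fun x : R => 2 * pi * x) (@atan R)
    _ (pinfty_nbhs R)); last exact: cvgy_atan.
  exact: gt0_cvgMry.
- by rewrite mulr0 atan0 mulr0 subr0.
Qed.

End half_line.

(** * Limits, integrability and product measures *)

Lemma cvge0P (R : realType) (T : Type) (F : set_system T) {FF : Filter F}
    (f : T -> \bar R) : (forall x, 0 <= f x)%E ->
  f x @[x --> F] --> 0%E <->
  (forall e : R, 0 < e -> \forall x \near F, (f x < e%:E)%E).
Proof.
move=> f0; split => [cf e e0|H].
  have : nbhs 0%E [set y : \bar R | (y < e%:E)%E].
    apply: open_nbhs_nbhs; split; first exact: open_ereal_lt_ereal.
    by rewrite /= lte_fin.
  by move/cf.
apply/fine_cvgP; split.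
  apply: filterS (H 1 ltr01) => x x1; rewrite ge0_fin_numE//.
  by rewrite (lt_trans x1)// ltry.
apply/cvgrPdist_lt => e e0; apply: filterS (H e e0) => x xe /=.
have fx : f x \is a fin_num by rewrite ge0_fin_numE// (lt_trans xe)// ltry.
rewrite sub0r normrN ger0_norm ?fine_ge0//.
by rewrite -lte_fin fineK.
Qed.

Lemma ae_eq_integrable d (T : measurableType d) (R : realType)
    (mu : {measure set T -> \bar R}) (f g : T -> \bar R) :
  measurable_fun setT f -> ae_eq mu setT f g -> mu.-integrable setT g ->
  mu.-integrable setT f.
Proof.
move=> mf fg /integrableP[mg Ig]; apply/integrableP; split => //.
rewrite (ae_eq_integral (abse \o g))//.
- exact: measurableT_comp.
- exact: measurableT_comp.
- by apply: filterS fg => x fgx /fgx ->.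
Qed.

Lemma integrable_ge0 d (T : measurableType d) (R : realType)
    (nu : {measure set T -> \bar R})
    (f : T -> R) : measurable_fun setT f -> (forall x, 0 <= f x) ->
  (\int[nu]_x (f x)%:E < +oo)%E -> nu.-integrable setT (EFin \o f).
Proof.
move=> mf f0 If; apply/integrableP; split; first exact/measurable_EFinP.
by under eq_integral do rewrite /= ger0_norm//.
Qed.

Lemma integrableM_bounded d (T : measurableType d) (R : realType)
    (nu : {measure set T -> \bar R})
    (f h : T -> R) (M : R) : nu.-integrable setT (EFin \o f) ->
  measurable_fun setT h -> (forall x, `|h x| <= M) ->
  nu.-integrable setT (EFin \o (fun x => f x * h x)).
Proof.
move=> intf mh hM; rewrite (_ : _ \o _ = (EFin \o f) \* (EFin \o h))%E//.
apply: integrableMl => //.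
exists M; split; first exact: num_real.
by move=> y My x _ /=; rewrite (le_trans (hM x))// ltW.
Qed.

Section product_integrals.
Context d1 d2 (T1 : measurableType d1) (T2 : measurableType d2) (R : realType).
Variables (m1 : {sigma_finite_measure set T1 -> \bar R})
          (m2 : {sigma_finite_measure set T2 -> \bar R}).

Section tensor.
Variables (f : T1 -> R) (g : T2 -> R).

Lemma measurable_tensor : measurable_fun setT f -> measurable_fun setT g ->
  measurable_fun setT (fun z : T1 * T2 => f z.1 * g z.2).
Proof.
move=> mf mg; apply: measurable_funM.
  exact: (measurableT_comp mf).
exact: (measurableT_comp mg).
Qed.

(** This factorization is what separates the time and frequency variables of
    the Rihaczek distribution. *)
Lemma ge0_integral_tensor : measurable_fun setT f -> measurable_fun setT g ->
  (forall x, 0 <= f x) -> (forall x, 0 <= g x) ->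
  (\int[m1 \x m2]_z (f z.1 * g z.2)%:E =
   (\int[m1]_x (f x)%:E) * (\int[m2]_y (g y)%:E))%E.
Proof.
move=> mf mg f0 g0; rewrite fubini_tonelli1/=.
- rewrite /fubini_F/=.
  have g0i : (0 <= \int[m2]_y (g y)%:E)%E.
    by apply: integral_ge0 => y _; rewrite lee_fin.
  transitivity (\int[m1]_x ((f x)%:E * \int[m2]_y (g y)%:E))%E.
    apply: eq_integral => x _; under eq_integral do rewrite EFinM.
    by rewrite ge0_integralZl_EFin//; [move=> y _; rewrite lee_fin|exact/measurable_EFinP].
  rewrite ge0_integralZr//; first exact/measurable_EFinP.
  by move=> x _; rewrite lee_fin.
- by apply/measurable_EFinP; exact: measurable_tensor.
- by move=> z; rewrite lee_fin mulr_ge0.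
Qed.

End tensor.

Section integrable_tensor.
Variables (f : T1 -> R) (g : T2 -> R).
Hypothesis intf : m1.-integrable setT (EFin \o f).
Hypothesis intg : m2.-integrable setT (EFin \o g).

Lemma integrable_tensor :
  (m1 \x m2)%E.-integrable setT (fun z => (f z.1 * g z.2)%:E).
Proof.
case/integrableP : intf => /measurable_EFinP mf If.
case/integrableP : intg => /measurable_EFinP mg Ig.
apply/integrableP; split.
  by apply/measurable_EFinP; exact: measurable_tensor.
under eq_integral do rewrite /= normrM.
rewrite (@ge0_integral_tensor (Num.norm \o f) (Num.norm \o g)); first last.
- by move=> x /=.
- by move=> x /=.
- exact: measurableT_comp.
- exact: measurableT_comp.
have If0 : (0 <= \int[m1]_x ((Num.norm \o f) x)%:E)%E.
  by apply: integral_ge0 => x _; rewrite lee_fin /=.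
by apply: lte_mul_pinfty => //; rewrite ge0_fin_numE.
Qed.

End integrable_tensor.

Lemma measurable_Rintegral_snd (F : T1 * T2 -> R) : measurable_fun setT F ->
  measurable_fun setT (fun x => \int[m2]_y F (x, y)).
Proof.
move=> /measurable_EFinP mF; apply: (measurableT_comp (fine_measurable measurableT)).
rewrite (_ : (fun x => _) = (fun x => \int[m2]_y ((EFin \o F)^\+ (x, y)) -
    \int[m2]_y ((EFin \o F)^\- (x, y)))%E).
  apply: emeasurable_funB.
  - apply: (measurable_fun_fubini_tonelli_F ((EFin \o F)^\+)%E) => //.
    exact: measurable_funepos.
  - apply: (measurable_fun_fubini_tonelli_F ((EFin \o F)^\-)%E) => //.
    exact: measurable_funeneg.
apply/funext => x; rewrite [LHS]integralE; congr (_ - _)%E.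
  by apply: eq_integral => y _; rewrite !funeposE.
by apply: eq_integral => y _; rewrite !funenegE.
Qed.

Section fubini_Rintegral.
Variable F : T1 * T2 -> R.
Hypothesis intF : (m1 \x m2)%E.-integrable setT (EFin \o F).

Lemma ae_fubini_F_EFin :
  ae_eq m1 setT (fun x => (\int[m2]_y F (x, y))%:E) (fubini_F m2 (EFin \o F)).
Proof.
apply: filterS (ae_integrable1 intF) => x ix _.
by rewrite /Rintegral fineK// integrable_fin_num.
Qed.

Lemma ae_fubini_G_EFin :
  ae_eq m2 setT (fun y => (\int[m1]_x F (x, y))%:E) (fubini_G m1 (EFin \o F)).
Proof.
apply: filterS (ae_integrable2 intF) => x ix _.
by rewrite /Rintegral fineK// integrable_fin_num.
Qed.

Lemma measurable_Rintegral_F :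
  measurable_fun setT (fun x => \int[m2]_y F (x, y)).
Proof.
exact: (measurableT_comp (fine_measurable measurableT) (measurable_fubini_F intF)).
Qed.

Lemma measurable_Rintegral_G :
  measurable_fun setT (fun y => \int[m1]_x F (x, y)).
Proof.
exact: (measurableT_comp (fine_measurable measurableT) (measurable_fubini_G intF)).
Qed.

Lemma integral_Rintegral_F :
  (\int[m1]_x (\int[m2]_y F (x, y))%:E = \int[m1 \x m2]_z (F z)%:E)%E.
Proof.
rewrite -integral12_prod_meas1//; apply: ae_eq_integral => //.
- by apply/measurable_EFinP; exact: measurable_Rintegral_F.
- exact: (measurable_fubini_F intF).
- exact: ae_fubini_F_EFin.
Qed.

Lemma integral_Rintegral_G :
  (\int[m2]_y (\int[m1]_x F (x, y))%:E = \int[m1 \x m2]_z (F z)%:E)%E.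
Proof.
rewrite -integral21_prod_meas1//; apply: ae_eq_integral => //.
- by apply/measurable_EFinP; exact: measurable_Rintegral_G.
- exact: (measurable_fubini_G intF).
- exact: ae_fubini_G_EFin.
Qed.

Lemma integrable_Rintegral_F :
  m1.-integrable setT (fun x => (\int[m2]_y F (x, y))%:E).
Proof.
apply: (ae_eq_integrable _ _ (integrable_fubini_F intF)) => //.
- by apply/measurable_EFinP; exact: measurable_Rintegral_F.
- exact: ae_fubini_F_EFin.
Qed.

End fubini_Rintegral.

Lemma Rintegral_tensor (f : T1 -> R) (g : T2 -> R) :
  m1.-integrable setT (EFin \o f) -> m2.-integrable setT (EFin \o g) ->
  (\int[m1 \x m2]_z (f z.1 * g z.2)%:E = ((\int[m1]_x f x) * (\int[m2]_y g y))%:E)%E.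
Proof.
move=> intf intg; rewrite -integral_Rintegral_F/=; last exact: integrable_tensor.
transitivity (\int[m1]_x ((f x) * \int[m2]_y g y)%:E)%E.
  by apply: eq_integral => x _; rewrite RintegralZl.
under eq_integral do rewrite EFinM.
rewrite integralZr// EFinM; congr (_ * _)%E.
by rewrite /Rintegral fineK// integrable_fin_num.
Qed.

(** The exchange of integrals behind Plancherel's identity: a(x) p(y) dominates
    the integrand because the kernel is bounded by 1. *)
Lemma Fubini_bounded_kernel (a : T1 -> R) (p : T2 -> R) (k : T1 * T2 -> R) :
  m1.-integrable setT (EFin \o a) -> m2.-integrable setT (EFin \o p) ->
  measurable_fun setT k -> (forall z, `|k z| <= 1) ->
  (\int[m2]_y (p y * \int[m1]_x (a x * k (x, y)))%:E =
   \int[m1]_x (a x * \int[m2]_y (p y * k (x, y)))%:E)%E.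
Proof.
move=> inta intp mk k1.
have intF : (m1 \x m2)%E.-integrable setT
    (EFin \o (fun z => (a z.1 * p z.2) * k z)).
  by apply: (@integrableM_bounded _ _ _ _ _ _ 1) => //; exact: integrable_tensor.
have k1x x : measurable_fun setT (fun y => k (x, y)).
  exact: (measurableT_comp mk (measurable_pair1 x)).
have k1y y : measurable_fun setT (fun x => k (x, y)).
  exact: (measurableT_comp mk (measurable_pair2 y)).
transitivity (\int[m1 \x m2]_z (a z.1 * p z.2 * k z)%:E)%E.
  rewrite -(integral_Rintegral_G intF); apply: eq_integral => y _; congr EFin.
  rewrite -RintegralZl//.
    by apply: eq_Rintegral => x _ /=; ring.
  exact: (@integrableM_bounded _ _ _ _ _ _ 1).
rewrite -(integral_Rintegral_F intF); apply: eq_integral => x _; congr EFin.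
rewrite -RintegralZl//.
  by apply: eq_Rintegral => y _ /=; ring.
exact: (@integrableM_bounded _ _ _ _ _ _ 1).
Qed.

Lemma product_measure_sigma_finite : sigma_finite setT (m1 \x m2)%E.
Proof.
have /sigma_finiteP[F [TF ndF Foo]] := sigma_finiteT m1.
have /sigma_finiteP[G [TG ndG Goo]] := sigma_finiteT m2.
exists (fun k => F k `*` G k).
  apply/esym; rewrite -subTset -setXTT TF TG => -[x y] [/= [i _ Fx] [j _ Gy]].
  exists (maxn i j) => //; split.
  - by move: x Fx; exact/subsetPset/ndF/leq_maxl.
  - by move: y Gy; exact/subsetPset/ndG/leq_maxr.
move=> k; have [mF Fk] := Foo k; have [mG Gk] := Goo k; split.
  exact: measurableX.
by rewrite product_measure1E// lte_mul_pinfty// ge0_fin_numE.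
Qed.

(** The product measure bundled as a sigma-finite measure, so that it can in
    turn be a factor of a product: the kernels below are integrated over
    (R x R) x R. *)
Definition product_sfm : {sigma_finite_measure set (T1 * T2)%type -> \bar R} :=
  HB.pack (m1 \x m2)%E
    (Measure_isSigmaFinite.Build _ _ _ (m1 \x m2)%E product_measure_sigma_finite).

End product_integrals.
Section affine.
Context {R : realType}.
Notation mu := (@lebesgue_measure R).
(** By uniqueness, e times the image of the Lebesgue measure under
    z |-> x - e z is the Lebesgue measure, since they agree on intervals. *)
Lemma ge0_integral_affine (G : R -> \bar R) (x e : R) : 0 < e ->
  measurable_fun setT G -> (forall r, 0 <= G r)%E ->
  (\int[mu]_y G y = e%:E * \int[mu]_z G (x - e * z)%R)%E.
Proof.
move=> e0 mG G0.
pose phi : measurableTypeR R -> measurableTypeR R := fun z => x - e * z.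
have mphi : measurable_fun [set: measurableTypeR R] phi.
  by apply: measurable_funB => //; exact: measurable_funM.
have H (A : set (measurableTypeR R)) : measurable A ->
    mscale (NngNum (ltW e0)) (pushforward mu phi) A = mu A.
  move=> mA; apply/esym/lebesgue_measure_unique => //= _ [[a b]] _ <-.
  rewrite /mscale/= /pushforward.
  have -> : phi @^-1` `]a, b] = `[(x - b) / e, (x - a) / e[%classic.
    apply/seteqP; split => z/=; rewrite !in_itv/= /phi.
      by rewrite ler_pdivrMr// ltr_pdivlMr//; lra.
    by rewrite ler_pdivrMr// ltr_pdivlMr//; lra.
  rewrite !lebesgue_measure_itv/=.
  rewrite !lte_fin ltr_pM2r ?invr_gt0// ltrD2l ltrN2.
  case: ifP => ab; last by rewrite mule0.
  rewrite -!EFinD -EFinM; congr EFin; field.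
  by rewrite gt_eqF.
rewrite -(@ge0_integral_pushforward _ _ _ _ _ _ mphi mu setT)//.
rewrite -(@ge0_integral_mscale _ _ _ _ _ measurableT (NngNum (ltW e0)))//.
by apply: eq_measure_integral => A mA _; rewrite /= H.
Qed.
End affine.

(** * The Poisson kernel and the exponential weight *)

Section poisson.
Context {R : realType}.
Notation mu := (@lebesgue_measure R).
Notation RM := (measurableTypeR R).

(** The Laplace transform in w, at the point e, of cos (2 pi z w).  It is half of
    the density usually called Poisson kernel, and has total mass 1/2. *)
Definition poisson (e z : R) : R := e / (e ^+ 2 + (2 * pi * z) ^+ 2).

Lemma poisson_ge0 (e z : R) : 0 <= e -> 0 <= poisson e z.
Proof. by move=> e0; rewrite divr_ge0// addr_ge0// sqr_ge0. Qed.

Lemma continuous_poisson (e : R) : 0 < e -> continuous (poisson e).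
Proof.
move=> e0 x; apply: cvgMr; apply: cvgV.
  by rewrite gt_eqF// ltr_pwDl ?sqr_ge0// exprn_gt0.
apply: cvgD; first exact: cvg_cst.
by under eq_fun do rewrite expr2; apply: cvgM; apply: cvgMr; exact: cvg_id.
Qed.

Lemma measurable_poisson (e : R) : 0 < e -> measurable_fun [set: RM] (poisson e).
Proof. by move=> e0; apply: continuous_measurable_fun; exact: continuous_poisson. Qed.

Lemma integral_poisson_unit : (\int[mu]_z (poisson 1 z)%:E = (2^-1)%:E)%E.
Proof.
rewrite ge0_symfun_integralT//.
- have -> : [set x | 0 <= x] = `[0%R, +oo[%classic :> set RM.
    by apply/seteqP; split => x/=; rewrite in_itv/= andbT.
  have -> : (2^-1)%:E = (2%:E * (4^-1)%:E)%E :> \bar R.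
    by rewrite -EFinM; congr EFin; field.
  rewrite -integral_poisson1; congr (_ * _)%E.
  by apply: eq_integral => x _; rewrite /poisson expr1n div1r.
- by move=> x; exact: poisson_ge0.
- exact: continuous_poisson.
- by move=> x; rewrite /poisson/= mulrN sqrrN.
Qed.

Lemma poisson_scale (e z : R) : 0 < e -> poisson e (e * z) = e^-1 * poisson 1 z.
Proof.
move=> e0; rewrite /poisson.
have n1 : 1 + (2 * pi * z) ^+ 2 != 0 by rewrite gt_eqF// ltr_pwDl// sqr_ge0.
have -> : e ^+ 2 + (2 * pi * (e * z)) ^+ 2 = e ^+ 2 * (1 + (2 * pi * z) ^+ 2).
  by move: (@pi R) => p; ring.
by rewrite expr1n div1r; move: (_ + _) n1 => q q0; field; rewrite q0 gt_eqF.
Qed.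

Lemma integral_poisson (e x : R) : 0 < e ->
  (\int[mu]_y (poisson e (x - y))%:E = (2^-1)%:E)%E.
Proof.
move=> e0.
have mp : measurable_fun [set: RM] (fun y : RM => poisson e (x - y)).
  apply: (measurableT_comp (measurable_poisson e0)).
  exact: measurable_funB.
rewrite (ge0_integral_affine x e0)//; last 2 first.
- exact/measurable_EFinP.
- by move=> r; rewrite lee_fin poisson_ge0// ltW.
transitivity (e%:E * \int[mu]_z (e^-1%:E * (poisson 1 z)%:E))%E.
  congr (_ * _)%E; apply: eq_integral => z _.
  by rewrite opprB addrCA subrr addr0 poisson_scale.
rewrite ge0_integralZl_EFin//; last 3 first.
- by move=> z _; rewrite lee_fin poisson_ge0.
- by apply/measurable_EFinP; exact: measurable_poisson.
- by rewrite invr_ge0 ltW.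
by rewrite muleA -EFinM divff ?gt_eqF// mul1e integral_poisson_unit.
Qed.

(** An Abel summation weight, extended by 0 to the whole line so that all
    integrals are taken over R.  It is integrable, which legitimates the exchange
    of integrals, and it increases to 1 on the half line as e decreases to 0. *)
Definition expw (e : R) : R -> R := (fun w => expR (- (e * w))) \_ `[0, +oo[.

Lemma expw_ge0 (e w : R) : 0 <= expw e w.
Proof. by rewrite /expw patchE; case: ifP => // _; exact: expR_ge0. Qed.

Lemma measurable_expw (e : R) : measurable_fun [set: RM] (expw e).
Proof.
apply/(measurable_restrictT _ _).1 => //.
apply: measurable_funTS; apply: measurableT_comp => //.
by apply: measurableT_comp => //; exact: measurable_funM.
Qed.

Lemma integral_expw_mul (e : R) (g : R -> R) :
  (\int[mu]_w (expw e w * g w)%:E =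
   \int[mu]_(w in `[0%R, +oo[) (expR (- (e * w)) * g w)%:E)%E.
Proof.
rewrite [RHS]integral_mkcond; apply: eq_integral => w _.
by rewrite /expw !patchE; case: ifP => // _; rewrite mul0r.
Qed.

Lemma integral_expw (e : R) : 0 < e -> (\int[mu]_w (expw e w)%:E = e^-1%:E)%E.
Proof.
move=> e0; rewrite -(integral_expRN e0) [RHS]integral_mkcond.
by apply: eq_integral => w _; rewrite /expw !patchE; case: ifP.
Qed.

Lemma integrable_expw (e : R) : 0 < e -> mu.-integrable setT (EFin \o expw e).
Proof.
move=> e0; apply: integrable_ge0.
- exact: measurable_expw.
- exact: expw_ge0.
- by rewrite integral_expw// ltry.
Qed.

Lemma integral_expw_cos (e c : R) : 0 < e ->
  (\int[mu]_w (expw e w * cos (c * w))%:E = (e / (e ^+ 2 + c ^+ 2))%:E)%E.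
Proof.
move=> e0.
have I1 : (\int[mu]_w (expw e w * (1 + cos (c * w)))%:E =
    (e^-1 + e / (e ^+ 2 + c ^+ 2))%:E)%E.
  by rewrite integral_expw_mul integral_expRN_1Dcos.
have i1 : mu.-integrable setT (EFin \o (fun w => expw e w * (1 + cos (c * w)))).
  apply: integrable_ge0.
  - apply: measurable_funM; first exact: measurable_expw.
    apply: measurable_funD => //; apply: (measurableT_comp (continuous_measurable_fun (@continuous_cos R))).
    exact: measurable_funM.
  - by move=> w; rewrite mulr_ge0 ?expw_ge0.
  - by rewrite I1 ltry.
transitivity (\int[mu]_w ((expw e w * (1 + cos (c * w)))%:E - (expw e w)%:E))%E.
  by apply: eq_integral => w _; rewrite -EFinB; congr EFin; ring.
rewrite integralB//; last exact: integrable_expw.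
by rewrite I1 integral_expw// -EFinB addrC addKr.
Qed.

End poisson.

(** * Energy balance for the transform on the line *)

Section line_transform.
Context {R : realType}.
Notation mu := (@lebesgue_measure R).
Notation RM := (measurableTypeR R).

Definition cosT (u : RM -> R) (w : R) : R := \int[mu]_x (u x * cos (2 * pi * (x * w))).
Definition sinT (u : RM -> R) (w : R) : R := \int[mu]_x (u x * sin (2 * pi * (x * w))).

Lemma measurable_cosM (c : R) : measurable_fun [set: RM] (fun x : RM => cos (c * x)).
Proof.
apply: (measurableT_comp (continuous_measurable_fun (@continuous_cos R))).
exact: measurable_funM.
Qed.

Lemma measurable_sinM (c : R) : measurable_fun [set: RM] (fun x : RM => sin (c * x)).
Proof.
apply: (measurableT_comp (continuous_measurable_fun (@continuous_sin R))).
exact: measurable_funM.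
Qed.

Variable u : RM -> R.
Hypothesis intu : mu.-integrable setT (EFin \o u).
Let mu_ : measurable_fun setT u.
Proof. by case/integrableP : intu => /measurable_EFinP. Qed.

Let phase (z : RM * RM) : R := 2 * pi * (z.1 - z.2).

Let mphase : measurable_fun setT phase.
Proof. by apply: measurable_funM => //; apply: measurable_funB. Qed.

Let int_cosM (c : R) : mu.-integrable setT (EFin \o (fun x => u x * cos (c * x))).
Proof.
apply: (@integrableM_bounded _ _ _ _ _ _ 1) => //; first exact: measurable_cosM.
by move=> x; rewrite ler_norml cos_geN1 cos_le1.
Qed.

Let int_sinM (c : R) : mu.-integrable setT (EFin \o (fun x => u x * sin (c * x))).
Proof.
apply: (@integrableM_bounded _ _ _ _ _ _ 1) => //; first exact: measurable_sinM.
by move=> x; rewrite ler_norml sin_geN1 sin_le1.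
Qed.

(** The product of two integrals is an integral over the plane, and
    cos a cos b + sin a sin b = cos (a - b). *)
Lemma line_energyE (w : R) :
  cosT u w ^+ 2 + sinT u w ^+ 2 =
  \int[product_sfm mu mu]_z (u z.1 * u z.2 * cos (2 * pi * (z.1 - z.2) * w)).
Proof.
have -> : cosT u w = \int[mu]_x (u x * cos (2 * pi * w * x)).
  by apply: eq_Rintegral => x _; rewrite [x * w]mulrC mulrA.
have -> : sinT u w = \int[mu]_x (u x * sin (2 * pi * w * x)).
  by apply: eq_Rintegral => x _; rewrite [x * w]mulrC mulrA.
set c := 2 * pi * w.
have ic := int_cosM c; have is_ := int_sinM c.
have tc := integrable_tensor ic ic; have ts := integrable_tensor is_ is_.
apply: EFin_inj; rewrite !expr2 EFinD -(Rintegral_tensor ic ic) -(Rintegral_tensor is_ is_).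
rewrite -integralD//.
have E (z : RM * RM) : ((u z.1 * cos (c * z.1) * (u z.2 * cos (c * z.2)))%:E +
    (u z.1 * sin (c * z.1) * (u z.2 * sin (c * z.2)))%:E)%E =
   (u z.1 * u z.2 * cos (2 * pi * (z.1 - z.2) * w))%:E.
  have -> : 2 * pi * (z.1 - z.2) * w = c * z.1 - c * z.2.
    by rewrite /c; move: (@pi R) => p; ring.
  by rewrite cosB -EFinD; congr EFin; ring.
under eq_integral do rewrite E.
rewrite /Rintegral fineK//; apply: integrable_fin_num => //.
apply: eq_integrable (integrableD measurableT tc ts) => // z _; exact: E.
Qed.

(** Integrate line_energyE against the weight and perform the frequency integral
    first: it is the Laplace transform of a cosine. *)
Lemma weighted_energyE (e : R) : 0 < e ->
  (\int[mu]_w (expw e w * (cosT u w ^+ 2 + sinT u w ^+ 2))%:E =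
   \int[mu \x mu]_z (u z.1 * u z.2 * poisson e (z.1 - z.2))%:E)%E.
Proof.
move=> e0.
have := @Fubini_bounded_kernel _ _ (RM * RM)%type RM R (product_sfm mu mu) mu
  (fun z => u z.1 * u z.2) (expw e) (fun zw => cos (phase zw.1 * zw.2)).
move=> /(_ _ (integrable_expw e0)) H.
under eq_integral do rewrite line_energyE.
rewrite H.
- apply: eq_integral => z _; congr (EFin (_ * _)).
  by rewrite /Rintegral/= integral_expw_cos.
- exact: integrable_tensor.
- apply: (measurableT_comp (continuous_measurable_fun (@continuous_cos R))).
  by apply: measurable_funM => //; exact: (measurableT_comp mphase).
- by move=> x; rewrite ler_norml cos_geN1 cos_le1.
Qed.
End line_transform.

Section oscillation.
Context {R : realType}.
Notation mu := (@lebesgue_measure R).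
Notation RM := (measurableTypeR R).
Variable e : R.
Hypothesis e0 : 0 < e.

(** A mean square increment of u at scale e, the Poisson kernel concentrating
    near the diagonal as e decreases to 0. *)
Definition oscillation (u : RM -> R) : \bar R :=
  \int[mu \x mu]_z ((u z.1 - u z.2) ^+ 2 * poisson e (z.1 - z.2))%:E.

Let k (z : RM * RM) : R := poisson e (z.1 - z.2).

Let p_ge0 r : 0 <= poisson e r. Proof. exact/poisson_ge0/ltW. Qed.

Let mk : measurable_fun setT k.
Proof.
by apply: (measurableT_comp (measurable_poisson e0)); exact: measurable_funB.
Qed.

Let mfst (u : RM -> R) : measurable_fun setT u ->
  measurable_fun setT (fun z : RM * RM => u z.1).
Proof. by move=> mu_; exact: (measurableT_comp mu_). Qed.

Let msnd (u : RM -> R) : measurable_fun setT u ->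
  measurable_fun setT (fun z : RM * RM => u z.2).
Proof. by move=> mu_; exact: (measurableT_comp mu_). Qed.

Lemma integral_poisson_fst (h : RM -> R) :
  measurable_fun setT h -> (forall x, 0 <= h x) ->
  (\int[mu \x mu]_z (h z.1 * poisson e (z.1 - z.2))%:E =
   (2^-1)%:E * \int[mu]_x (h x)%:E)%E.
Proof.
move=> mh h0; rewrite fubini_tonelli1; first last.
- by move=> z; rewrite lee_fin mulr_ge0.
- by apply/measurable_EFinP; exact: (measurable_funM (mfst mh) mk).
rewrite -ge0_integralZl_EFin//; first last.
- exact/measurable_EFinP.
- by move=> x _; rewrite lee_fin.
apply: eq_integral => x _; rewrite /fubini_F/=.
under eq_integral do rewrite EFinM.
rewrite ge0_integralZl_EFin ?integral_poisson 1?muleC//.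
  by move=> y _; rewrite lee_fin.
apply/measurable_EFinP; exact: (measurableT_comp mk (measurable_pair1 x)).
Qed.

Lemma integral_poisson_snd (h : RM -> R) :
  measurable_fun setT h -> (forall x, 0 <= h x) ->
  (\int[mu \x mu]_z (h z.2 * poisson e (z.1 - z.2))%:E =
   (2^-1)%:E * \int[mu]_x (h x)%:E)%E.
Proof.
move=> mh h0; rewrite fubini_tonelli2; first last.
- by move=> z; rewrite lee_fin mulr_ge0.
- by apply/measurable_EFinP; exact: (measurable_funM (msnd mh) mk).
rewrite -ge0_integralZl_EFin//; first last.
- exact/measurable_EFinP.
- by move=> x _; rewrite lee_fin.
apply: eq_integral => y _; rewrite /fubini_G/=.
under eq_integral do rewrite EFinM.
rewrite ge0_integralZl_EFin//; first last.
- apply/measurable_EFinP; exact: (measurableT_comp mk (measurable_pair2 y)).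
- by move=> x _; rewrite lee_fin.
rewrite muleC -(integral_poisson y e0); congr (_ * _)%E.
by apply: eq_integral => x _; rewrite /poisson -[x - y]opprB !mulrN sqrrN.
Qed.

(** Polarize 2 u(x) u(y) = u(x)^2 + u(y)^2 - (u(x) - u(y))^2 in weighted_energyE:
    since the kernel has mass 1/2 in each variable, the two squares contribute
    the integral of u^2 altogether. *)
Lemma energy_balance (u : RM -> R) : mu.-integrable setT (EFin \o u) ->
  (\int[mu]_x (u x ^+ 2)%:E < +oo)%E ->
  (2%:E * (\int[mu]_w (expw e w * (cosT u w ^+ 2 + sinT u w ^+ 2))%:E) +
   oscillation u = \int[mu]_x (u x ^+ 2)%:E)%E.
Proof.
move=> iu u2.
have mu_ : measurable_fun setT u by case/integrableP : iu => /measurable_EFinP.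
have mu2 : measurable_fun setT (fun x => u x ^+ 2) by exact: measurable_funX.
have u20 x : 0 <= u x ^+ 2 by exact: sqr_ge0.
have I1 := integral_poisson_fst mu2 u20.
have I2 := integral_poisson_snd mu2 u20.
have half_lt : ((2^-1)%:E * \int[mu]_x (u x ^+ 2)%:E < +oo)%E.
  by rewrite lte_mul_pinfty// lee_fin.
have i1 : (mu \x mu)%E.-integrable setT
    (EFin \o (fun z : RM * RM => u z.1 ^+ 2 * k z)).
  apply: integrable_ge0; last by rewrite I1.
    exact: (measurable_funM (mfst mu2) mk).
  by move=> z; rewrite mulr_ge0// p_ge0.
have i2 : (mu \x mu)%E.-integrable setT
    (EFin \o (fun z : RM * RM => u z.2 ^+ 2 * k z)).
  apply: integrable_ge0; last by rewrite I2.
    exact: (measurable_funM (msnd mu2) mk).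
  by move=> z; rewrite mulr_ge0// p_ge0.
have i12 : (mu \x mu)%E.-integrable setT
    (EFin \o (fun z : RM * RM => u z.1 * u z.2 * k z)).
  apply: (le_integrable _ _ _ (integrableD _ i1 i2)) => //.
    apply/measurable_EFinP.
    exact: (measurable_funM (measurable_funM (mfst mu_) (msnd mu_)) mk).
  move=> z _ /=; rewrite lee_fin -mulrDl normrM [leRHS]normrM ler_wpM2r//.
  rewrite [leRHS]ger0_norm ?addr_ge0// ler_norml.
  by move: (u z.1) (u z.2) => a b; apply/andP; split; nra.
rewrite weighted_energyE// -integralZl//.
have io : (mu \x mu)%E.-integrable setT
    (EFin \o (fun z : RM * RM => (u z.1 - u z.2) ^+ 2 * k z)).
  have := integrableB measurableT (integrableD measurableT i1 i2)
    (integrableZl measurableT 2 i12).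
  apply: eq_integrable => // z _ /=; rewrite -?EFinM -?EFinD -?EFinB; congr EFin.
  by ring.
rewrite /oscillation -integralD//; last exact: integrableZl.
transitivity (\int[mu \x mu]_z ((u z.1 ^+ 2 * k z)%:E + (u z.2 ^+ 2 * k z)%:E))%E.
  apply: eq_integral => z _; rewrite -EFinM -!EFinD; congr EFin.
  by rewrite /k; ring.
rewrite integralD// I1 I2 -ge0_muleDl// -EFinD.
by rewrite (_ : 2^-1 + 2^-1 = 1 :> R) ?mul1e//; field.
Qed.

Let mosc (u : RM -> R) : measurable_fun setT u ->
  measurable_fun setT (fun z : RM * RM => (u z.1 - u z.2) ^+ 2 * k z).
Proof.
move=> mu_; apply: (measurable_funM _ mk).
by apply: measurable_funX; exact: (measurable_funB (mfst mu_) (msnd mu_)).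
Qed.

Lemma oscillation_le (u : RM -> R) : measurable_fun setT u ->
  (oscillation u <= 2%:E * \int[mu]_x (u x ^+ 2)%:E)%E.
Proof.
move=> mu_.
have mu2 : measurable_fun setT (fun x => u x ^+ 2) by exact: measurable_funX.
have u20 x : 0 <= u x ^+ 2 by exact: sqr_ge0.
have -> : (2%:E * \int[mu]_x (u x ^+ 2)%:E =
  2%:E * \int[mu \x mu]_z ((u z.1 ^+ 2 * k z)%:E + (u z.2 ^+ 2 * k z)%:E))%E.
  rewrite ge0_integralD//; first last.
  - by apply/measurable_EFinP; exact: (measurable_funM (msnd mu2) mk).
  - by move=> z _; rewrite lee_fin mulr_ge0// p_ge0.
  - by apply/measurable_EFinP; exact: (measurable_funM (mfst mu2) mk).
  - by move=> z _; rewrite lee_fin mulr_ge0// p_ge0.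
  rewrite (integral_poisson_fst mu2 u20) (integral_poisson_snd mu2 u20).
  rewrite -ge0_muleDl// -EFinD.
  by rewrite (_ : 2^-1 + 2^-1 = 1 :> R) ?mul1e//; field.
rewrite -ge0_integralZl_EFin//; first last.
- under eq_fun do rewrite -EFinD; apply/measurable_EFinP; apply: measurable_funD.
    exact: (measurable_funM (mfst mu2) mk).
  exact: (measurable_funM (msnd mu2) mk).
- by move=> z _; rewrite -EFinD lee_fin addr_ge0// mulr_ge0// p_ge0.
apply: ge0_le_integral => //.
- by move=> z _; rewrite lee_fin mulr_ge0// sqr_ge0.
- by apply/measurable_EFinP; exact: mosc.
- apply/measurable_EFinP; apply: measurable_funM => //; apply: measurable_funD.
    exact: (measurable_funM (mfst mu2) mk).
  exact: (measurable_funM (msnd mu2) mk).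
move=> z _; rewrite -EFinD -EFinM lee_fin /k.
move: (poisson _ _) (p_ge0 (z.1 - z.2)) (u z.1) (u z.2) => P P0 a b.
have H : (a - b) ^+ 2 <= 2 * (a ^+ 2 + b ^+ 2).
  by have := sqr_ge0 (a + b); lra.
by have := ler_wpM2r P0 H; lra.
Qed.

(** Stability of the oscillation in L^2, uniformly in the scale: it allows to
    replace u by a continuous approximation before letting e decrease to 0. *)
Lemma oscillation_leB (u g : RM -> R) :
  measurable_fun setT u -> measurable_fun setT g ->
  (oscillation u <= 4%:E * \int[mu]_x ((u x - g x) ^+ 2)%:E + 2%:E * oscillation g)%E.
Proof.
move=> mu_ mg; set v := u \- g.
have mv : measurable_fun setT v by exact: measurable_funB.
apply: (@le_trans _ _ (2%:E * oscillation v + 2%:E * oscillation g)%E); last first.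
  rewrite leeD2r// (_ : 4 = 2 * 2 :> R); last by ring.
  by rewrite EFinM -muleA lee_wpmul2l// oscillation_le.
rewrite -!ge0_integralZl_EFin//; first last.
- by apply/measurable_EFinP; exact: mosc.
- by move=> z _; rewrite lee_fin mulr_ge0// sqr_ge0.
- by apply/measurable_EFinP; exact: mosc.
- by move=> z _; rewrite lee_fin mulr_ge0// sqr_ge0.
rewrite -ge0_integralD//; first last.
- by apply/measurable_EFinP; apply: measurable_funM => //; exact: mosc.
- by move=> z _; rewrite lee_fin mulr_ge0// mulr_ge0// sqr_ge0.
- by apply/measurable_EFinP; apply: measurable_funM => //; exact: mosc.
- by move=> z _; rewrite lee_fin mulr_ge0// mulr_ge0// sqr_ge0.
apply: ge0_le_integral => //.
- by move=> z _; rewrite lee_fin mulr_ge0// sqr_ge0.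
- by apply/measurable_EFinP; exact: mosc.
- apply/measurable_EFinP; apply: measurable_funD.
    by apply: measurable_funM => //; exact: mosc.
  by apply: measurable_funM => //; exact: mosc.
move=> z _; rewrite -!EFinM -EFinD lee_fin /k /v/=.
move: (poisson _ _) (p_ge0 (z.1 - z.2)) => P P0.
move: (u z.1) (u z.2) (g z.1) (g z.2) => a b c d.
have H : (a - b) ^+ 2 <= 2 * (a - c - (b - d)) ^+ 2 + 2 * (c - d) ^+ 2.
  by have := sqr_ge0 (a - c - (b - d) - (c - d)); lra.
by have := ler_wpM2r P0 H; lra.
Qed.

End oscillation.

(** * Vanishing of the oscillation *)

Section density.
Context {R : realType}.
Notation mu := (@lebesgue_measure R).
Notation RM := (measurableTypeR R).

(* Clipping values to [-N, N] and multiplying by a plateau function supported in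
   [-(N + 1), N + 1] turn an L^1 approximation of a bounded, boundedly supported
   function into a bounded one with the same support control.  Then
   (v - g)^2 <= 2 N |v - g|, so that approximation in L^1 gives approximation
   in L^2. *)
Let clip (N y : R) : R := Num.max (- N) (Num.min N y).

Let clip_le (N y : R) : 0 <= N -> `|clip N y| <= N.
Proof.
move=> N0; rewrite /clip ler_norml; apply/andP; split.
  by rewrite le_max lexx.
by rewrite ge_max ge_min lexx/= andbT; lra.
Qed.

Let clip_dist (N v y : R) : `|v| <= N -> `|v - clip N y| <= `|v - y|.
Proof.
rewrite ler_norml => /andP[v1 v2]; rewrite /clip.
case: (leP N y) => Ny.
  rewrite max_r; last by lra.
  by rewrite [leRHS]distrC [leLHS]distrC !ger0_norm; lra.
case: (leP (- N) y) => Ny' //.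
by rewrite !ger0_norm; lra.
Qed.

Let clip_norm (N y : R) : 0 <= N -> `|clip N y| <= `|y|.
Proof.
move=> N0; have := @clip_dist N 0 y; rewrite !sub0r !normrN normr0; exact.
Qed.

Let cutoff (N x : R) : R := Num.max 0 (Num.min 1 (N + 1 - `|x|)).

Let cutoff_in (N x : R) : `|x| <= N -> cutoff N x = 1.
Proof. by move=> xN; rewrite /cutoff min_l ?max_r//; lra. Qed.

Let cutoff_out (N x : R) : N + 1 <= `|x| -> cutoff N x = 0.
Proof. by move=> xN; rewrite /cutoff max_l// ge_min; apply/orP; right; lra. Qed.

Let cutoff_ge0 (N x : R) : 0 <= cutoff N x.
Proof. by rewrite /cutoff le_max lexx. Qed.

Let cutoff_le1 (N x : R) : cutoff N x <= 1.
Proof. by rewrite /cutoff ge_max ler01 ge_min lexx. Qed.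

Let continuous_clip (N : R) (g : R -> R) : continuous g -> continuous (clip N \o g).
Proof.
move=> cg x; apply: (@continuous_max _ _ (cst (- N)) (fun x => Num.min N (g x))).
  exact: cvg_cst.
apply: (@continuous_min _ _ (cst N) g); first exact: cvg_cst.
exact: cg.
Qed.

Let continuous_cutoff (N : R) : continuous (cutoff N).
Proof.
move=> x; apply: (@continuous_max _ _ (cst 0) (fun x => Num.min 1 (N + 1 - `|x|))).
  exact: cvg_cst.
apply: (@continuous_min _ _ (cst 1) (fun x : R => N + 1 - `|x|)); first exact: cvg_cst.
apply: cvgB; first exact: cvg_cst.
exact: norm_continuous.
Qed.

Let approx_bounded (v : RM -> R) (N eta : R) : measurable_fun setT v -> 0 <= N ->
  (forall x, `|v x| <= N) -> (forall x, N < `|x| -> v x = 0) -> 0 < eta ->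
  exists g : R -> R, exists B : R, [/\ continuous g, forall x, `|g x| <= B,
    forall x, B < `|x| -> g x = 0 & (\int[mu]_x ((v x - g x) ^+ 2)%:E < eta%:E)%E].
Proof.
move=> mv N0 vN v0 eta0.
pose E : set RM := `[- (N + 1), N + 1]%classic.
have mE : measurable E by exact: measurable_itv.
have Ey : (mu E < +oo)%E.
  by rewrite lebesgue_measure_itv/=; case: ifP => // _; rewrite -EFinD ltry.
have iv : mu.-integrable E (EFin \o v).
  apply: measurable_bounded_integrable => //.
    exact: measurable_funTS.
  exists N; split; first exact: num_real.
  by move=> y Ny x _ /=; rewrite (le_trans (vN x))// ltW.
have [g_ [cg ig gv]] := approximation_continuous_integrable mE Ey iv.
have d0 : 0 < eta / (2 * N + 1) by rewrite divr_gt0//; lra.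
have [n gn] : exists n, (\int[mu]_(z in E) `|(v z - g_ n z)%:E| < (eta / (2 * N + 1))%:E)%E.
  have /cvge0P -/(_ _ _ d0) := gv.
  by move=> [|n _ /(_ n (leqnn n))]; [move=> n; exact: integral_ge0|exists n].
pose g x := cutoff N x * clip N (g_ n x).
exists g, (N + 1).
have gN x : `|g x| <= N.
  rewrite normrM ger0_norm ?cutoff_ge0// -[leRHS]mul1r.
  by rewrite ler_pM ?cutoff_ge0// ?cutoff_le1 ?clip_le.
have cg' : continuous g.
  by move=> x; apply: cvgM; [exact: continuous_cutoff|exact: continuous_clip].
have mg : measurable_fun [set: RM] g by exact: continuous_measurable_fun.
split => //.
- by move=> x; rewrite (le_trans (gN x))// lerDl.
- by move=> x xN; rewrite /g cutoff_out ?mul0r// ltW.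
have vg x : (v x - g x) ^+ 2 <= (2 * N) * ((fun x => `|v x - g_ n x|) \_ E) x.
  have [xE|xE] := pselect (E x).
    rewrite patchE mem_set//; have h1 : `|v x - g x| <= `|v x - g_ n x|.
      have [xN|xN] := lerP `|x| N.
        by rewrite /g cutoff_in// mul1r clip_dist.
      rewrite v0// !sub0r !normrN /g normrM ger0_norm ?cutoff_ge0//.
      by rewrite -[leRHS]mul1r ler_pM ?cutoff_ge0// ?cutoff_le1 ?clip_norm.
    have h2 : `|v x - g x| <= 2 * N.
      by rewrite (le_trans (ler_normB _ _))// mulr_natl mulr2n lerD.
    by rewrite -real_normK ?num_real// expr2 ler_pM.
  have xN : N + 1 < `|x|.
    move/negP : xE; rewrite /E/= in_itv/= -ler_norml.
    by rewrite -ltNge.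
  rewrite patchE memNset// mulr0 v0 ?/g ?cutoff_out ?(ltW xN)//; last by lra.
  by rewrite mul0r subrr expr0n.
apply: (@le_lt_trans _ _ ((2 * N)%:E * \int[mu]_(z in E) `|(v z - g_ n z)%:E|)%E).
  rewrite [X in (_ * X)%E]integral_mkcond.
  have mp : measurable_fun setT ((fun x => `|v x - g_ n x|) \_ E).
    apply/(measurable_restrictT _ _).1 => //; apply: measurable_funTS.
    apply: measurableT_comp => //; apply: measurable_funB => //.
    exact: continuous_measurable_fun.
  rewrite (_ : _ \_ E = EFin \o ((fun x => `|v x - g_ n x|) \_ E)); last first.
    by rewrite -restrict_EFin.
  rewrite -ge0_integralZl_EFin//; first last.
  - by rewrite mulr_ge0.
  - exact/measurable_EFinP.
  - by move=> x _; rewrite lee_fin patchE; case: ifP.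
  apply: ge0_le_integral => //.
  - by move=> x _; rewrite lee_fin sqr_ge0.
  - by apply/measurable_EFinP; apply: measurable_funX; exact: measurable_funB.
  - by apply/measurable_EFinP; apply: measurable_funM.
  - by move=> x _; rewrite -EFinM lee_fin vg.
have J0 : (0 <= \int[mu]_(z in E) `|(v z - g_ n z)%:E|)%E by exact: integral_ge0.
apply: (@le_lt_trans _ _ ((2 * N)%:E * (eta / (2 * N + 1))%:E)%E).
  by rewrite lee_wpmul2l ?lee_fin ?mulr_ge0// ltW.
rewrite -EFinM lte_fin mulrA ltr_pdivrMr; last by lra.
by nra.
Qed.

(** Truncate u where its argument or its value is large, then approximate the
    bounded truncation. *)
Lemma dense_continuous_L2 (u : RM -> R) (eta : R) : measurable_fun setT u ->
  (\int[mu]_x (u x ^+ 2)%:E < +oo)%E -> 0 < eta ->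
  exists g : R -> R, exists B : R, [/\ continuous g, forall x, `|g x| <= B,
    forall x, B < `|x| -> g x = 0 & (\int[mu]_x ((u x - g x) ^+ 2)%:E < eta%:E)%E].
Proof.
move=> mu_ u2 eta0.
have mu2 : measurable_fun setT (fun x => u x ^+ 2) by exact: measurable_funX.
pose A (n : nat) : set RM := `[- n%:R, n%:R]%classic `&` u @^-1` `[- n%:R, n%:R]%classic.
have mA n : measurable (A n).
  apply: measurableI; first exact: measurable_itv.
  by rewrite -[X in measurable X]setTI; apply: mu_ => //; exact: measurable_itv.
pose t n := u \_ (A n).
have mt n : measurable_fun setT (t n).
  by apply/(measurable_restrictT _ _).1 => //; exact: measurable_funTS.
have mf n : measurable_fun setT (fun x => (u x - t n x) ^+ 2).
  by apply: measurable_funX; exact: measurable_funB.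
have eta4 : 0 < eta / 4 by rewrite divr_gt0.
have pw x : setT x -> ((u x - t n x) ^+ 2)%:E @[n --> \oo] --> 0%E.
  move=> _; apply: cvg_near_cst.
  have [m m1] : exists m : nat, `|x| + `|u x| <= m%:R.
    exists (Num.truncn (`|x| + `|u x|)).+1.
    by apply/ltW; rewrite truncnS_gt.
  exists m => // k /= mk; congr EFin.
  have mkR : m%:R <= k%:R :> R by rewrite ler_nat.
  rewrite /t patchE mem_set ?subrr ?expr0n//.
  have x0 := normr_ge0 x; have ux0 := normr_ge0 (u x).
  by split; rewrite /= in_itv/= -ler_norml; lra.
have dom x n : setT x -> (`|((u x - t n x) ^+ 2)%:E| <= (u x ^+ 2)%:E)%E.
  move=> _; rewrite /= ger0_norm ?sqr_ge0// lee_fin.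
  by rewrite /t patchE; case: ifP; rewrite ?subr0// subrr expr0n/= sqr_ge0.
have iu2 : mu.-integrable setT (EFin \o (fun x => u x ^+ 2)).
  by apply: integrable_ge0 => // x; exact: sqr_ge0.
have [n tn] : exists n, (\int[mu]_z ((u z - t n z) ^+ 2)%:E < (eta / 4)%:E)%E.
  have [_ _] := dominated_convergence measurableT
    (fun n => (measurable_EFinP _ _).2 (mf n)) (measurable_cst _) (aeW _ pw) iu2
    (aeW _ dom).
  rewrite integral_cst// mul0e => cv.
  have /cvge0P -/(_ _ _ eta4) := cv.
  case=> [n|n _ /(_ n (leqnn n))]; last by exists n.
  by apply: integral_ge0 => x _; rewrite lee_fin sqr_ge0.
have tle x : `|t n x| <= n%:R.
  rewrite /t patchE; case: ifPn; last by rewrite normr0.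
  by rewrite inE => -[_]; rewrite /= in_itv/= ler_norml.
have t0 x : n%:R < `|x| -> t n x = 0.
  move=> nx; rewrite /t patchE memNset// => -[]; rewrite /= in_itv/= -ler_norml.
  by rewrite leNgt nx.
have [g [B [cg gB g0 tg]]] := approx_bounded (mt n) (ler0n _ _) tle t0 eta4.
exists g, B; split => //.
have mg : measurable_fun [set: RM] g by exact: continuous_measurable_fun.
apply: (@le_lt_trans _ _ (2%:E * \int[mu]_x ((u x - t n x) ^+ 2)%:E +
  2%:E * \int[mu]_x ((t n x - g x) ^+ 2)%:E)%E).
  rewrite -!ge0_integralZl_EFin//; first last.
  - by apply/measurable_EFinP.
  - by move=> x _; rewrite lee_fin sqr_ge0.
  - by apply/measurable_EFinP; apply: measurable_funX; exact: measurable_funB.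
  - by move=> x _; rewrite lee_fin sqr_ge0.
  rewrite -ge0_integralD//; first last.
  - apply/measurable_EFinP; apply: measurable_funM => //.
    by apply: measurable_funX; exact: measurable_funB.
  - by move=> x _; rewrite lee_fin mulr_ge0 ?sqr_ge0.
  - by apply/measurable_EFinP; apply: measurable_funM.
  - by move=> x _; rewrite lee_fin mulr_ge0 ?sqr_ge0.
  apply: ge0_le_integral => //.
  - by move=> x _; rewrite lee_fin sqr_ge0.
  - by apply/measurable_EFinP; apply: measurable_funX; exact: measurable_funB.
  - apply/measurable_EFinP; apply: measurable_funD; apply: measurable_funM => //.
    by apply: measurable_funX; exact: measurable_funB.
  - move=> x _; rewrite -!EFinM -EFinD lee_fin.
    move: (u x) (t n x) (g x) => a b c.
    by have := sqr_ge0 (a - b - (b - c)); lra.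
have -> : eta%:E = (2%:E * (eta / 4)%:E + 2%:E * (eta / 4)%:E)%E.
  by rewrite -!EFinM -EFinD; congr EFin; field.
by rewrite lteD// lte_pmul2l// lte_fin.
Qed.

End density.

Section oscillation_vanishes.
Context {R : realType}.
Notation mu := (@lebesgue_measure R).
Notation RM := (measurableTypeR R).

Let mul_sqr_ge0 (a b c : R) : 0 <= a -> 0 <= c -> 0 <= a * b ^+ 2 * c.
Proof. by move=> a0 c0; rewrite mulr_ge0// mulr_ge0// sqr_ge0. Qed.

(** The substitution y = x - e z moves the dependence on e from the kernel into
    the function, ready for dominated convergence.  The weight h localizes x to a
    bounded set, without which no dominating function would be integrable. *)
Lemma oscillation_swap (e : R) (h : RM -> R) (g : RM -> R) : 0 < e ->
  measurable_fun setT h -> measurable_fun setT g -> (forall x, 0 <= h x) ->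
  (\int[mu \x mu]_z (h z.1 * (g z.1 - g z.2) ^+ 2 * poisson e (z.1 - z.2))%:E =
   \int[mu \x mu]_z (h z.1 * (g z.1 - g (z.1 - e * z.2)) ^+ 2 * poisson 1 z.2)%:E)%E.
Proof.
move=> e0 mh mg h0.
have p_ge0 r : 0 <= poisson e r by exact/poisson_ge0/ltW.
have p1_ge0 r : 0 <= poisson 1 r :> R by exact/poisson_ge0.
have mfst (u : RM -> R) : measurable_fun setT u ->
  measurable_fun setT (fun z : RM * RM => u z.1).
  by move=> mu_; exact: (measurableT_comp mu_).
have msnd (u : RM -> R) : measurable_fun setT u ->
  measurable_fun setT (fun z : RM * RM => u z.2).
  by move=> mu_; exact: (measurableT_comp mu_).
rewrite fubini_tonelli1; first last.
- by move=> z; rewrite lee_fin mul_sqr_ge0.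
- apply/measurable_EFinP; apply: measurable_funM.
    apply: (measurable_funM (mfst _ mh)); apply: measurable_funX.
    exact: (measurable_funB (mfst _ mg) (msnd _ mg)).
  by apply: (measurableT_comp (measurable_poisson e0)); exact: measurable_funB.
rewrite fubini_tonelli1; first last.
- by move=> z; rewrite lee_fin mul_sqr_ge0.
- apply/measurable_EFinP; apply: measurable_funM; last first.
    exact: (msnd _ (measurable_poisson ltr01)).
  apply: (measurable_funM (mfst _ mh)); apply: measurable_funX.
  apply: (measurable_funB (mfst _ mg)); apply: (measurableT_comp mg).
  by apply: measurable_funB => //; exact: measurable_funM.
apply: eq_integral => x _; rewrite /fubini_F/=.
have mgx : measurable_fun setT (fun y => h x * (g x - g y) ^+ 2).
  by apply: measurable_funM => //; apply: measurable_funX; exact: measurable_funB.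
rewrite (ge0_integral_affine x e0)//; first last.
- by move=> r; rewrite lee_fin mul_sqr_ge0.
- apply/measurable_EFinP; apply: measurable_funM => //.
  by apply: (measurableT_comp (measurable_poisson e0)); exact: measurable_funB.
rewrite -ge0_integralZl_EFin//; first last.
- by rewrite ltW.
- apply/measurable_EFinP.
  have ma : measurable_fun [set: RM] (fun z : RM => x - e * z).
    by apply: measurable_funB => //; exact: measurable_funM.
  apply: measurable_funM; first exact: (measurableT_comp mgx ma).
  by apply: (measurableT_comp (measurable_poisson e0)); exact: measurable_funB.
- by move=> y _; rewrite lee_fin mul_sqr_ge0.
apply: eq_integral => z _; rewrite -EFinM; congr EFin.
rewrite opprB addrCA subrr addr0 poisson_scale//.
by field; rewrite gt_eqF.
Qed.

(** If g x and g y differ then x or y lies in the support of g; by symmetry it is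
    enough to bound the part where x does, where oscillation_swap applies and
    g (x - e z) tends to g x by continuity. *)
Lemma oscillation_cvg0_continuous (g : R -> R) (B : R) : continuous g ->
  (forall x, `|g x| <= B) -> (forall x, B < `|x| -> g x = 0) ->
  oscillation n.+1%:R^-1 g @[n --> \oo] --> 0%E.
Proof.
move=> cg gB g0.
have mg : measurable_fun [set: RM] g by exact: continuous_measurable_fun.
pose E : set RM := `[- B, B]%classic.
have mE : measurable E by exact: measurable_itv.
have Ey : (mu E < +oo)%E.
  by rewrite lebesgue_measure_itv/=; case: ifP => // _; rewrite -EFinD ltry.
pose h : RM -> R := \1_E.
have mh : measurable_fun setT h by exact: measurable_indic.
have h0 x : 0 <= h x by rewrite /h indicE.
have e0 n : 0 < n.+1%:R^-1 :> R by rewrite invr_gt0.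
pose f n (z : RM * RM) : R :=
  h z.1 * (g z.1 - g (z.1 - n.+1%:R^-1 * z.2)) ^+ 2 * poisson 1 z.2.
have p_ge0 n r : 0 <= poisson n.+1%:R^-1 r :> R by exact/poisson_ge0/ltW.
have p1_ge0 r : 0 <= poisson 1 r :> R by exact/poisson_ge0.
have mfst (u : RM -> R) : measurable_fun setT u ->
  measurable_fun setT (fun z : RM * RM => u z.1).
  by move=> mu_; exact: (measurableT_comp mu_).
have msnd (u : RM -> R) : measurable_fun setT u ->
  measurable_fun setT (fun z : RM * RM => u z.2).
  by move=> mu_; exact: (measurableT_comp mu_).
have mf n : measurable_fun setT (f n).
  apply: measurable_funM; last exact: (msnd _ (measurable_poisson ltr01)).
  apply: (measurable_funM (mfst _ mh)); apply: measurable_funX.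
  apply: (measurable_funB (mfst _ mg)); apply: (measurableT_comp mg).
  by apply: measurable_funB => //; exact: measurable_funM.
have f_ge0 n z : 0 <= f n z by rewrite mul_sqr_ge0.
have oscf n : (oscillation n.+1%:R^-1 g <= 2%:E * \int[mu \x mu]_z (f n z)%:E)%E.
  have mk : measurable_fun setT
      (fun z : RM * RM => (g z.1 - g z.2) ^+ 2 * poisson n.+1%:R^-1 (z.1 - z.2)).
    apply: measurable_funM.
      by apply: measurable_funX; exact: (measurable_funB (mfst _ mg) (msnd _ mg)).
    by apply: (measurableT_comp (measurable_poisson (e0 n))); exact: measurable_funB.
  have m1 : measurable_fun setT (fun z : RM * RM =>
      h z.1 * (g z.1 - g z.2) ^+ 2 * poisson n.+1%:R^-1 (z.1 - z.2)).
    by under eq_fun do rewrite -mulrA; exact: (measurable_funM (mfst _ mh) mk).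
  have m2 : measurable_fun setT (fun z : RM * RM =>
      h z.2 * (g z.1 - g z.2) ^+ 2 * poisson n.+1%:R^-1 (z.1 - z.2)).
    by under eq_fun do rewrite -mulrA; exact: (measurable_funM (msnd _ mh) mk).
  have I1 := oscillation_swap (e0 n) mh mg h0.
  have I2 : (\int[mu \x mu]_z (h z.2 * (g z.1 - g z.2) ^+ 2 *
       poisson n.+1%:R^-1 (z.1 - z.2))%:E = \int[mu \x mu]_z (f n z)%:E)%E.
    rewrite -I1 fubini_tonelli2; first last.
    - by move=> z; rewrite lee_fin mul_sqr_ge0.
    - exact/measurable_EFinP.
    rewrite fubini_tonelli1; first last.
    - by move=> z; rewrite lee_fin mul_sqr_ge0.
    - exact/measurable_EFinP.
    apply: eq_integral => x _; apply: eq_integral => y _ /=; congr EFin.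
    congr (_ * _ * _); first by rewrite -sqrrN opprB.
    by rewrite /poisson -[x - y]opprB !mulrN sqrrN.
  apply: (@le_trans _ _ (\int[mu \x mu]_z
     ((h z.1 * (g z.1 - g z.2) ^+ 2 * poisson n.+1%:R^-1 (z.1 - z.2))%:E +
      (h z.2 * (g z.1 - g z.2) ^+ 2 * poisson n.+1%:R^-1 (z.1 - z.2))%:E))%E).
    apply: ge0_le_integral => //.
    - by move=> z _; rewrite lee_fin mulr_ge0// sqr_ge0.
    - exact/measurable_EFinP.
    - by apply/measurable_EFinP; apply: measurable_funD.
    move=> z _; rewrite -EFinD lee_fin -mulrDl -mulrDl ler_wpM2r// ?p_ge0//.
    have [zE|zE] := pselect (E z.1 \/ E z.2).
      rewrite -[leLHS]mul1r ler_wpM2r ?sqr_ge0// /h !indicE.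
      by case: zE => /mem_set ->; rewrite ?lerDl ?lerDr.
    have out x : ~ E x -> g x = 0.
      move=> /negP; rewrite /E/= in_itv/= -ler_norml -ltNge; exact: g0.
    by rewrite !out ?subrr ?expr0n/= ?mulr0//; tauto.
  rewrite ge0_integralD//; first last.
  - exact/measurable_EFinP.
  - by move=> z _; rewrite lee_fin mul_sqr_ge0.
  - exact/measurable_EFinP.
  - by move=> z _; rewrite lee_fin mul_sqr_ge0.
  by rewrite I1 I2 -[(2%:E)]/((1 + 1)%:E) EFinD ge0_muleDl// mul1e.
have idom : (mu \x mu)%E.-integrable setT
    (fun z : RM * RM => ((4 * B ^+ 2 * h z.1) * poisson 1 z.2)%:E).
  apply: (@integrable_tensor _ _ RM RM R mu mu (fun x => 4 * B ^+ 2 * h x) (poisson 1)).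
    have B40 : 0 <= 4 * B ^+ 2 by rewrite mulr_ge0// sqr_ge0.
    apply: integrable_ge0.
    - exact: measurable_funM.
    - by move=> x; rewrite mulr_ge0.
    - under eq_integral do rewrite EFinM.
      rewrite ge0_integralZl_EFin//; first last.
      - exact/measurable_EFinP.
      - by move=> x _; rewrite lee_fin.
      by rewrite /h integral_indic// setIT lte_mul_pinfty.
  apply: integrable_ge0 => //; first exact: measurable_poisson.
  by rewrite integral_poisson_unit ltry.
have pw (z : RM * RM) : setT z -> (f n z)%:E @[n --> \oo] --> 0%E.
  move=> _; apply: cvg_EFin; first exact: nearW.
  have gz : g (z.1 - n.+1%:R^-1 * z.2) @[n --> \oo] --> g z.1.
    apply: (@cvg_comp _ _ _ (fun n : nat => z.1 - n.+1%:R^-1 * z.2) g); last first.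
      exact: cg.
    have : z.1 - n.+1%:R^-1 * z.2 @[n --> \oo] --> z.1 - 0 * z.2.
      apply: cvgB; first exact: cvg_cst.
      by apply: cvgMl; exact: cvg_harmonic.
    by rewrite mul0r subr0.
  have -> : 0 = h z.1 * ((g z.1 - g z.1) * (g z.1 - g z.1)) * poisson 1 z.2.
    by rewrite subrr mul0r mulr0 mul0r.
  under eq_fun do rewrite /f/= expr2.
  apply: cvgMl; apply: cvgMr.
  by apply: cvgM; apply: cvgB => //; exact: cvg_cst.
have dom (z : RM * RM) n : setT z ->
   (`|(f n z)%:E| <= (4 * B ^+ 2 * h z.1 * poisson 1 z.2)%:E)%E.
  move=> _; rewrite /= ger0_norm// lee_fin ler_wpM2r// mulrC ler_wpM2r//.
  have := gB z.1; have := gB (z.1 - n.+1%:R^-1 * z.2).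
  rewrite !ler_norml => /andP[a1 a2] /andP[b1 b2].
  by move: (g _) (g _) a1 a2 b1 b2 => a b; nra.
have [_ _] := dominated_convergence measurableT
  (fun n => (measurable_EFinP _ _).2 (mf n)) (measurable_cst _) (aeW _ pw) idom
  (aeW _ dom).
rewrite integral_cst// mul0e => cv.
apply/cvge0P => [n|e ee].
  by apply: integral_ge0 => z _; rewrite lee_fin mulr_ge0// sqr_ge0.
have /cvge0P -/(_ _ (e / 2)) := cv.
case=> [n||N _ HN]; [by apply: integral_ge0 => z _; rewrite lee_fin|by rewrite divr_gt0|].
exists N => // n /= /HN /= fe; apply: (le_lt_trans (oscf n)).
have -> : e%:E = (2%:E * (e / 2)%:E)%E by rewrite -EFinM; congr EFin; field.
by rewrite lte_pmul2l// lte_fin.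
Qed.

Lemma oscillation_cvg0 (u : RM -> R) : measurable_fun setT u ->
  (\int[mu]_x (u x ^+ 2)%:E < +oo)%E ->
  oscillation n.+1%:R^-1 u @[n --> \oo] --> 0%E.
Proof.
move=> mu_ u2.
have e0 n : 0 < n.+1%:R^-1 :> R by rewrite invr_gt0.
have osc0 n h : (0 <= oscillation (n.+1%:R^-1 : R) h)%E.
  by apply: integral_ge0 => z _; rewrite lee_fin mulr_ge0 ?sqr_ge0// poisson_ge0// ltW.
apply/cvge0P => // e ee.
have e8 : 0 < e / 8 by rewrite divr_gt0.
have [g [B [cg gB g0 ug]]] := dense_continuous_L2 mu_ u2 e8.
have mg : measurable_fun [set: RM] g by exact: continuous_measurable_fun.
have e4 : 0 < e / 4 by rewrite divr_gt0.
have /cvge0P -/(_ (osc0 ^~ g) _ e4) := oscillation_cvg0_continuous cg gB g0.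
apply: filterS => n ng; apply: (le_lt_trans (oscillation_leB (e0 n) mu_ mg)).
have -> : e%:E = (4%:E * (e / 8)%:E + 2%:E * (e / 4)%:E)%E.
  by rewrite -!EFinM -EFinD; congr EFin; field.
by rewrite lteD// lte_pmul2l// lte_fin.
Qed.

End oscillation_vanishes.

(** * Plancherel's identity on the line *)

Section plancherel_line.
Context {R : realType}.
Notation mu := (@lebesgue_measure R).
Notation RM := (measurableTypeR R).

Let mcos2 : measurable_fun setT (fun z : RM * RM => cos (2 * pi * (z.2 * z.1))).
Proof.
apply: (measurableT_comp (continuous_measurable_fun (@continuous_cos R))).
apply: measurable_funM => //; apply: measurable_funM => //.
Qed.

Let msin2 : measurable_fun setT (fun z : RM * RM => sin (2 * pi * (z.2 * z.1))).
Proof.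
apply: (measurableT_comp (continuous_measurable_fun (@continuous_sin R))).
apply: measurable_funM => //; apply: measurable_funM => //.
Qed.

Lemma measurable_cosT (u : RM -> R) : measurable_fun setT u ->
  measurable_fun [set: RM] (cosT u).
Proof.
move=> mu_; apply: (@measurable_Rintegral_snd _ _ RM RM R mu
  (fun z => u z.2 * cos (2 * pi * (z.2 * z.1)))).
by apply: measurable_funM => //; exact: (measurableT_comp mu_).
Qed.

Lemma measurable_sinT (u : RM -> R) : measurable_fun setT u ->
  measurable_fun [set: RM] (sinT u).
Proof.
move=> mu_; apply: (@measurable_Rintegral_snd _ _ RM RM R mu
  (fun z => u z.2 * sin (2 * pi * (z.2 * z.1)))).
by apply: measurable_funM => //; exact: (measurableT_comp mu_).
Qed.

(** Let e decrease to 0 in energy_balance: the weighted energies converge by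
    monotone convergence. *)
Lemma plancherel_half_line (u : RM -> R) : mu.-integrable setT (EFin \o u) ->
  (\int[mu]_x (u x ^+ 2)%:E < +oo)%E ->
  (2%:E * \int[mu]_(w in `[0%R, +oo[) (cosT u w ^+ 2 + sinT u w ^+ 2)%:E =
   \int[mu]_x (u x ^+ 2)%:E)%E.
Proof.
move=> iu u2.
have mu_ : measurable_fun setT u by case/integrableP : iu => /measurable_EFinP.
pose E w := cosT u w ^+ 2 + sinT u w ^+ 2.
have mE : measurable_fun [set: RM] E.
  apply: measurable_funD; apply: measurable_funX.
    exact: measurable_cosT.
  exact: measurable_sinT.
have E0 w : 0 <= E w by rewrite addr_ge0// sqr_ge0.
pose W n : \bar R := (\int[mu]_w (expw n.+1%:R^-1 w * E w)%:E)%E.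
have W0 n : (0 <= W n)%E.
  by apply: integral_ge0 => w _; rewrite lee_fin mulr_ge0// expw_ge0.
have cW : W n @[n --> \oo] --> (\int[mu]_(w in `[0%R, +oo[) (E w)%:E)%E.
  have := @cvg_monotone_convergence _ _ _ mu _ measurableT
    (fun n w => (expw n.+1%:R^-1 w * E w)%:E).
  rewrite [X in _ -> _ -> _ -> _ --> X](_ : _ =
    (\int[mu]_(w in `[0%R, +oo[) (E w)%:E)%E).
    apply => //.
    - move=> n; apply/measurable_EFinP; apply: measurable_funM => //.
      exact: measurable_expw.
    - by move=> n w _; rewrite lee_fin mulr_ge0// expw_ge0.
    - move=> w _ m n mn; rewrite lee_fin ler_wpM2r//.
      rewrite /expw !patchE; case: ifPn => //; rewrite inE/= in_itv/= andbT => w0.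
      rewrite ler_expR lerN2 ler_wpM2r// lef_pV2 ?posrE//.
      by rewrite ler_nat.
  rewrite [RHS]integral_mkcond; apply: eq_integral => w _.
  apply/cvg_lim => //; rewrite patchE; case: ifPn => w0.
    apply: cvg_EFin; first exact: nearW.
    rewrite -[X in _ --> X]mul1r; apply: cvgMl.
    rewrite /expw; under eq_fun do rewrite patchE w0.
    have c0 : - (n.+1%:R^-1 * w) @[n --> \oo] --> (0 : R).
      rewrite -oppr0 -(mul0r w); apply: cvgN; apply: cvgMl.
      exact: cvg_harmonic.
    have : expR (- (n.+1%:R^-1 * w)) @[n --> \oo] --> expR (0 : R).
      by apply: continuous_cvg => //; exact: continuous_expR.
    by rewrite expR0.
  apply: cvg_near_cst; apply: nearW => n.
  by rewrite /expw patchE (negbTE w0) mul0r.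
have e0 n : 0 < n.+1%:R^-1 :> R by rewrite invr_gt0.
have bal n : (2%:E * W n + oscillation n.+1%:R^-1 u = \int[mu]_x (u x ^+ 2)%:E)%E.
  exact: energy_balance.
have c1 : (2%:E * W n + oscillation n.+1%:R^-1 u)%E @[n --> \oo] -->
  (2%:E * (\int[mu]_(w in `[0%R, +oo[) (E w)%:E) + 0)%E.
  apply: cvgeD.
  - by rewrite fin_num_adde_defl.
  - exact: cvgeZl.
  - exact: oscillation_cvg0.
have c2 : (2%:E * W n + oscillation n.+1%:R^-1 u)%E @[n --> \oo] -->
  (\int[mu]_x (u x ^+ 2)%:E)%E.
  by apply: cvg_near_cst; exact: nearW.
have := cvg_unique _ c1 c2; rewrite adde0 => -> //.
Qed.

Lemma integral_line_reflect (G : RM -> \bar R) : measurable_fun setT G ->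
  (forall w, 0 <= G w)%E ->
  (\int[mu]_w G w = \int[mu]_(w in `[0%R, +oo[) (G w + G (- w)%R))%E.
Proof.
move=> mG G0.
have mGN : measurable_fun [set: RM] (fun w : RM => G (- w)).
  by apply: (measurableT_comp mG).
have -> : [set: RM] = `]-oo, 0[%classic `|` `[0, +oo[%classic.
  apply/seteqP; split => // x _ /=; rewrite !in_itv/= andbT.
  by case: (ltP x 0); [left|right].
rewrite ge0_integral_setU//=; last 2 first.
- by apply: measurable_funTS.
- rewrite disj_set2E; apply/eqP/seteqP; split => // x []/=.
  by rewrite !in_itv/= andbT leNgt => ->.
rewrite integral_itv_bndo_bndc; last exact: measurable_funTS.
rewrite ge0_integralD//; first last.
- exact: measurable_funTS.
- exact: measurable_funTS.
rewrite addeC; congr (_ + _)%E.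
rewrite (ge0_integration_by_substitution0 mGN)//.
by apply: eq_integral => w _; rewrite opprK.
Qed.

Definition lineRe (u v : RM -> R) (w : R) : R := \int[mu]_x
  (u x * cos (2 * pi * (x * w)) + v x * sin (2 * pi * (x * w))).
Definition lineIm (u v : RM -> R) (w : R) : R := \int[mu]_x
  (v x * cos (2 * pi * (x * w)) - u x * sin (2 * pi * (x * w))).

(** The real and imaginary parts of the transform of u + i v mix cosine and sine
    transforms of u and v.  Adding the energies at w and -w cancels the cross
    terms, because cosT is even and sinT is odd; what is left is
    plancherel_half_line for u and for v. *)
Theorem plancherel_line (u v : RM -> R) : mu.-integrable setT (EFin \o u) ->
  mu.-integrable setT (EFin \o v) ->
  (\int[mu]_x (u x ^+ 2 + v x ^+ 2)%:E < +oo)%E ->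
  (\int[mu]_w (lineRe u v w ^+ 2 + lineIm u v w ^+ 2)%:E =
   \int[mu]_x (u x ^+ 2 + v x ^+ 2)%:E)%E.
Proof.
move=> iu iv uv2.
have mu_ : measurable_fun setT u by case/integrableP : iu => /measurable_EFinP.
have mv : measurable_fun setT v by case/integrableP : iv => /measurable_EFinP.
have ic (f : RM -> R) w : mu.-integrable setT (EFin \o f) ->
    mu.-integrable setT (EFin \o (fun x => f x * cos (2 * pi * (x * w)))).
  move=> intf; apply: (@integrableM_bounded _ _ _ _ _ _ 1) => //.
    exact: (measurableT_comp mcos2 (measurable_pair1 w)).
  by move=> x; rewrite ler_norml cos_geN1 cos_le1.
have is_ (f : RM -> R) w : mu.-integrable setT (EFin \o f) ->
    mu.-integrable setT (EFin \o (fun x => f x * sin (2 * pi * (x * w)))).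
  move=> intf; apply: (@integrableM_bounded _ _ _ _ _ _ 1) => //.
    exact: (measurableT_comp msin2 (measurable_pair1 w)).
  by move=> x; rewrite ler_norml sin_geN1 sin_le1.
have ReE w : lineRe u v w = cosT u w + sinT v w.
  by rewrite /lineRe RintegralD//; [exact: ic|exact: is_].
have ImE w : lineIm u v w = cosT v w - sinT u w.
  by rewrite /lineIm RintegralB//; [exact: ic|exact: is_].
have cosN (f : RM -> R) w : cosT f (- w) = cosT f w.
  by apply: eq_Rintegral => x _; rewrite !mulrN cosN.
have sinN (f : RM -> R) w : mu.-integrable setT (EFin \o f) -> sinT f (- w) = - sinT f w.
  move=> intf; rewrite -[RHS]mulN1r -RintegralZl//; last exact: is_.
  by apply: eq_Rintegral => x _; rewrite !mulrN sinN mulrN mulN1r.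
have mRe : measurable_fun [set: RM] (lineRe u v).
  rewrite (_ : lineRe u v = cosT u \+ sinT v); last by apply/funext => w; exact: ReE.
  by apply: measurable_funD; [exact: measurable_cosT|exact: measurable_sinT].
have mIm : measurable_fun [set: RM] (lineIm u v).
  rewrite (_ : lineIm u v = cosT v \- sinT u); last by apply/funext => w; exact: ImE.
  by apply: measurable_funB; [exact: measurable_cosT|exact: measurable_sinT].
have mu2 : measurable_fun setT (fun x => u x ^+ 2) by exact: measurable_funX.
have mv2 : measurable_fun setT (fun x => v x ^+ 2) by exact: measurable_funX.
have Iuv : (\int[mu]_x (u x ^+ 2 + v x ^+ 2)%:E =
    \int[mu]_x (u x ^+ 2)%:E + \int[mu]_x (v x ^+ 2)%:E)%E.
  under eq_integral do rewrite EFinD.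
  rewrite ge0_integralD//.
  - by move=> x _; rewrite lee_fin sqr_ge0.
  - exact/measurable_EFinP.
  - by move=> x _; rewrite lee_fin sqr_ge0.
  - exact/measurable_EFinP.
have I0 (f : RM -> R) : (0 <= \int[mu]_x (f x ^+ 2)%:E)%E.
  by apply: integral_ge0 => x _; rewrite lee_fin sqr_ge0.
have u2 : (\int[mu]_x (u x ^+ 2)%:E < +oo)%E.
  by apply: le_lt_trans uv2; rewrite Iuv leeDl.
have v2 : (\int[mu]_x (v x ^+ 2)%:E < +oo)%E.
  by apply: le_lt_trans uv2; rewrite Iuv leeDr.
rewrite integral_line_reflect; first last.
- by move=> w; rewrite lee_fin addr_ge0// sqr_ge0.
- by apply/measurable_EFinP; apply: measurable_funD; apply: measurable_funX.
rewrite Iuv -(plancherel_half_line iu u2) -(plancherel_half_line iv v2).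
have mE (f : RM -> R) : measurable_fun setT f ->
    measurable_fun [set: RM] (fun w => cosT f w ^+ 2 + sinT f w ^+ 2).
  move=> mf; apply: measurable_funD; apply: measurable_funX.
    exact: measurable_cosT.
  exact: measurable_sinT.
have E0 (f : RM -> R) w : 0 <= cosT f w ^+ 2 + sinT f w ^+ 2.
  by rewrite addr_ge0// sqr_ge0.
have mEp (f : RM -> R) : measurable_fun setT f ->
    measurable_fun (`[0, +oo[%classic : set RM)
      (fun w => (cosT f w ^+ 2 + sinT f w ^+ 2)%:E).
  by move=> mf; apply: measurable_funTS; apply/measurable_EFinP; exact: mE.
rewrite -!ge0_integralZl_EFin//; try by [exact: mEp|move=> w _; rewrite lee_fin].
rewrite -ge0_integralD//; first last.
- apply/measurable_EFinP; apply: measurable_funM => //.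
  by apply: measurable_funTS; exact: mE.
- by move=> w _; rewrite lee_fin mulr_ge0.
- apply/measurable_EFinP; apply: measurable_funM => //.
  by apply: measurable_funTS; exact: mE.
- by move=> w _; rewrite lee_fin mulr_ge0.
apply: eq_integral => w _; rewrite -!EFinM -!EFinD; congr EFin.
by rewrite !ReE !ImE !cosN !sinN//; ring.
Qed.

End plancherel_line.

(** * Plancherel's identity on products and on tuples *)

Section phase_transform.
Context d (T : measurableType d) (R : realType).
Variables (m : {sigma_finite_measure set T -> \bar R}) (theta : T * T -> R).

(** Real and imaginary part of the integral of (u + i v) exp(-i theta(x, w)).
    Keeping the phase theta abstract lets one induction cover all dimensions. *)
Definition phase_re (u v : T -> R) (w : T) : R :=
  \int[m]_x (u x * cos (theta (x, w)) + v x * sin (theta (x, w))).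

Definition phase_im (u v : T -> R) (w : T) : R :=
  \int[m]_x (v x * cos (theta (x, w)) - u x * sin (theta (x, w))).

Definition is_plancherel := forall u v : T -> R,
  m.-integrable setT (EFin \o u) -> m.-integrable setT (EFin \o v) ->
  (\int[m]_x (u x ^+ 2 + v x ^+ 2)%:E < +oo)%E ->
  (\int[m]_w (phase_re u v w ^+ 2 + phase_im u v w ^+ 2)%:E =
   \int[m]_x (u x ^+ 2 + v x ^+ 2)%:E)%E.

Lemma measurable_cos_phase d' (T' : measurableType d') (h : T' -> R) :
  measurable_fun setT h -> measurable_fun setT (fun x => cos (h x)).
Proof.
exact: (measurableT_comp (continuous_measurable_fun (@continuous_cos R))).
Qed.

Lemma measurable_sin_phase d' (T' : measurableType d') (h : T' -> R) :
  measurable_fun setT h -> measurable_fun setT (fun x => sin (h x)).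
Proof.
exact: (measurableT_comp (continuous_measurable_fun (@continuous_sin R))).
Qed.

Lemma integrable_phase_re d' (T' : measurableType d')
    (nu : {measure set T' -> \bar R}) (u v h : T' -> R) :
  nu.-integrable setT (EFin \o u) -> nu.-integrable setT (EFin \o v) ->
  measurable_fun setT h ->
  nu.-integrable setT (EFin \o (fun x => u x * cos (h x) + v x * sin (h x))).
Proof.
move=> iu iv mh; apply: (@integrableD _ _ _ nu setT measurableT
  (EFin \o (fun x => u x * cos (h x))) (EFin \o (fun x => v x * sin (h x)))).
  apply: (@integrableM_bounded _ _ _ _ _ _ 1) => //.
    exact: measurable_cos_phase.
  by move=> x; rewrite ler_norml cos_geN1 cos_le1.
apply: (@integrableM_bounded _ _ _ _ _ _ 1) => //.
  exact: measurable_sin_phase.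
by move=> x; rewrite ler_norml sin_geN1 sin_le1.
Qed.

Lemma integrable_phase_im d' (T' : measurableType d')
    (nu : {measure set T' -> \bar R}) (u v h : T' -> R) :
  nu.-integrable setT (EFin \o u) -> nu.-integrable setT (EFin \o v) ->
  measurable_fun setT h ->
  nu.-integrable setT (EFin \o (fun x => v x * cos (h x) - u x * sin (h x))).
Proof.
move=> iu iv mh; apply: (@integrableB _ _ _ nu setT measurableT
  (EFin \o (fun x => v x * cos (h x))) (EFin \o (fun x => u x * sin (h x)))).
  apply: (@integrableM_bounded _ _ _ _ _ _ 1) => //.
    exact: measurable_cos_phase.
  by move=> x; rewrite ler_norml cos_geN1 cos_le1.
apply: (@integrableM_bounded _ _ _ _ _ _ 1) => //.
  exact: measurable_sin_phase.
by move=> x; rewrite ler_norml sin_geN1 sin_le1.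
Qed.

Hypothesis mtheta : measurable_fun setT theta.

Let mtheta' : measurable_fun setT (fun z : T * T => theta (z.2, z.1)).
Proof. by apply: (measurableT_comp mtheta); exact: measurable_fun_pair. Qed.

Let msnd (f : T -> R) : measurable_fun setT f ->
  measurable_fun setT (fun z : T * T => f z.2).
Proof. by move=> mf; exact: (measurableT_comp mf). Qed.

Lemma measurable_phase_re u v : measurable_fun setT u -> measurable_fun setT v ->
  measurable_fun setT (phase_re u v).
Proof.
move=> mu_ mv; apply: (@measurable_Rintegral_snd _ _ T T R m (fun z =>
  u z.2 * cos (theta (z.2, z.1)) + v z.2 * sin (theta (z.2, z.1)))).
apply: measurable_funD; apply: measurable_funM; try exact: msnd.
  exact: measurable_cos_phase.
exact: measurable_sin_phase.
Qed.

Lemma measurable_phase_im u v : measurable_fun setT u -> measurable_fun setT v ->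
  measurable_fun setT (phase_im u v).
Proof.
move=> mu_ mv; apply: (@measurable_Rintegral_snd _ _ T T R m (fun z =>
  v z.2 * cos (theta (z.2, z.1)) - u z.2 * sin (theta (z.2, z.1)))).
apply: measurable_funB; apply: measurable_funM; try exact: msnd.
  exact: measurable_cos_phase.
exact: measurable_sin_phase.
Qed.

End phase_transform.

Section plancherel_tensor.
Context d1 d2 (T1 : measurableType d1) (T2 : measurableType d2) (R : realType).
Variables (m1 : {sigma_finite_measure set T1 -> \bar R})
          (m2 : {sigma_finite_measure set T2 -> \bar R}).
Variables (th1 : T1 * T1 -> R) (th2 : T2 * T2 -> R).
Hypotheses (mth1 : measurable_fun setT th1) (mth2 : measurable_fun setT th2).
Hypotheses (P1 : is_plancherel m1 th1) (P2 : is_plancherel m2 th2).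

(** The phase of a product space: the exponentials of the two factors multiply. *)
Definition phase_sum (z : (T1 * T2) * (T1 * T2)) : R :=
  th1 (z.1.1, z.2.1) + th2 (z.1.2, z.2.2).

Lemma measurable_phase_sum : measurable_fun setT phase_sum.
Proof.
apply: measurable_funD.
  apply: (measurableT_comp mth1); apply: measurable_fun_pair => //.
    by apply: (measurableT_comp measurable_fst).
  by apply: (measurableT_comp measurable_fst).
apply: (measurableT_comp mth2); apply: measurable_fun_pair => //.
  by apply: (measurableT_comp measurable_snd).
by apply: (measurableT_comp measurable_snd).
Qed.

Let m12 := product_sfm m1 m2.

Section fixed.
Variables u v : T1 * T2 -> R.
Hypotheses (iu : m12.-integrable setT (EFin \o u))
           (iv : m12.-integrable setT (EFin \o v)).

Let gR x w2 := phase_re m2 th2 (fun y => u (x, y)) (fun y => v (x, y)) w2.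
Let gI x w2 := phase_im m2 th2 (fun y => u (x, y)) (fun y => v (x, y)) w2.

Let mu_ : measurable_fun setT u.
Proof. by case/integrableP : iu => /measurable_EFinP. Qed.
Let mv : measurable_fun setT v.
Proof. by case/integrableP : iv => /measurable_EFinP. Qed.

Let mth1w w : measurable_fun setT (fun x => th1 (x, w)).
Proof. exact: (measurableT_comp mth1 (measurable_pair2 w)). Qed.
Let mth2w w : measurable_fun setT (fun x => th2 (x, w)).
Proof. exact: (measurableT_comp mth2 (measurable_pair2 w)). Qed.

Let ae_iu : {ae m1, forall x, m2.-integrable setT (EFin \o (fun y => u (x, y)))}.
Proof. exact: (ae_integrable1 iu). Qed.
Let ae_iv : {ae m1, forall x, m2.-integrable setT (EFin \o (fun y => v (x, y)))}.
Proof. exact: (ae_integrable1 iv). Qed.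

Lemma integrable_gR w2 : m1.-integrable setT (EFin \o (gR ^~ w2)).
Proof.
apply: (@integrable_Rintegral_F _ _ _ _ _ m1 m2 (fun z =>
  u z * cos (th2 (z.2, w2)) + v z * sin (th2 (z.2, w2)))).
apply: integrable_phase_re => //; exact: (measurableT_comp (mth2w w2)).
Qed.

Lemma integrable_gI w2 : m1.-integrable setT (EFin \o (gI ^~ w2)).
Proof.
apply: (@integrable_Rintegral_F _ _ _ _ _ m1 m2 (fun z =>
  v z * cos (th2 (z.2, w2)) - u z * sin (th2 (z.2, w2)))).
apply: integrable_phase_im => //; exact: (measurableT_comp (mth2w w2)).
Qed.

Let mzx (f : T1 * T2 -> R) : measurable_fun setT f ->
  measurable_fun setT (fun q : (T1 * T2) * T2 => f (q.1.1, q.2)).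
Proof.
move=> mf; apply: (measurableT_comp mf); apply: measurable_fun_pair => //.
by apply: (measurableT_comp measurable_fst).
Qed.

Let mth2q : measurable_fun setT (fun q : (T1 * T2) * T2 => th2 (q.2, q.1.2)).
Proof.
apply: (measurableT_comp mth2); apply: measurable_fun_pair => //.
by apply: (measurableT_comp measurable_snd).
Qed.

Let mgR : measurable_fun setT (fun z : T1 * T2 => gR z.1 z.2).
Proof.
apply: (@measurable_Rintegral_snd _ _ (T1 * T2)%type T2 R m2 (fun q =>
  u (q.1.1, q.2) * cos (th2 (q.2, q.1.2)) + v (q.1.1, q.2) * sin (th2 (q.2, q.1.2)))).
apply: measurable_funD; apply: measurable_funM; try exact: mzx.
  exact: measurable_cos_phase.
exact: measurable_sin_phase.
Qed.

Let mgI : measurable_fun setT (fun z : T1 * T2 => gI z.1 z.2).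
Proof.
apply: (@measurable_Rintegral_snd _ _ (T1 * T2)%type T2 R m2 (fun q =>
  v (q.1.1, q.2) * cos (th2 (q.2, q.1.2)) - u (q.1.1, q.2) * sin (th2 (q.2, q.1.2)))).
apply: measurable_funB; apply: measurable_funM; try exact: mzx.
  exact: measurable_cos_phase.
exact: measurable_sin_phase.
Qed.

Lemma phase_re_iterated w1 w2 : phase_re m12 phase_sum u v (w1, w2) =
  phase_re m1 th1 (gR ^~ w2) (gI ^~ w2) w1.
Proof.
pose H (z : T1 * T2) := u z * cos (th1 (z.1, w1) + th2 (z.2, w2)) +
  v z * sin (th1 (z.1, w1) + th2 (z.2, w2)).
have iH : (m1 \x m2)%E.-integrable setT (EFin \o H).
  apply: (integrable_phase_re iu iv); apply: measurable_funD.
    exact: (measurableT_comp (mth1w w1)).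
  exact: (measurableT_comp (mth2w w2)).
rewrite /phase_re /Rintegral; congr fine.
transitivity (\int[m1 \x m2]_z (H z)%:E)%E; first by [].
rewrite -(integral_Rintegral_F iH); apply: ae_eq_integral => //.
- apply: (measurable_int m1); exact: (integrable_Rintegral_F iH).
- apply: (measurable_int m1).
  exact: (integrable_phase_re (integrable_gR w2) (integrable_gI w2)).
apply: filterS2 ae_iu ae_iv => x iux ivx _; congr EFin.
have iR := integrable_phase_re iux ivx (mth2w w2).
have iI := integrable_phase_im iux ivx (mth2w w2).
rewrite mulrC [gI x w2 * _]mulrC /gR /gI /phase_re /phase_im -!RintegralZl//.
rewrite -RintegralD//; first last.
- exact: (integrableZl measurableT _ iI).
- exact: (integrableZl measurableT _ iR).
apply: eq_Rintegral => y _; rewrite /H/= cosD sinD; ring.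
Qed.

Lemma phase_im_iterated w1 w2 : phase_im m12 phase_sum u v (w1, w2) =
  phase_im m1 th1 (gR ^~ w2) (gI ^~ w2) w1.
Proof.
pose H (z : T1 * T2) := v z * cos (th1 (z.1, w1) + th2 (z.2, w2)) -
  u z * sin (th1 (z.1, w1) + th2 (z.2, w2)).
have iH : (m1 \x m2)%E.-integrable setT (EFin \o H).
  apply: (integrable_phase_im iu iv); apply: measurable_funD.
    exact: (measurableT_comp (mth1w w1)).
  exact: (measurableT_comp (mth2w w2)).
rewrite /phase_im /Rintegral; congr fine.
transitivity (\int[m1 \x m2]_z (H z)%:E)%E; first by [].
rewrite -(integral_Rintegral_F iH); apply: ae_eq_integral => //.
- apply: (measurable_int m1); exact: (integrable_Rintegral_F iH).
- apply: (measurable_int m1).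
  exact: (integrable_phase_im (integrable_gR w2) (integrable_gI w2)).
apply: filterS2 ae_iu ae_iv => x iux ivx _; congr EFin.
have iR := integrable_phase_re iux ivx (mth2w w2).
have iI := integrable_phase_im iux ivx (mth2w w2).
rewrite mulrC [gR x w2 * _]mulrC /gR /gI /phase_re /phase_im -!RintegralZl//.
rewrite -RintegralB//; first last.
- exact: (integrableZl measurableT _ iR).
- exact: (integrableZl measurableT _ iI).
apply: eq_Rintegral => y _; rewrite /H/= cosD sinD; ring.
Qed.

Hypothesis uv2 : (\int[m12]_z (u z ^+ 2 + v z ^+ 2)%:E < +oo)%E.

Let sq_ge0 (a b : R) : (0 <= (a ^+ 2 + b ^+ 2)%:E)%E.
Proof. by rewrite lee_fin addr_ge0// sqr_ge0. Qed.

Let muv2 : measurable_fun setT (fun z => (u z ^+ 2 + v z ^+ 2)%:E).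
Proof. by apply/measurable_EFinP; apply: measurable_funD; exact: measurable_funX. Qed.

Let mg2 : measurable_fun setT (fun z : T1 * T2 => (gR z.1 z.2 ^+ 2 + gI z.1 z.2 ^+ 2)%:E).
Proof. by apply/measurable_EFinP; apply: measurable_funD; exact: measurable_funX. Qed.

Lemma energy_snd :
  (\int[m1]_x \int[m2]_w2 (gR x w2 ^+ 2 + gI x w2 ^+ 2)%:E =
   \int[m12]_z (u z ^+ 2 + v z ^+ 2)%:E)%E.
Proof.
have -> : (\int[m12]_z (u z ^+ 2 + v z ^+ 2)%:E =
    \int[m1]_x \int[m2]_y (u (x, y) ^+ 2 + v (x, y) ^+ 2)%:E)%E.
  exact: (fubini_tonelli1 (m1 := m1) _ muv2 (fun z => sq_ge0 _ _)).
apply: ae_eq_integral => //.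
- exact: (measurable_fun_fubini_tonelli_F (m2 := m2) _ mg2).
- exact: (measurable_fun_fubini_tonelli_F (m2 := m2) _ muv2).
have : {ae m1, forall x, (\int[m2]_y (u (x, y) ^+ 2 + v (x, y) ^+ 2)%:E < +oo)%E}.
  have := @integrable_ae _ _ _ m1 _ measurableT
    (fun x => (\int[m2]_y (u (x, y) ^+ 2 + v (x, y) ^+ 2)%:E)%E).
  case.
    apply/integrableP; split.
      exact: (measurable_fun_fubini_tonelli_F (m2 := m2) _ muv2).
    under eq_integral do rewrite gee0_abs ?integral_ge0//.
    apply: le_lt_trans uv2.
    by rewrite [leRHS](fubini_tonelli1 (m1 := m1) _ muv2 (fun z => sq_ge0 _ _)).
  move=> A [mA A0 sA]; exists A; split => // x /= nx; apply: sA => /= fx; apply: nx.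
  by have := fx I; rewrite fin_numE => /andP[_]; rewrite -ltey.
apply: filterS3 ae_iu ae_iv => x iux ivx xy _.
exact: P2.
Qed.

Lemma plancherel_tensor_fixed :
  (\int[m12]_w (phase_re m12 phase_sum u v w ^+ 2 +
                phase_im m12 phase_sum u v w ^+ 2)%:E =
   \int[m12]_z (u z ^+ 2 + v z ^+ 2)%:E)%E.
Proof.
have mRI : measurable_fun setT (fun w => (phase_re m12 phase_sum u v w ^+ 2 +
    phase_im m12 phase_sum u v w ^+ 2)%:E).
  apply/measurable_EFinP; apply: measurable_funD; apply: measurable_funX.
    by apply: measurable_phase_re => //; exact: measurable_phase_sum.
  by apply: measurable_phase_im => //; exact: measurable_phase_sum.
have swap : (\int[m2]_w2 \int[m1]_x (gR x w2 ^+ 2 + gI x w2 ^+ 2)%:E =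
    \int[m1]_x \int[m2]_w2 (gR x w2 ^+ 2 + gI x w2 ^+ 2)%:E)%E.
  exact: (esym (fubini_tonelli (m1 := m1) (m2 := m2) _ mg2 (fun z => sq_ge0 _ _))).
have fin_ae : {ae m2, forall w2,
    (\int[m1]_x (gR x w2 ^+ 2 + gI x w2 ^+ 2)%:E < +oo)%E}.
  have := @integrable_ae _ _ _ m2 _ measurableT
    (fun w2 => (\int[m1]_x (gR x w2 ^+ 2 + gI x w2 ^+ 2)%:E)%E).
  case.
    apply/integrableP; split.
      exact: (measurable_fun_fubini_tonelli_G (m1 := m1) _ mg2).
    under eq_integral do rewrite gee0_abs ?integral_ge0//.
    by rewrite swap energy_snd.
  move=> A [mA A0 sA]; exists A; split => // x /= nx; apply: sA => /= fx; apply: nx.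
  by have := fx I; rewrite fin_numE => /andP[_]; rewrite -ltey.
transitivity (\int[m2]_w2 \int[m1]_w1 (phase_re m12 phase_sum u v (w1, w2) ^+ 2 +
    phase_im m12 phase_sum u v (w1, w2) ^+ 2)%:E)%E.
  exact: (fubini_tonelli2 (m1 := m1) (m2 := m2) _ mRI (fun z => sq_ge0 _ _)).
rewrite -energy_snd -swap; apply: ae_eq_integral => //.
- exact: (measurable_fun_fubini_tonelli_G (m1 := m1) _ mRI).
- exact: (measurable_fun_fubini_tonelli_G (m1 := m1) _ mg2).
apply: filterS fin_ae => w2 fw2 _.
under eq_integral do rewrite phase_re_iterated phase_im_iterated.
exact: (P1 (integrable_gR w2) (integrable_gI w2)).
Qed.

End fixed.

(** Transform in the second variable for fixed first variable, then in the first
    variable for fixed second frequency: each step preserves the energy for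
    almost every value of the fixed variable, and Tonelli's theorem lets the two
    steps be chained. *)
Theorem plancherel_tensor : is_plancherel m12 phase_sum.
Proof. by move=> u v iu iv uv2; exact: plancherel_tensor_fixed. Qed.

End plancherel_tensor.

Section plancherel_tuple.
Context {R : realType}.
Notation mu := (@lebesgue_measure R).
Notation RM := (measurableTypeR R).
Notation Rn n := (n.-tuple RM).
Notation lambda n := (@lebesgue_tuple R n).

Definition dot_phase n (z : Rn n * Rn n) : R := 2 * pi * dotp z.1 z.2.

Lemma dotp_cons n (x y : RM) (s t : Rn n) :
  dotp [tuple of x :: s] [tuple of y :: t] = x * y + dotp s t.
Proof.
rewrite /dotp big_ord_recl !(tnth_nth 0)/=; congr (_ + _).
by apply: eq_bigr => i _; rewrite !(tnth_nth 0).
Qed.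

Lemma measurable_dotp n : measurable_fun setT (fun z : Rn n * Rn n => dotp z.1 z.2).
Proof.
rewrite /dotp; apply: measurable_sum => i; apply: measurable_funM.
  apply: (measurableT_comp (measurable_tnth i)); exact: measurable_fst.
by apply: (measurableT_comp (measurable_tnth i)); exact: measurable_snd.
Qed.

Lemma measurable_dot_phase n : measurable_fun setT (@dot_phase n).
Proof. by apply: measurable_funM => //; exact: measurable_dotp. Qed.

Lemma ge0_integral_lebesgue_cons n (f : Rn n.+1 -> \bar R) :
  measurable_fun setT f -> (forall t, 0 <= f t)%E ->
  (\int[lambda n.+1]_t f t =
   \int[mu \x lambda n]_p f (cons_pair p))%E.
Proof.
move=> mf f0.
rewrite -(ge0_integral_pushforward (measurable_cons_pair (n := n))
   (mu \x lambda n)%E measurableT mf)//.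
Qed.

Lemma integrable_lebesgue_cons n (f : Rn n.+1 -> \bar R) :
  (lambda n.+1).-integrable setT f ->
  (mu \x lambda n)%E.-integrable setT (f \o @cons_pair R n).
Proof.
move=> /integrableP[mf If]; apply/integrableP; split.
  exact: (measurableT_comp mf (measurable_cons_pair (n := n))).
rewrite ge0_integral_lebesgue_cons// in If.
exact: measurableT_comp.
Qed.

Lemma Rintegral_lebesgue_cons n (f : Rn n.+1 -> R) :
  (lambda n.+1).-integrable setT (EFin \o f) ->
  \int[lambda n.+1]_t f t =
   \int[product_sfm mu (lambda n)]_p f (cons_pair p).
Proof.
move=> intf; rewrite /Rintegral; congr fine.
have /integrableP[mf _] := intf.
exact: (integral_pushforward (measurable_cons_pair (n := n))
  (mu := (mu \x lambda n)%E) mf (integrable_lebesgue_cons intf) measurableT).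
Qed.

(** In dimension 0 the transform is the identity on functions of one point; the
    step splits off the first coordinate. *)
Theorem plancherel_tuple n : is_plancherel (lambda n) (@dot_phase n).
Proof.
have mphw k w : measurable_fun setT (fun x : Rn k => dot_phase (x, w)).
  exact: (measurableT_comp (@measurable_dot_phase k) (measurable_pair2 w)).
elim: n => [|n IHn].
  move=> u v iu iv uv2; have mu_ : measurable_fun setT u.
    by case/integrableP : iu => /measurable_EFinP.
  have mv : measurable_fun setT v by case/integrableP : iv => /measurable_EFinP.
  have dphase (x w : Rn 0) : dot_phase (x, w) = 0.
    by rewrite /dot_phase /dotp big_ord0 mulr0.
  have int0 (f : Rn 0 -> R) : measurable_fun setT f ->
      (\int[lambda 0]_x (f x)%:E = (f [tuple])%:E)%E.
    move=> mf; rewrite [LHS]integral_dirac ?diracT ?mul1e//.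
    exact/measurable_EFinP.
  have ReE w : phase_re (lambda 0) (@dot_phase 0) u v w = u [tuple].
    rewrite /phase_re /Rintegral int0 ?dphase ?cos0 ?sin0 ?mulr1 ?mulr0 ?addr0//.
    apply: measurable_funD; apply: measurable_funM => //.
      exact: (measurable_cos_phase (mphw 0%N w)).
    exact: (measurable_sin_phase (mphw 0%N w)).
  have ImE w : phase_im (lambda 0) (@dot_phase 0) u v w = v [tuple].
    rewrite /phase_im /Rintegral int0 ?dphase ?cos0 ?sin0 ?mulr1 ?mulr0 ?subr0//.
    apply: measurable_funB; apply: measurable_funM => //.
      exact: (measurable_cos_phase (mphw 0%N w)).
    exact: (measurable_sin_phase (mphw 0%N w)).
  under eq_integral do rewrite ReE ImE.
  rewrite int0// int0//.
  by apply: measurable_funD; apply: measurable_funX.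
move=> u v iu iv uv2.
have mu_ : measurable_fun setT u by case/integrableP : iu => /measurable_EFinP.
have mv : measurable_fun setT v by case/integrableP : iv => /measurable_EFinP.
pose line_phase (z : RM * RM) : R := 2 * pi * (z.1 * z.2).
have mline : measurable_fun setT line_phase.
  by apply: measurable_funM => //; exact: measurable_funM.
have PT : is_plancherel (product_sfm mu (lambda n))
    (phase_sum line_phase (@dot_phase n)).
  apply: plancherel_tensor => //; first exact: measurable_dot_phase.
  by move=> f g; exact: plancherel_line.
have phaseE (p q : RM * Rn n) : dot_phase (cons_pair p, cons_pair q) =
    phase_sum line_phase (@dot_phase n) (p, q).
  by rewrite /phase_sum /dot_phase /line_phase/= dotp_cons mulrDr.
have ReE q : phase_re (lambda n.+1) (@dot_phase n.+1) u v (cons_pair q) =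
    phase_re (product_sfm mu (lambda n)) (phase_sum line_phase (@dot_phase n))
      (u \o @cons_pair R n) (v \o @cons_pair R n) q.
  rewrite /phase_re Rintegral_lebesgue_cons; last first.
    exact: (integrable_phase_re iu iv (mphw _ (cons_pair q))).
  by apply: eq_Rintegral => p _; rewrite !phaseE.
have ImE q : phase_im (lambda n.+1) (@dot_phase n.+1) u v (cons_pair q) =
    phase_im (product_sfm mu (lambda n)) (phase_sum line_phase (@dot_phase n))
      (u \o @cons_pair R n) (v \o @cons_pair R n) q.
  rewrite /phase_im Rintegral_lebesgue_cons; last first.
    exact: (integrable_phase_im iu iv (mphw _ (cons_pair q))).
  by apply: eq_Rintegral => p _; rewrite !phaseE.
have sq_ge0 (a b : R) : (0 <= (a ^+ 2 + b ^+ 2)%:E)%E.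
  by rewrite lee_fin addr_ge0// sqr_ge0.
have muv2 : measurable_fun setT (fun z => (u z ^+ 2 + v z ^+ 2)%:E).
  by apply/measurable_EFinP; apply: measurable_funD; exact: measurable_funX.
rewrite [RHS]ge0_integral_lebesgue_cons// [LHS]ge0_integral_lebesgue_cons//.
  under eq_integral do rewrite ReE ImE.
  apply: (PT (u \o @cons_pair R n) (v \o @cons_pair R n)).
  - exact: (integrable_lebesgue_cons iu).
  - exact: (integrable_lebesgue_cons iv).
  - by move: uv2; rewrite ge0_integral_lebesgue_cons.
apply/measurable_EFinP; apply: measurable_funD; apply: measurable_funX.
  by apply: measurable_phase_re => //; exact: measurable_dot_phase.
by apply: measurable_phase_im => //; exact: measurable_dot_phase.
Qed.

End plancherel_tuple.

(** * Energies of complex functions *)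

Import ComplexField.Normc.
Local Open Scope complex_scope.

Section L2_basics.
Context d (T : measurableType d) (R : realType).
Variable mu : {measure set T -> \bar R}.
Implicit Types (f g : T -> R[i]) (F G : L2 mu).

(** The square of the L^2 norm as an extended real.  It makes sense for every
    function, so that no membership in L^2 has to be carried along. *)
Definition energy (f : T -> R[i]) : \bar R := (\int[mu]_x (cabs f x ^+ 2)%:E)%E.

Lemma cabs_sqE f x : cabs f x ^+ 2 = complex.Re (f x) ^+ 2 + complex.Im (f x) ^+ 2.
Proof.
by rewrite /cabs/=; case: (f x) => a b /=; rewrite sqr_sqrtr// addr_ge0// sqr_ge0.
Qed.

Lemma norm_Re_le_cabs f x : `|complex.Re (f x)| <= cabs f x.
Proof.
rewrite -(@ler_pXn2r _ 2) ?nnegrE ?cabs_ge0// real_normK ?num_real//.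
by rewrite cabs_sqE lerDl sqr_ge0.
Qed.

Lemma norm_Im_le_cabs f x : `|complex.Im (f x)| <= cabs f x.
Proof.
rewrite -(@ler_pXn2r _ 2) ?nnegrE ?cabs_ge0// real_normK ?num_real//.
by rewrite cabs_sqE lerDr sqr_ge0.
Qed.

Lemma energy_ge0 f : (0 <= energy f)%E.
Proof. by apply: integral_ge0 => x _; rewrite lee_fin sqr_ge0. Qed.

Lemma measurable_cabs_sq f : cmeasurable f -> measurable_fun setT (fun x => cabs f x ^+ 2).
Proof. by move=> mf; apply: measurable_funX; exact: measurable_cabs. Qed.

Lemma Lnorm2_energy f : ('N[mu]_2%:E[EFin \o cabs f] `^ 2)%E = energy f.
Proof.
rewrite poweR_Lnorm//; apply: eq_integral => x _ /=.
by rewrite ger0_norm ?cabs_ge0// powR_mulrn// cabs_ge0.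
Qed.

Lemma L2predE f : cmeasurable f -> (f \in L2pred mu) = (energy f < +oo)%E.
Proof.
move=> mf; apply/L2predP/idP => [[_]|ef]; rewrite -?Lnorm2_energy.
  by move=> Nf; rewrite poweR_lty.
split=> //; rewrite /finite_norm.
move: ef; rewrite -Lnorm2_energy.
have : (0 <= 'N[mu]_2%:E[EFin \o cabs f])%E by exact: Lnorm_ge0.
by move=> _; rewrite !ltey; apply: contraNN => /eqP ->; rewrite poweRyr.
Qed.

Lemma pi_ae (u : L2fun mu) : {ae mu, forall x, ((\pi_(L2 mu) u)%qT : L2 mu) x = u x}.
Proof.
rewrite /L2_to_fun; set v := repr _.
have /L2nullP uv : v - u \in L2null (mu := mu).
  by rewrite Quotient.idealrBE reprK.
apply: filterS uv => x vux.
by apply/eqP; rewrite -subr_eq0; apply/eqP.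
Qed.

Lemma cmeasurable_L2 F : cmeasurable F.
Proof. by have /L2predP[] := L2funP (repr F). Qed.

Lemma energy_L2_lty F : (energy F < +oo)%E.
Proof.
by rewrite -L2predE; [exact: (L2funP (repr F))|exact: cmeasurable_L2].
Qed.

Lemma energyE F : energy F = (`|F| ^+ 2)%:E.
Proof.
rewrite -Lnorm2_energy.
have -> : ('N[mu]_2%:E[EFin \o cabs F])%E = `|F|%:E.
  by have := L2normE (repr F); rewrite reprK => <-.
by rewrite poweR_EFin powR_mulrn// normr_ge0.
Qed.

Lemma eq_ae_energy f g : cmeasurable f -> cmeasurable g ->
  {ae mu, forall x, f x = g x} -> energy f = energy g.
Proof.
move=> mf mg fg; apply: ae_eq_integral => //.
- by apply/measurable_EFinP; exact: measurable_cabs_sq.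
- by apply/measurable_EFinP; exact: measurable_cabs_sq.
- by apply: filterS fg => x fgx _; rewrite /cabs/= fgx.
Qed.

(** Elements of L2 are classes; this is how concrete functions enter the space. *)
Lemma ex_L2 f : cmeasurable f -> (energy f < +oo)%E ->
  exists F : L2 mu, {ae mu, forall x, F x = f x}.
Proof.
move=> mf; rewrite -L2predE// => Lf.
by exists (\pi_(L2 mu) (MkL2fun Lf))%qT; exact: pi_ae.
Qed.

Lemma L2B_ae F G : {ae mu, forall x, (F - G : L2 mu) x = F x - G x}.
Proof.
have -> : F - G = (\pi_(L2 mu) (repr F - repr G))%qT.
  by rewrite raddfB/= !reprK.
by apply: filterS (pi_ae (repr F - repr G)) => x ->.
Qed.

Lemma energyB F G : energy (fun x => F x - G x) = (`|F - G| ^+ 2)%:E.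
Proof.
rewrite -energyE; apply: eq_ae_energy.
- apply: cmeasurableD; first exact: cmeasurable_L2.
  by apply: cmeasurableN; exact: cmeasurable_L2.
- exact: cmeasurable_L2.
- by apply: filterS (L2B_ae F G) => x ->.
Qed.

Lemma energyD_le f g : cmeasurable f -> cmeasurable g ->
  (energy (fun x => (f x + g x)%R) <= 2%:E * energy f + 2%:E * energy g)%E.
Proof.
move=> mf mg.
have mf2 := measurable_cabs_sq mf; have mg2 := measurable_cabs_sq mg.
rewrite -!ge0_integralZl_EFin//; last first.
- exact/measurable_EFinP.
- by move=> x _; rewrite lee_fin sqr_ge0.
- exact/measurable_EFinP.
- by move=> x _; rewrite lee_fin sqr_ge0.
rewrite -ge0_integralD//; first last.
- by apply/measurable_EFinP; exact: measurable_funM.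
- by move=> x _; rewrite lee_fin mulr_ge0 ?sqr_ge0.
- by apply/measurable_EFinP; exact: measurable_funM.
- by move=> x _; rewrite lee_fin mulr_ge0 ?sqr_ge0.
apply: ge0_le_integral => //.
- by move=> x _; rewrite lee_fin sqr_ge0.
- by apply/measurable_EFinP; apply: measurable_cabs_sq; exact: cmeasurableD.
- by apply/measurable_EFinP; apply: measurable_funD; exact: measurable_funM.
move=> x _; rewrite -!EFinM -EFinD lee_fin !cabs_sqE 2!raddfD/=.
move: (complex.Re (f x)) (complex.Im (f x)) (complex.Re (g x)) (complex.Im (g x)) => a b c e.
by have := sqr_ge0 (a - c); have := sqr_ge0 (b - e); lra.
Qed.

End L2_basics.

(** * Completeness of L2 *)

Section fatou.
Context d (T : measurableType d) (R : realType).
Variable mu : {measure set T -> \bar R}.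

(** Fatou's lemma in the form used for Riesz-Fischer: the pointwise limit need
    only be given almost everywhere, and the bound only eventually. *)
Lemma fatou_ae_le (h : (T -> R)^nat) (h' : T -> R) (c : \bar R) :
  (forall n, measurable_fun setT (h n)) -> measurable_fun setT h' ->
  (forall n x, 0 <= h n x) -> (forall x, 0 <= h' x) ->
  {ae mu, forall x, h n x @[n --> \oo] --> h' x} ->
  (\forall n \near \oo, \int[mu]_x (h n x)%:E <= c)%E ->
  (\int[mu]_x (h' x)%:E <= c)%E.
Proof.
move=> mh mh' h0 h'0 hh' hc.
have mhE n : measurable_fun setT (fun x => (h n x)%:E) by exact/measurable_EFinP.
have mI : measurable_fun setT (fun x => limn_einf (fun n => (h n x)%:E)).
  have -> : (fun x => limn_einf (fun n => (h n x)%:E)) =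
      (fun x => - limn_esup (fun n => - (h n x)%:E))%E.
    by apply/funext => x; rewrite -limn_einfN; congr limn_einf; apply/funext => n; rewrite /comp oppeK.
  apply: measurableT_comp => //; apply: measurable_fun_limn_esup => // n.
  exact: measurableT_comp.
apply: (@le_trans _ _ (\int[mu]_x limn_einf (fun n => (h n x)%:E))%E).
  apply: ae_ge0_le_integral => //.
  - by move=> x _; rewrite lee_fin.
  - exact/measurable_EFinP.
  - move=> x _; rewrite limn_einf_lim; apply: lime_ge; first exact: is_cvg_einfs.
    apply: nearW => n; apply: le_ereal_inf_tmp => _ [k _ <-].
    by rewrite lee_fin.
  apply: filterS hh' => x hx _.
  have /cvg_limn_einf_sup[-> _] // : (h n x)%:E @[n --> \oo] --> (h' x)%:E.
  by apply: cvg_EFin => //; exact: nearW.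
apply: (le_trans (fatou mu measurableT mhE _)).
  by move=> n x _; rewrite lee_fin.
rewrite limn_einf_lim; apply: lime_le; first exact: is_cvg_einfs.
apply: filterS hc => n hn; apply: le_trans hn.
by apply: ereal_inf_lbound; exists n => /=.
Qed.

End fatou.

Section riesz_fischer.
Context d (T : measurableType d) (R : realType).
Variable mu : {measure set T -> \bar R}.

Lemma fast_cauchy_cvg (a : R^nat) (C : R) :
  (forall n, `|a n.+1 - a n| <= C * 2^-1 ^+ n) -> cvgn a.
Proof.
move=> aC.
have -> : a = (fun n => a 0%N + series (telescope a) n).
  by apply/funext => n; exact: eq_sum_telescope.
apply: is_cvgD; first exact: is_cvg_cst.
apply: normed_cvg; apply: (series_le_cvg _ _ _ (@is_cvg_geometric_series R C 2^-1 _)).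
- by move=> n; exact: normr_ge0.
- by move=> n; rewrite /= (le_trans _ (aC n)).
- by move=> n; exact: aC.
- by rewrite ger0_norm ?invr_ge0// invf_lt1// ltr1n.
Qed.

(** The upper limit is measurable whether or not the sequence converges, and is
    the limit where it does. *)
Definition seq_lim (f : nat -> T -> R) (x : T) : R := fine (limn_esup (fun n => (f n x)%:E)).

Lemma measurable_seq_lim (f : nat -> T -> R) :
  (forall n, measurable_fun setT (f n)) -> measurable_fun setT (seq_lim f).
Proof.
move=> mf; apply: (measurableT_comp (fine_measurable measurableT)).
by apply: measurable_fun_limn_esup => // n; exact/measurable_EFinP.
Qed.

Lemma cvg_seq_lim (f : nat -> T -> R) x : cvgn (f ^~ x) ->
  f n x @[n --> \oo] --> seq_lim f x.
Proof.
move=> cf; have /cvg_limn_einf_sup[_] : (f n x)%:E @[n --> \oo] --> (limn (f ^~ x))%:E.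
  by apply: cvg_EFin; [exact: nearW|exact: cf].
by rewrite /seq_lim => ->.
Qed.

(** Riesz-Fischer: a sequence with summable increments converges almost
    everywhere, and Fatou's lemma identifies the limit in norm. *)
Lemma fast_cauchy_L2 (F : nat -> L2 mu) :
  (forall n, `|F n.+1 - F n| <= 4^-1 ^+ n) ->
  exists G : L2 mu, forall m, `|G - F m| <= 2 * 4^-1 ^+ m.
Proof.
move=> dF.
have dF2 m n : `|F (m + n)%N - F m| <= 2 * 4^-1 ^+ m.
  suff : `|F (m + n)%N - F m| <= 2 * 4^-1 ^+ m - 2 * 4^-1 ^+ (m + n).
    by move/le_trans; apply; rewrite gerBl mulr_ge0// exprn_ge0.
  elim: n => [|n IHn]; first by rewrite addn0 !subrr normr0.
  rewrite addnS (le_trans (ler_distD (F (m + n)%N) _ _))//.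
  have := lerD (dF (m + n)%N) IHn; move/le_trans; apply.
  have : 0 <= (4^-1 : R) ^+ (m + n) by rewrite exprn_ge0.
  by rewrite exprS; move: (_ ^+ (m + n)) (_ ^+ m) => p q p0; lra.
pose a n x := cabs (fun x => F n.+1 x - F n x) x.
have mFB m n : cmeasurable (fun x => F m x - F n x).
  by apply: cmeasurableD; [exact: cmeasurable_L2|apply: cmeasurableN; exact: cmeasurable_L2].
have ma n : measurable_fun setT (fun x => (4 ^+ n * a n x ^+ 2)%:E).
  by apply/measurable_EFinP; apply: measurable_funM => //; exact: measurable_cabs_sq.
(* The integral of 4^n a_n^2 is at most 4^-n, so the sum of these functions is
   finite almost everywhere; where it is, a_n = O(2^-n). *)
have ae_bd : {ae mu, forall x, exists C : R, forall n, a n x <= C * 2^-1 ^+ n}.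
  pose S x : \bar R := (\sum_(n <oo) (4 ^+ n * a n x ^+ 2)%:E)%E.
  have t0 n x : (0 <= (4 ^+ n * a n x ^+ 2)%:E)%E.
    by rewrite lee_fin mulr_ge0// sqr_ge0.
  have S0 x : (0 <= S x)%E by apply: nneseries_ge0 => n _ _; exact: t0.
  have IS : (\int[mu]_x S x < +oo)%E.
    rewrite integral_nneseries//.
    apply: (@le_lt_trans _ _ 2%:E); last by rewrite ltry.
    apply: lime_le.
      by apply: is_cvg_nneseries => n _ _; apply: integral_ge0.
    apply: nearW => n.
    apply: (@le_trans _ _ (2 - 2 * 4^-1 ^+ n)%:E); last first.
      by rewrite lee_fin gerBl mulr_ge0// exprn_ge0.
    elim: n => [|n IHn]; first by rewrite big_geq// expr0 lee_fin; lra.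
    rewrite big_nat_recr//=; apply: (@le_trans _ _ ((2 - 2 * 4^-1 ^+ n)%:E + (4^-1 ^+ n)%:E)%E).
      apply: leeD => //.
      under eq_integral do rewrite EFinM.
      rewrite ge0_integralZl_EFin//; first last.
      - by apply/measurable_EFinP; exact: measurable_cabs_sq.
      - by move=> x _; rewrite lee_fin sqr_ge0.
      rewrite -/(energy mu (fun x => F n.+1 x - F n x)) energyB -EFinM lee_fin.
      have h : `|F n.+1 - F n| ^+ 2 <= (4^-1 ^+ n) ^+ 2.
        by rewrite lerXn2r ?nnegrE ?exprn_ge0.
      apply: (le_trans (ler_wpM2l _ h)); first by rewrite exprn_ge0.
      by rewrite expr2 mulrA -exprMn divff// expr1n mul1r.
    rewrite -EFinD lee_fin exprS.
    have : 0 <= (4^-1 : R) ^+ n by rewrite exprn_ge0.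
    by move: (_ ^+ n) => p p0; lra.
  have : mu.-integrable setT S.
    apply/integrableP; split; last by under eq_integral do rewrite gee0_abs//.
    by apply: ge0_emeasurable_sum => // k x _ _; exact: t0.
  move/(integrable_ae measurableT); apply: filterS => x /(_ I) Sx.
  (* 2^n a_n <= (2^n a_n)^2 + 1. *)
  exists (fine (S x) + 1) => n.
  have : ((4 ^+ n * a n x ^+ 2)%R%:E <= S x)%E.
    apply: le_trans (nneseries_lim_ge n.+1 _); last by move=> k _ _; exact: t0.
    by rewrite big_nat_recr//= leeDr// sume_ge0.
  rewrite -(fineK Sx) lee_fin => h.
  rewrite exprVn ler_pdivlMr ?exprn_gt0//.
  have E4 : (4 : R) ^+ n = (2 ^+ n) ^+ 2.
    by rewrite -exprM mulnC exprM; congr (_ ^+ _); ring.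
  by move: h; rewrite E4 /=; move: (a n x) (2 ^+ n) (fine _) => p q r; have := sqr_ge0 (p * q - 1); have := sqr_ge0 (p * q); lra.
pose gr := seq_lim (fun n x => complex.Re (F n x)).
pose gi := seq_lim (fun n x => complex.Im (F n x)).
pose g x : R[i] := gr x +i* gi x.
have mg : cmeasurable g.
  split; apply: measurable_seq_lim => n; have [] := cmeasurable_L2 (F n) => //.
have ae_cv : {ae mu, forall x,
    complex.Re (F n x) @[n --> \oo] --> gr x /\
    complex.Im (F n x) @[n --> \oo] --> gi x}.
  apply: filterS ae_bd => x [C aC]; split; apply: cvg_seq_lim.
    apply: (@fast_cauchy_cvg _ C) => n.
    by rewrite -raddfB (le_trans _ (aC n))// norm_Re_le_cabs.
  apply: (@fast_cauchy_cvg _ C) => n.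
  by rewrite -raddfB (le_trans _ (aC n))// norm_Im_le_cabs.
have gF m : (energy mu (fun x => (g x - F m x)%R) <= ((2 * 4^-1 ^+ m) ^+ 2)%:E)%E.
  apply: (@fatou_ae_le _ _ _ mu (fun n x => cabs (fun x => F n x - F m x) x ^+ 2)).
  - by move=> n; apply: measurable_cabs_sq.
  - apply: measurable_cabs_sq; apply: cmeasurableD => //.
    by apply: cmeasurableN; exact: cmeasurable_L2.
  - by move=> n x; exact: sqr_ge0.
  - by move=> x; exact: sqr_ge0.
  - apply: filterS ae_cv => x [cr ci].
    under eq_fun do rewrite cabs_sqE 2!raddfB/= !expr2.
    rewrite cabs_sqE 2!raddfB/= !expr2.
    apply: cvgD; apply: cvgM; apply: cvgB => //; exact: cvg_cst.
  - exists m => // n /= mn.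
    rewrite -/(energy mu (fun x => F n x - F m x)) energyB lee_fin.
    rewrite lerXn2r ?nnegrE ?mulr_ge0 ?exprn_ge0//.
    by rewrite -(subnKC mn).
have eg : (energy mu g < +oo)%E.
  have -> : g = (fun x => (g x - F 0%N x) + F 0%N x).
    by apply/funext => x; rewrite subrK.
  apply: le_lt_trans (energyD_le _ _ _) _.
  - by apply: cmeasurableD => //; apply: cmeasurableN; exact: cmeasurable_L2.
  - exact: cmeasurable_L2.
  rewrite lte_add_pinfty// lte_mul_pinfty// ?energy_L2_lty//.
  by rewrite (le_lt_trans (gF 0%N))// ltry.
have [G Gg] := ex_L2 mg eg.
exists G => m.
rewrite -(@ler_pXn2r _ 2) ?nnegrE ?mulr_ge0 ?exprn_ge0//.
rewrite -lee_fin -energyB (@eq_ae_energy _ _ _ _ _ (fun x => g x - F m x)) ?gF//.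
- apply: cmeasurableD; first exact: cmeasurable_L2.
  by apply: cmeasurableN; exact: cmeasurable_L2.
- by apply: cmeasurableD => //; apply: cmeasurableN; exact: cmeasurable_L2.
- by apply: filterS Gg => x ->.
Qed.

(** Pick centers of balls of radius about 4^-n that belong to the filter; they form a
    fast Cauchy sequence, and its limit is the limit of the filter. *)
Lemma L2_complete (U : set_system (L2 mu)) : ProperFilter U ->
  (forall e : R, 0 < e -> exists f : L2 mu, U (ball f e)) ->
  exists f : L2 mu, U --> f.
Proof.
move=> PU cU.
pose e n : R := 4^-1 ^+ n / 2.
have e0 n : 0 < e n by rewrite divr_gt0// exprn_gt0.
have /choice[F UF] : forall n, exists f : L2 mu, U (ball f (e n)).
  by move=> n; exact: cU.
have dF n : `|F n.+1 - F n| <= 4^-1 ^+ n.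
  have [f [f1 f2]] := filter_ex (filterI (UF n.+1) (UF n)).
  move: f1 f2; rewrite -!ball_normE /ball_/= => f1 f2.
  rewrite (le_trans (ler_distD f _ _))// [leLHS]addrC.
  have h : e n.+1 <= e n.
    rewrite /e exprS; have : 0 <= (4^-1 : R) ^+ n by rewrite exprn_ge0.
    by move: (_ ^+ n) => p p0; lra.
  rewrite [in leLHS](distrC f) (le_trans (lerD (ltW f2) (ltW (lt_le_trans f1 h))))//.
  by rewrite /e -splitr.
have [G GF] := fast_cauchy_L2 dF.
exists G; apply/cvg_ballP => r r0.
have [n nr] : exists n, 3 * 4^-1 ^+ n < r :> R.
  have : 3 * (4^-1 : R) ^+ n @[n --> \oo] --> 3 * (0 : R).
    by apply: cvgMr; apply: cvg_expr; rewrite ger0_norm ?invr_ge0// invf_lt1// ltr1n.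
  rewrite mulr0 => /cvgrPdist_lt /(_ r r0)[n _ /(_ n (leqnn n))] /=.
  rewrite sub0r normrN ger0_norm ?mulr_ge0 ?exprn_ge0// => ?; by exists n.
apply: filterS (UF n) => f; rewrite -!ball_normE /ball_/= => fn.
rewrite (le_lt_trans (ler_distD (F n) _ _))// (lt_trans _ nr)//.
have := ler_ltD (GF n) fn; move/lt_le_trans; apply.
rewrite /e; have : 0 <= (4^-1 : R) ^+ n by rewrite exprn_ge0.
by move: (_ ^+ n) => p p0; lra.
Qed.

End riesz_fischer.

(** * Total boundedness in L2 *)

Section compactness.
Context d (T : measurableType d) (R : realType).
Variable mu : {measure set T -> \bar R}.

(** An ultrafilter containing the closure of K contains, for every radius, one of
    the finitely many balls of a net, so it is Cauchy and completeness applies. *)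
Lemma L2_totally_bounded_precompact (K : set (L2 mu)) :
  (forall e : R, 0 < e -> exists (I : finType) (c : I -> L2 mu),
    forall k, K k -> exists i, ball (c i) e k) ->
  precompact K.
Proof.
move=> tb; rewrite precompactE compact_ultra => U UU UK.
have [e e0|f Uf] := @L2_complete _ _ _ mu U _.
  have [|I [c Kc]] := tb (e / 2); first by rewrite divr_gt0.
  apply: contrapT => nU.
  have H i : U (~` ball (c i) e).
    by have [Ui|//] := in_ultra_setVsetC (ball (c i) e) UU; exfalso; apply: nU; exists (c i).
  have H' : \forall x \near U, forall i, ~ ball (c i) e x.
    by apply: filter_forall => i; exact: H.
  have [x [clKx nx]] := filter_ex (filterI UK H').
  have e20 : 0 < e / 2 by rewrite divr_gt0.
  have [k [Kk kx]] := clKx _ (nbhsx_ballx x _ e20).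
  have [i ik] := Kc k Kk; apply: (nx i).
  by apply: (ball_split ik); exact: ball_sym.
exists f; split => //; apply: closed_closure => B Bf.
have [x [clx Bx]] := filter_ex (filterI UK (Uf _ Bf)).
by exists x.
Qed.

Lemma precompact_totally_bounded (K : set (L2 mu)) (e : R) : precompact K -> 0 < e ->
  exists (I : finType) (c : I -> L2 mu), forall k, K k -> exists i, ball (c i) e k.
Proof.
rewrite precompactE compact_cover => cK e0.
have [||D _ KD] := cK (L2 mu) setT (fun c => (ball c e)^°).
- by move=> c _; exact: open_interior.
- by move=> k _; exists k => //; exact: nbhsx_ballx.
pose s : seq (L2 mu) := finmap.enum_fset D.
exists 'I_(size s), (fun i : 'I_(size s) => nth 0 s i) => k Kk.
have [c cD ck] := KD k (subset_closure Kk).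
have cs : c \in s by exact: cD.
have ci : (index c s < size s)%N by rewrite index_mem.
by exists (Ordinal ci); rewrite /= nth_index//; exact: interior_subset.
Qed.

End compactness.

(** * Truncation and tails *)

Section truncation.
Context d (T : measurableType d) (R : realType).
Variable mu : {measure set T -> \bar R}.
Implicit Types (f g : T -> R[i]) (F G : L2 mu) (A : set T).

Definition trunc A f x : R[i] := if x \in A then f x else 0.

Lemma Re_trunc A f x : complex.Re (trunc A f x) = \1_A x * complex.Re (f x).
Proof. by rewrite /trunc indicE; case: (x \in A); rewrite ?mul1r ?mul0r. Qed.

Lemma Im_trunc A f x : complex.Im (trunc A f x) = \1_A x * complex.Im (f x).
Proof. by rewrite /trunc indicE; case: (x \in A); rewrite ?mul1r ?mul0r. Qed.

Lemma cmeasurable_trunc A f : measurable A -> cmeasurable f -> cmeasurable (trunc A f).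
Proof.
move=> mA [mr mi]; split.
  rewrite (_ : _ \o _ = (fun x => \1_A x * complex.Re (f x))); last first.
    by apply/funext => x; exact: Re_trunc.
  by apply: measurable_funM => //; exact: measurable_indic.
rewrite (_ : _ \o _ = (fun x => \1_A x * complex.Im (f x))); last first.
  by apply/funext => x; exact: Im_trunc.
by apply: measurable_funM => //; exact: measurable_indic.
Qed.

Lemma cabs_trunc_sq A f x : cabs (trunc A f) x ^+ 2 = \1_A x * cabs f x ^+ 2.
Proof.
by rewrite !cabs_sqE Re_trunc Im_trunc indicE; case: (x \in A); rewrite ?mul1r ?mul0r ?expr0n ?addr0.
Qed.

Lemma energy_trunc A f : measurable A ->
  energy mu (trunc A f) = (\int[mu]_(x in A) (cabs f x ^+ 2)%:E)%E.
Proof.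
move=> mA; rewrite [RHS]integral_mkcond; apply: eq_integral => x _.
rewrite cabs_trunc_sq indicE patchE; case: ifP => //; by rewrite ?mul1r// mul0r.
Qed.

Lemma energy_trunc_le A f : cmeasurable f -> measurable A ->
  (energy mu (trunc A f) <= energy mu f)%E.
Proof.
move=> mf mA; apply: ge0_le_integral => //.
- by move=> x _; rewrite lee_fin sqr_ge0.
- by apply/measurable_EFinP; apply: measurable_cabs_sq; exact: cmeasurable_trunc.
- by apply/measurable_EFinP; exact: measurable_cabs_sq.
- move=> x _; rewrite lee_fin cabs_trunc_sq indicE.
  by case: (x \in A); rewrite ?mul1r// mul0r sqr_ge0.
Qed.

Lemma energy_trunc_split A f : cmeasurable f -> measurable A ->
  energy mu f = (energy mu (trunc A f) + energy mu (trunc (~` A) f))%E.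
Proof.
move=> mf mA; have mA' := measurableC mA.
rewrite /energy -ge0_integralD//.
- apply: eq_integral => x _; rewrite -EFinD !cabs_trunc_sq !indicE in_setC.
  by case: (x \in A); rewrite ?mul1r mul0r ?addr0 ?add0r.
- by move=> x _; rewrite lee_fin sqr_ge0.
- by apply/measurable_EFinP; apply: measurable_cabs_sq; exact: cmeasurable_trunc.
- by move=> x _; rewrite lee_fin sqr_ge0.
- by apply/measurable_EFinP; apply: measurable_cabs_sq; exact: cmeasurable_trunc.
Qed.

Lemma ex_trunc F A : measurable A -> exists G : L2 mu,
  {ae mu, forall x, G x = trunc A F x} /\
  (`|F - G| ^+ 2)%:E = energy mu (trunc (~` A) F).
Proof.
move=> mA; have mF := cmeasurable_L2 F.
have [||G Gt] := @ex_L2 _ _ _ mu (trunc A F); first exact: cmeasurable_trunc.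
  exact: le_lt_trans (energy_trunc_le mF mA) (energy_L2_lty F).
exists G; split => //; rewrite -energyB; apply: eq_ae_energy.
- by apply: cmeasurableD => //; apply: cmeasurableN; exact: cmeasurable_L2.
- by apply: cmeasurable_trunc => //; exact: measurableC.
- apply: filterS Gt => x ->; rewrite /trunc in_setC.
  by case: (x \in A); rewrite ?subrr ?subr0.
Qed.

(** On a set of finite measure, |f| <= 1 + |f|^2. *)
Lemma integrable_cabs_trunc A f : measurable A -> (mu A < +oo)%E ->
  cmeasurable f -> (energy mu f < +oo)%E ->
  mu.-integrable setT (EFin \o cabs (trunc A f)).
Proof.
move=> mA Ay mf ef; have mt := cmeasurable_trunc mA mf.
have m1 : measurable_fun setT (fun x => \1_A x : R) by exact: measurable_indic.
apply: integrable_ge0; [exact: measurable_cabs|exact: cabs_ge0|].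
apply: (@le_lt_trans _ _ (\int[mu]_x ((\1_A x)%:E + (cabs f x ^+ 2)%:E))%E).
  apply: ge0_le_integral => //.
  - by move=> x _; rewrite lee_fin cabs_ge0.
  - by apply/measurable_EFinP; exact: measurable_cabs.
  - under eq_fun do rewrite -EFinD; apply/measurable_EFinP.
    by apply: measurable_funD => //; exact: measurable_cabs_sq.
  move=> x _; rewrite -EFinD lee_fin.
  have := cabs_trunc_sq A f x; have := cabs_ge0 (trunc A f) x.
  have := sqr_ge0 (cabs f x).
  rewrite indicE; case: (x \in A) => /=; rewrite ?mul1r ?mul0r.
    by move=> h0 h1 <-; have := sqr_ge0 (cabs (trunc A f) x - 1); lra.
  move=> h0 h1 /eqP; rewrite sqrf_eq0 => /eqP ->; lra.
rewrite ge0_integralD//; first last.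
- by apply/measurable_EFinP; exact: measurable_cabs_sq.
- by move=> x _; rewrite lee_fin sqr_ge0.
- exact/measurable_EFinP.
by rewrite lte_add_pinfty// integral_indic// setIT.
Qed.

End truncation.

Section euclidean_balls.
Context {R : realType}.
Notation mu := (@lebesgue_measure R).
Notation RM := (measurableTypeR R).
Notation Rn n := (n.-tuple RM).
Notation lambda n := (@lebesgue_tuple R n).

Definition eball n (xi : R) : set (Rn n) := [set x | enorm x <= xi].

Lemma dotp_ge0 n (x : Rn n) : 0 <= dotp x x.
Proof. by apply: sumr_ge0 => i _; rewrite -expr2 sqr_ge0. Qed.

Lemma measurable_enorm n : measurable_fun setT (@enorm R n).
Proof.
apply: (measurableT_comp (continuous_measurable_fun (@sqrt_continuous R))).
rewrite /dotp; apply: measurable_sum => i.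
by apply: measurable_funM; exact: measurable_tnth.
Qed.

Lemma measurable_eball n xi : measurable (@eball n xi).
Proof.
rewrite -[X in measurable X]setTI.
have -> : @eball n xi = @enorm R n @^-1` `]-oo, xi]%classic.
  by apply/seteqP; split => x; rewrite /eball/= in_itv.
by apply: measurable_enorm => //; exact: measurable_itv.
Qed.

Lemma tnth_le_enorm n (x : Rn n) i : `|tnth x i| <= enorm x.
Proof.
rewrite -(@ler_pXn2r _ 2) ?nnegrE ?sqrtr_ge0// sqr_sqrtr ?dotp_ge0//.
rewrite real_normK ?num_real// /dotp (bigD1 i)//= expr2 lerDl.
by apply: sumr_ge0 => j _; rewrite -expr2 sqr_ge0.
Qed.

Definition cube n (xi : R) : set (Rn n) := [set x | forall i, `|tnth x i| <= xi].

Lemma measurable_cube n xi : measurable (@cube n xi).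
Proof.
have -> : @cube n xi = \bigcap_(i in [set: 'I_n])
    ((@tnth n RM)^~ i @^-1` `[- xi, xi]%classic).
  apply/seteqP; split => x /= h i; first by move=> _; rewrite /= in_itv/= -ler_norml.
  by have := h i I; rewrite /= in_itv/= -ler_norml.
apply: fin_bigcap_measurable => // i _.
rewrite -[X in measurable X]setTI; by apply: (measurable_tnth i).
Qed.

Lemma lambda_cube_lty n xi : (lambda n (@cube n xi) < +oo)%E.
Proof.
elim: n => [|n IHn].
  by rewrite /= /dirac indicE ltry.
pose I : set RM := `[- xi, xi]%classic.
have mI : measurable I by exact: measurable_itv.
have -> : (lambda n.+1 (@cube n.+1 xi) = (mu \x lambda n)%E (I `*` @cube n xi))%E.
  rewrite /= /lebesgue_cons /pushforward; congr product_measure1.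
  apply/seteqP; split => -[x t]; rewrite /cube/=.
    move=> h; split; first by have := h ord0; rewrite (tnth_nth 0)/= /I/= in_itv/= -ler_norml.
    by move=> i; have := h (lift ord0 i); rewrite !(tnth_nth 0).
  move=> [h1 h2] i; case: (unliftP ord0 i) => [j ->|->].
    by have := h2 j; rewrite !(tnth_nth 0).
  by move: h1; rewrite (tnth_nth 0)/= /I/= in_itv/= -ler_norml.
rewrite product_measure1E//; last exact: measurable_cube.
have muI : (mu I \is a fin_num)%E by rewrite lebesgue_measure_itv/=; case: ifP.
exact: (lte_mul_pinfty _ muI IHn).
Qed.

Lemma lambda_eball_lty n xi : (lambda n (@eball n xi) < +oo)%E.
Proof.
apply: le_lt_trans (lambda_cube_lty n xi); apply: le_measure; rewrite ?inE.
- exact: measurable_eball.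
- exact: measurable_cube.
- by move=> x /= xxi i; rewrite (le_trans (tnth_le_enorm x i)).
Qed.

End euclidean_balls.

Section tails.
Context {R : realType} {n : nat}.
Notation RM := (measurableTypeR R).
Notation Rn := (n.-tuple RM).
Notation lambda := (@lebesgue_tuple R n).

Definition tail (xi : R) (f : Rn -> R[i]) : \bar R :=
  energy lambda (trunc (~` eball xi) f).

Lemma tail_nonincreasing (f : Rn -> R[i]) (xi xi' : R) : cmeasurable f ->
  xi <= xi' -> (tail xi' f <= tail xi f)%E.
Proof.
move=> mf xx; have mB r := measurableC (@measurable_eball R n r).
apply: ge0_le_integral => //.
- by move=> x _; rewrite lee_fin sqr_ge0.
- by apply/measurable_EFinP; apply: measurable_cabs_sq; exact: cmeasurable_trunc.
- by apply/measurable_EFinP; apply: measurable_cabs_sq; exact: cmeasurable_trunc.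
move=> x _; rewrite lee_fin !cabs_trunc_sq !indicE ler_wpM2r ?sqr_ge0//.
rewrite ler_nat; case: (boolP (x \in ~` eball xi')) => //.
rewrite inE/= => h; rewrite mem_set//= => h'; apply: h.
exact: le_trans h' xx.
Qed.

(** Dominated convergence as the balls exhaust the space. *)
Lemma tail_small (f : Rn -> R[i]) (e : R) : cmeasurable f ->
  (energy lambda f < +oo)%E -> 0 < e ->
  exists xi : R, (tail xi f < e%:E)%E.
Proof.
move=> mf ef e0; have mB r := measurableC (@measurable_eball R n r).
have mt (k : nat) : measurable_fun setT
    (fun x => cabs (trunc (~` eball k%:R) f) x ^+ 2).
  by apply: measurable_cabs_sq; exact: cmeasurable_trunc.
have iu2 : lambda.-integrable setT (EFin \o (fun x => cabs f x ^+ 2)).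
  by apply: integrable_ge0 => // [|x]; [exact: measurable_cabs_sq|exact: sqr_ge0].
have pw (x : Rn) : setT x ->
    (cabs (trunc (~` eball k%:R) f) x ^+ 2)%:E @[k --> \oo] --> 0%E.
  move=> _; apply: cvg_near_cst; exists (Num.truncn (enorm x)).+1 => // k /= xk.
  rewrite cabs_trunc_sq indicE memNset ?mul0r//; apply; rewrite /eball/=.
  by apply: (le_trans (ltW (truncnS_gt _))); rewrite ler_nat.
have dom (x : Rn) (k : nat) : setT x ->
    (`|(cabs (trunc (~` eball k%:R) f) x ^+ 2)%:E| <= (cabs f x ^+ 2)%:E)%E.
  move=> _; rewrite /= ger0_norm ?sqr_ge0// lee_fin cabs_trunc_sq indicE.
  by case: (x \in _); rewrite ?mul1r// mul0r sqr_ge0.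
have [_ _] := dominated_convergence measurableT
  (fun k => (measurable_EFinP _ _).2 (mt k)) (measurable_cst _) (aeW _ pw) iu2
  (aeW _ dom).
rewrite integral_cst// mul0e => cv.
have /cvge0P -/(_ _ _ e0) := cv.
case=> [k|k _ /(_ k (leqnn k))]; last by exists k%:R.
by apply: integral_ge0 => x _; rewrite lee_fin sqr_ge0.
Qed.

End tails.

(** * The Fourier operator on L2 *)

Section fourier_operator.
Context {R : realType} {n : nat}.
Notation RM := (measurableTypeR R).
Notation Rn := (n.-tuple RM).
Notation lambda := (@lebesgue_tuple R n).
Notation L2Rn := (L2 lambda).
Notation graph := (@fourier_graph R n).

Definition L1 (f : Rn -> R[i]) := lambda.-integrable setT (EFin \o cabs f).

Lemma integrable_Re f : cmeasurable f -> L1 f ->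
  lambda.-integrable setT (EFin \o (fun x => complex.Re (f x))).
Proof.
move=> [mr _] Lf; apply: (le_integrable _ _ _ Lf) => //.
  exact/measurable_EFinP.
move=> x _ /=; rewrite lee_fin [leRHS]ger0_norm ?cabs_ge0//.
exact: norm_Re_le_cabs.
Qed.

Lemma integrable_Im f : cmeasurable f -> L1 f ->
  lambda.-integrable setT (EFin \o (fun x => complex.Im (f x))).
Proof.
move=> [_ mi] Lf; apply: (le_integrable _ _ _ Lf) => //.
  exact/measurable_EFinP.
move=> x _ /=; rewrite lee_fin [leRHS]ger0_norm ?cabs_ge0//.
exact: norm_Im_le_cabs.
Qed.

Lemma Re_fourier_integral f w : complex.Re (fourier_integral f w) =
  phase_re lambda (@dot_phase R n) (fun x => complex.Re (f x)) (fun x => complex.Im (f x)) w.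
Proof.
apply: eq_Rintegral => x _; rewrite /expi cosN sinN.
case: (f x) => a b /=; rewrite /dot_phase/=.
by move: (cos _) (sin _) => c s; ring.
Qed.

Lemma Im_fourier_integral f w : complex.Im (fourier_integral f w) =
  phase_im lambda (@dot_phase R n) (fun x => complex.Re (f x)) (fun x => complex.Im (f x)) w.
Proof.
apply: eq_Rintegral => x _; rewrite /expi cosN sinN.
case: (f x) => a b /=; rewrite /dot_phase/=.
by move: (cos _) (sin _) => c s; ring.
Qed.

Lemma cmeasurable_fourier_integral (f : Rn -> R[i]) : cmeasurable f ->
  cmeasurable (fourier_integral f).
Proof.
move=> [mr mi]; split.
  rewrite (_ : _ \o _ = phase_re lambda (@dot_phase R n)
    (fun x => complex.Re (f x)) (fun x => complex.Im (f x))).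
    by apply: measurable_phase_re => //; exact: measurable_dot_phase.
  by apply/funext => w; exact: Re_fourier_integral.
rewrite (_ : _ \o _ = phase_im lambda (@dot_phase R n)
  (fun x => complex.Re (f x)) (fun x => complex.Im (f x))).
  by apply: measurable_phase_im => //; exact: measurable_dot_phase.
by apply/funext => w; exact: Im_fourier_integral.
Qed.

Lemma energy_fourier_integral (f : Rn -> R[i]) : cmeasurable f -> L1 f ->
  (energy lambda f < +oo)%E -> energy lambda (fourier_integral f) = energy lambda f.
Proof.
move=> mf Lf ef.
have E (g : Rn -> R[i]) : energy lambda g =
    (\int[lambda]_x (complex.Re (g x) ^+ 2 + complex.Im (g x) ^+ 2)%:E)%E.
  by apply: eq_integral => x _; rewrite cabs_sqE.
rewrite !E; under eq_integral do rewrite Re_fourier_integral Im_fourier_integral.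
apply: (@plancherel_tuple R n).
- exact: integrable_Re.
- exact: integrable_Im.
- by rewrite -E.
Qed.

Lemma fourier_integral_ae (f g : Rn -> R[i]) w : cmeasurable f -> cmeasurable g ->
  {ae lambda, forall x, f x = g x} -> fourier_integral f w = fourier_integral g w.
Proof.
move=> mf mg fg.
have mph : measurable_fun setT (fun x : Rn => dot_phase (x, w)).
  exact: (measurableT_comp (@measurable_dot_phase R n) (measurable_pair2 w)).
have mc := measurable_cos_phase mph; have ms := measurable_sin_phase mph.
have [mfr mfi] := mf; have [mgr mgi] := mg.
apply/eqP; rewrite eq_complex; apply/andP; split; apply/eqP.
  rewrite !Re_fourier_integral; congr fine; apply: ae_eq_integral => //.
  - by apply/measurable_EFinP; apply: measurable_funD; exact: measurable_funM.
  - by apply/measurable_EFinP; apply: measurable_funD; exact: measurable_funM.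
  - by apply: filterS fg => x -> .
rewrite !Im_fourier_integral; congr fine; apply: ae_eq_integral => //.
- by apply/measurable_EFinP; apply: measurable_funB; exact: measurable_funM.
- by apply/measurable_EFinP; apply: measurable_funB; exact: measurable_funM.
- by apply: filterS fg => x ->.
Qed.

Lemma L1_ae (f g : Rn -> R[i]) : cmeasurable f -> cmeasurable g ->
  {ae lambda, forall x, f x = g x} -> L1 g -> L1 f.
Proof.
move=> mf mg fg; apply: ae_eq_integrable.
  by apply/measurable_EFinP; exact: measurable_cabs.
by apply: filterS fg => x fgx _; rewrite /= /cabs/= fgx.
Qed.

Lemma L1B (f g : Rn -> R[i]) : cmeasurable f -> cmeasurable g -> L1 f -> L1 g ->
  L1 (fun x => f x - g x).
Proof.
move=> mf mg Lf Lg; apply: (le_integrable _ _ _ (integrableD _ Lf Lg)) => //.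
  apply/measurable_EFinP/measurable_cabs.
  by apply: cmeasurableD => //; exact: cmeasurableN.
move=> x _ /=; rewrite lee_fin !ger0_norm ?addr_ge0 ?cabs_ge0//.
by have := le_normcD (f x) (- g x); rewrite normcN.
Qed.

Lemma fourier_integralB (f g : Rn -> R[i]) w : cmeasurable f -> cmeasurable g -> L1 f -> L1 g ->
  fourier_integral (fun x => f x - g x) w = fourier_integral f w - fourier_integral g w.
Proof.
move=> mf mg Lf Lg.
have mph : measurable_fun setT (fun x : Rn => dot_phase (x, w)).
  exact: (measurableT_comp (@measurable_dot_phase R n) (measurable_pair2 w)).
have [ifr ifi] := (integrable_Re mf Lf, integrable_Im mf Lf).
have [igr igi] := (integrable_Re mg Lg, integrable_Im mg Lg).
apply/eqP; rewrite eq_complex; apply/andP; split; apply/eqP.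
  have -> : forall a b : R[i], complex.Re (a - b) = complex.Re a - complex.Re b by move=> [? ?] [? ?].
  rewrite !Re_fourier_integral /phase_re -RintegralB//.
  - by apply: eq_Rintegral => x _; rewrite 2!raddfB/=; ring.
  - exact: (integrable_phase_re ifr ifi mph).
  - exact: (integrable_phase_re igr igi mph).
have -> : forall a b : R[i], complex.Im (a - b) = complex.Im a - complex.Im b by move=> [? ?] [? ?].
rewrite !Im_fourier_integral /phase_im -RintegralB//.
- by apply: eq_Rintegral => x _; rewrite 2!raddfB/=; ring.
- exact: (integrable_phase_im ifr ifi mph).
- exact: (integrable_phase_im igr igi mph).
Qed.

Lemma graph_ex (F : L2Rn) : L1 F -> exists G, graph (F, G).
Proof.
move=> LF; have mF := cmeasurable_L2 F.
have [||G GF] := @ex_L2 _ _ _ lambda (fourier_integral F).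
- exact: cmeasurable_fourier_integral.
- by rewrite energy_fourier_integral// energy_L2_lty.
by exists G; split.
Qed.

Lemma graph_isometry F G : graph (F, G) -> `|G| = `|F|.
Proof.
move=> [/= LF GF]; have mF := cmeasurable_L2 F.
apply/eqP; rewrite -(@eqrXn2 _ 2)//; apply/eqP/EFin_inj.
rewrite -!energyE (@eq_ae_energy _ _ _ _ _ (fourier_integral F))//.
- by rewrite energy_fourier_integral// energy_L2_lty.
- exact: cmeasurable_L2.
- exact: cmeasurable_fourier_integral.
Qed.

(** The graph is a subgroup; elements of L2 being classes, the identities hold
    almost everywhere only, which the integral does not see. *)
Lemma graphB F G F' G' : graph (F, G) -> graph (F', G') -> graph (F - F', G - G').
Proof.
move=> [/= LF GF] [/= LF' GF'].
have mF := cmeasurable_L2 F; have mF' := cmeasurable_L2 F'.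
have mB : cmeasurable (fun x => F x - F' x).
  by apply: cmeasurableD => //; exact: cmeasurableN.
split => /=.
  apply: L1_ae (L2B_ae F F') (L1B mF mF' LF LF') => //.
  exact: cmeasurable_L2.
apply: filterS3 (L2B_ae G G') GF GF' => w -> -> ->.
rewrite -fourier_integralB//; apply: fourier_integral_ae => //.
  exact: cmeasurable_L2.
by apply: filterS (L2B_ae F F') => x ->.
Qed.

Lemma closure_graphP f g : closure graph (f, g) <->
  (forall e : R, 0 < e -> exists F G, [/\ graph (F, G), `|f - F| < e & `|g - G| < e]).
Proof.
split=> [cfg e e0|H B].
  have [[F G] [FG [/= fF gG]]] : graph `&` (ball f e `*` ball g e) !=set0.
    by apply: cfg; exists (ball f e, ball g e) => //; split; exact: nbhsx_ballx.
  by exists F, G; split => //; move: fF gG; rewrite -!ball_normE.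
move=> [[B1 B2] [/= /nbhs_ballP[e1 /= e10 B1e] /nbhs_ballP[e2 /= e20 B2e]] BB].
have e0 : 0 < Num.min e1 e2 by rewrite lt_min e10.
have [F [G [FG]]] := H _ e0; rewrite !lt_min => /andP[f1 _] /andP[_ g2].
exists (F, G); split => //; apply: BB; split => /=.
  by apply: B1e; rewrite -ball_normE.
by apply: B2e; rewrite -ball_normE.
Qed.

(** The norm is continuous, so the isometry property passes to the closure.
    Applied to differences it also shows that the closure is a functional graph. *)
Lemma closure_graph_isometry f g : closure graph (f, g) -> `|g| = `|f|.
Proof.
move=> /closure_graphP H; apply/eqP; rewrite -subr_eq0 -normr_eq0.
rewrite eq_le normr_ge0 andbT; apply/ler_addgt0Pl => e e0; rewrite addr0.
have [F [G [FG fF gG]]] : exists F G, [/\ graph (F, G), `|f - F| < e / 2 & `|g - G| < e / 2].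
  by apply: H; rewrite divr_gt0.
have := ler_dist_dist f F; have := ler_dist_dist g G; rewrite (graph_isometry FG).
rewrite !ler_norml => /andP[h1 h2] /andP[h3 h4]; apply/andP; split; lra.
Qed.

Lemma closure_graphB f g f' g' : closure graph (f, g) -> closure graph (f', g') ->
  closure graph (f - f', g - g').
Proof.
move=> /closure_graphP H /closure_graphP H'; apply/closure_graphP => e e0.
have e2 : 0 < e / 2 by rewrite divr_gt0.
have [F [G [FG fF gG]]] := H _ e2; have [F' [G' [FG' fF' gG']]] := H' _ e2.
have sub4 (a b a' b' : L2Rn) : `|a - b| < e / 2 -> `|a' - b'| < e / 2 ->
    `|a - a' - (b - b')| < e.
  move=> h h'; have -> : a - a' - (b - b') = (a - b) + (b' - a').
      by rewrite opprB addrACA [RHS]addrACA [- a' - b]addrC.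
  rewrite (splitr e); apply: le_lt_trans (ltrD h h').
  by rewrite [in leRHS](distrC a' b') ler_normD.
by exists (F - F'), (G - G'); split; [exact: graphB|exact: sub4|exact: sub4].
Qed.

(** Truncations of f to large balls are integrable and converge to f fast; their
    transforms are then fast Cauchy by isometry. *)
Lemma closure_graph_ex f : exists g, closure graph (f, g).
Proof.
pose e k : R := 4^-1 ^+ k / 2.
have e0 k : 0 < e k by rewrite divr_gt0// exprn_gt0.
have /choice[F FP] : forall k, exists F : L2Rn, L1 F /\ `|f - F| < e k.
  move=> k; have [xi fxi] := tail_small (cmeasurable_L2 f) (energy_L2_lty f)
    (exprn_gt0 2 (e0 k)).
  have [F [Ff FE]] := ex_trunc f (@measurable_eball R n xi).
  have mt := cmeasurable_trunc (@measurable_eball R n xi) (cmeasurable_L2 f).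
  exists F; split.
    apply: L1_ae Ff _ => //; first exact: cmeasurable_L2.
    apply: integrable_cabs_trunc; [exact: measurable_eball|exact: lambda_eball_lty|..].
      exact: cmeasurable_L2.
    exact: energy_L2_lty.
  move: fxi; rewrite /tail -FE lte_fin ltr_pXn2r// nnegrE//; exact: ltW.
have /choice[G GP] : forall k, exists G, graph (F k, G).
  by move=> k; apply: graph_ex; have [] := FP k.
have dG k : `|G k.+1 - G k| <= 4^-1 ^+ k.
  rewrite (graph_isometry (graphB (GP k.+1) (GP k))).
  rewrite (le_trans (ler_distD f _ _))// distrC.
  have [[_ h1] [_ h2]] := (FP k.+1, FP k).
  have h : e k.+1 <= e k.
    rewrite /e exprS; have : 0 <= (4^-1 : R) ^+ k by rewrite exprn_ge0.
    by move: (_ ^+ k) => p p0; lra.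
  apply: (le_trans (lerD (ltW h1) (ltW h2))).
  by apply: (le_trans (lerD h (lexx _))); rewrite /e -splitr.
have [g gG] := fast_cauchy_L2 dG.
exists g; apply/closure_graphP => r r0.
have [k kr] : exists k, 2 * 4^-1 ^+ k < r :> R.
  have : 2 * (4^-1 : R) ^+ k @[k --> \oo] --> 2 * (0 : R).
    by apply: cvgMr; apply: cvg_expr; rewrite ger0_norm ?invr_ge0// invf_lt1// ltr1n.
  rewrite mulr0 => /cvgrPdist_lt /(_ r r0)[k _ /(_ k (leqnn k))] /=.
  rewrite sub0r normrN ger0_norm ?mulr_ge0 ?exprn_ge0// => ?; by exists k.
exists (F k), (G k); split => //; last exact: le_lt_trans (gG k) kr.
have [_ h] := FP k; apply: (lt_trans h); apply: le_lt_trans kr.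
rewrite /e; have : 0 <= (4^-1 : R) ^+ k by rewrite exprn_ge0.
by move: (_ ^+ k) => p p0; lra.
Qed.

Lemma closure_graph_fourier f : closure graph (f, fourier f).
Proof. by have [g fg] := closure_graph_ex f; rewrite /fourier; case: xgetP => [h -> //|/(_ g)]; case. Qed.

Lemma closure_graph_unique f g g' : closure graph (f, g) -> closure graph (f, g') -> g = g'.
Proof.
move=> fg fg'; have := closure_graph_isometry (closure_graphB fg fg').
by rewrite subrr normr0 => /normr0_eq0/eqP; rewrite subr_eq0 => /eqP.
Qed.

Lemma norm_fourier (f : L2Rn) : `|fourier f| = `|f|.
Proof. exact/closure_graph_isometry/closure_graph_fourier. Qed.

Lemma fourierB (f g : L2Rn) : fourier (f - g) = fourier f - fourier g.
Proof.
have gB := closure_graphB (@closure_graph_fourier f) (@closure_graph_fourier g).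
exact: (@closure_graph_unique (f - g) _ _ (@closure_graph_fourier (f - g)) gB).
Qed.

Lemma fourier_L1 (f : L2Rn) : L1 f -> {ae lambda, forall w, fourier f w = fourier_integral f w}.
Proof.
move=> /graph_ex[G fG].
have -> : fourier f = G.
  have gG := @subset_closure _ graph _ fG.
  exact: (@closure_graph_unique f _ _ (@closure_graph_fourier f) gG).
by have [_] := fG.
Qed.

End fourier_operator.

(** * Tails of the Rihaczek distribution *)

Section rihaczek_tails.
Context {R : realType} {n : nat}.
Notation RM := (measurableTypeR R).
Notation Rn := (n.-tuple RM).
Notation lambda := (@lebesgue_tuple R n).
Notation L2Rn := (L2 lambda).
Implicit Types (f g : L2Rn) (xi : R).

(** The chirp has modulus 1, so only the moduli of f and its transform remain. *)
Lemma cabs_rihaczek_sq f z :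
  cabs (rihaczek f) z ^+ 2 = cabs f z.1 ^+ 2 * cabs (fourier f) z.2 ^+ 2.
Proof.
rewrite !cabs_sqE /rihaczek /expi.
move: (- _) => t; case: (L2_to_fun f z.1) => a b; case: (L2_to_fun _ z.2) => p q /=.
have := cos2Dsin2 t; move: (cos t) (sin t) => c s cs.
transitivity ((c ^+ 2 + s ^+ 2) * (a ^+ 2 + b ^+ 2) * (p ^+ 2 + q ^+ 2)).
  by ring.
by rewrite cs mul1r.
Qed.

Lemma measurable_Qset xi : measurable (@Qset R n xi).
Proof.
rewrite (_ : Qset xi = eball xi `*` eball xi); last by apply/seteqP; split => -[x w].
by apply: measurableX; exact: measurable_eball.
Qed.

Lemma tail_ge0 xi (u : Rn -> R[i]) : (0 <= tail xi u)%E.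
Proof. exact: energy_ge0. Qed.

Lemma tail_le_norm xi f : (tail xi f <= (`|f| ^+ 2)%:E)%E.
Proof.
rewrite -energyE; apply: energy_trunc_le; first exact: cmeasurable_L2.
exact: measurableC (measurable_eball _).
Qed.

Lemma energy_tensor (u v : Rn -> R[i]) : cmeasurable u -> cmeasurable v ->
  (\int[lambda \x lambda]_z (cabs u z.1 ^+ 2 * cabs v z.2 ^+ 2)%:E =
   energy lambda u * energy lambda v)%E.
Proof.
move=> mu mv; apply: (@ge0_integral_tensor _ _ _ _ _ lambda lambda
  (fun x => cabs u x ^+ 2) (fun x => cabs v x ^+ 2)).
- exact: measurable_cabs_sq.
- exact: measurable_cabs_sq.
- by move=> x; exact: sqr_ge0.
- by move=> x; exact: sqr_ge0.
Qed.

Let mB xi : measurable (~` @eball R n xi).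
Proof. exact: measurableC (measurable_eball xi). Qed.

Let mt xi f : cmeasurable (trunc (~` eball xi) f).
Proof. by apply: cmeasurable_trunc => //; exact: cmeasurable_L2. Qed.

Let mtensor (u v : Rn -> R[i]) : cmeasurable u -> cmeasurable v ->
  measurable_fun setT (fun z : Rn * Rn => (cabs u z.1 ^+ 2 * cabs v z.2 ^+ 2)%:E).
Proof.
move=> mu mv; apply/measurable_EFinP.
by apply: (measurable_tensor (f := fun x => cabs u x ^+ 2)
  (g := fun x => cabs v x ^+ 2)); exact: measurable_cabs_sq.
Qed.

Let mR xi f : measurable_fun setT
  ((fun z => (cabs (rihaczek f) z ^+ 2)%:E) \_ (~` Qset xi)).
Proof.
apply/(measurable_restrictT _ _).1; first exact: measurableC (measurable_Qset xi).
apply: measurable_funTS; under eq_fun do rewrite cabs_rihaczek_sq.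
by apply: mtensor; exact: cmeasurable_L2.
Qed.

(** The complement of Q_xi contains { |x| > xi } x R^n. *)
Lemma rihaczek_tail_ge_time xi f : (tail xi f * (`|f| ^+ 2)%:E <= rihaczek_tail xi f)%E.
Proof.
rewrite -norm_fourier -energyE -energy_tensor//; last exact: cmeasurable_L2.
rewrite /rihaczek_tail [leRHS]integral_mkcond; apply: ge0_le_integral => //.
- by move=> z _; rewrite lee_fin mulr_ge0 ?sqr_ge0.
- by apply: mtensor => //; exact: cmeasurable_L2.
move=> [x w] _; rewrite patchE cabs_trunc_sq indicE cabs_rihaczek_sq/=.
case: (boolP (x \in _)) => xB; last first.
  by rewrite !mul0r; case: ifP => // _; rewrite lee_fin mulr_ge0 ?sqr_ge0.
rewrite mul1r mem_set// => -[/= xxi _]; move: xB; rewrite inE; exact.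
Qed.

Lemma rihaczek_tail_ge_frequency xi f :
  ((`|f| ^+ 2)%:E * tail xi (fourier f) <= rihaczek_tail xi f)%E.
Proof.
rewrite -energyE -energy_tensor//; last exact: cmeasurable_L2.
rewrite /rihaczek_tail [leRHS]integral_mkcond; apply: ge0_le_integral => //.
- by move=> z _; rewrite lee_fin mulr_ge0 ?sqr_ge0.
- by apply: mtensor => //; exact: cmeasurable_L2.
move=> [x w] _; rewrite patchE cabs_trunc_sq indicE cabs_rihaczek_sq/=.
case: (boolP (w \in _)) => wB; last first.
  by rewrite mul0r mulr0; case: ifP => // _; rewrite lee_fin mulr_ge0 ?sqr_ge0.
rewrite mul1r mem_set// => -[/= _ wxi]; move: wB; rewrite inE; exact.
Qed.

(** The complement of Q_xi is covered by { |x| > xi } x R^n and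
    R^n x { |w| > xi }. *)
Lemma rihaczek_tail_le xi f :
  (rihaczek_tail xi f <= (`|f| ^+ 2)%:E * (tail xi f + tail xi (fourier f)))%E.
Proof.
rewrite ge0_muleDr ?tail_ge0//.
have -> : ((`|f| ^+ 2)%:E * tail xi f =
    energy lambda (trunc (~` eball xi) f) * energy lambda (fourier f))%E.
  by rewrite muleC energyE norm_fourier.
rewrite -(energyE f) -!energy_tensor//; try exact: cmeasurable_L2.
rewrite -ge0_integralD//; first last.
- by apply: mtensor => //; exact: cmeasurable_L2.
- by move=> z _; rewrite lee_fin mulr_ge0 ?sqr_ge0.
- by apply: mtensor => //; exact: cmeasurable_L2.
- by move=> z _; rewrite lee_fin mulr_ge0 ?sqr_ge0.
rewrite /rihaczek_tail [leLHS]integral_mkcond; apply: ge0_le_integral => //.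
- move=> z _; rewrite patchE; case: ifP => // _; by rewrite lee_fin sqr_ge0.
- by apply: emeasurable_funD; apply: mtensor => //; exact: cmeasurable_L2.
move=> [x w] _; rewrite patchE !cabs_trunc_sq !indicE cabs_rihaczek_sq/=.
rewrite -EFinD; case: ifPn => [|_]; last first.
  by rewrite lee_fin addr_ge0// mulr_ge0 ?sqr_ge0// mulr_ge0 ?sqr_ge0.
rewrite inE/= => nQ; rewrite lee_fin.
have [xxi|xxi] := pselect (enorm x <= xi); last first.
  rewrite mem_set// mul1r lerDl mulr_ge0 ?sqr_ge0// mulr_ge0 ?sqr_ge0//.
have wxi : ~ enorm w <= xi by move=> wxi; apply: nQ.
by rewrite [w \in _]mem_set// mul1r lerDr mulr_ge0 ?sqr_ge0// mulr_ge0 ?sqr_ge0.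
Qed.

(** Each tail is at most the squared norm of f, so its square is at most its
    product with the squared norm, hence at most the Rihaczek tail. *)
Lemma rihaczek_tail_lt xi f (e : R) : 0 < e ->
  (rihaczek_tail xi f < (e ^+ 2)%:E)%E ->
  (tail xi f < e%:E)%E /\ (tail xi (fourier f) < e%:E)%E.
Proof.
move=> e0 re.
have sq_lt (t : \bar R) : (0 <= t)%E -> (t <= (`|f| ^+ 2)%:E)%E ->
    (t * (`|f| ^+ 2)%:E <= rihaczek_tail xi f)%E -> (t < e%:E)%E.
  move=> t0 tf tr.
  have tfin : (t \is a fin_num)%E.
    by rewrite ge0_fin_numE// (le_lt_trans tf)// ltry.
  have : (t * t < (e ^+ 2)%:E)%E.
    by apply: le_lt_trans re; apply: le_trans tr; exact: lee_wpmul2l.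
  rewrite -(fineK tfin) -EFinM !lte_fin -expr2 ltr_pXn2r// ?nnegrE ?fine_ge0//.
  exact: ltW.
split; apply: sq_lt; rewrite ?tail_ge0//.
- exact: tail_le_norm.
- exact: rihaczek_tail_ge_time.
- by rewrite -norm_fourier tail_le_norm.
- by rewrite muleC rihaczek_tail_ge_frequency.
Qed.

(** Truncation is linear and does not increase the energy. *)
Lemma tail_near xi f g :
  (tail xi f <= 2%:E * tail xi g + 2%:E * (`|f - g| ^+ 2)%:E)%E.
Proof.
have mfg : cmeasurable (fun x => f x - g x).
  by apply: cmeasurableD; [exact: cmeasurable_L2|apply: cmeasurableN; exact: cmeasurable_L2].
have -> : tail xi f = energy lambda (fun x => trunc (~` eball xi) g x +
    trunc (~` eball xi) (fun x => f x - g x) x).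
  apply: eq_integral => x _; congr (_ ^+ 2)%:E; rewrite /cabs/=; congr normc.
  by rewrite /trunc; case: (x \in _); rewrite ?addr0// addrC subrK.
apply: (le_trans (energyD_le _ _ _)) => //; first exact: cmeasurable_trunc.
rewrite leeD2l// lee_wpmul2l// -energyB.
exact: energy_trunc_le.
Qed.

(** The finitely many points of a net have uniformly small tails, and tails move
    little under small perturbations; the transforms of the points form a net of
    the transforms, with the same radius. *)
Lemma precompact_uniform_tails (K : set L2Rn) (e : R) : precompact K -> 0 < e ->
  exists xi, forall f, K f -> (tail xi f <= e%:E)%E /\ (tail xi (fourier f) <= e%:E)%E.
Proof.
have four (t : R) : 2 * (t / 4) + 2 * (t / 4) = t by field.
(* With this radius, tail_near bounds every tail by e / 2 + e / 2. *)
move=> cK e0; pose r := Num.sqrt e / 2.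
have r2 : r ^+ 2 = e / 4.
  by rewrite /r expr_div_n sqr_sqrtr ?ltW//; congr (_ / _); ring.
have [|I [c Kc]] := precompact_totally_bounded (e := r) cK.
  by rewrite divr_gt0// sqrtr_gt0.
have e4 : 0 < e / 4 by rewrite divr_gt0.
have /choice[x1 x1P] : forall i, exists xi, (tail xi (c i) < (e / 4)%:E)%E.
  by move=> i; apply: tail_small e4; [exact: cmeasurable_L2|exact: energy_L2_lty].
have /choice[x2 x2P] : forall i, exists xi, (tail xi (fourier (c i)) < (e / 4)%:E)%E.
  by move=> i; apply: tail_small e4; [exact: cmeasurable_L2|exact: energy_L2_lty].
pose xi := \sum_i (`|x1 i| + `|x2 i|).
have xi12 i : x1 i <= xi /\ x2 i <= xi.
  have : `|x1 i| + `|x2 i| <= xi.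
    by rewrite /xi (bigD1 i)//= lerDl sumr_ge0// => j _; rewrite addr_ge0.
  have := ler_norm (x1 i); have := ler_norm (x2 i).
  have := normr_ge0 (x1 i); have := normr_ge0 (x2 i).
  by move=> *; split; lra.
have close (f g : L2Rn) (x : R) : x <= xi -> (tail x g < (e / 4)%:E)%E ->
    `|f - g| < r -> (tail xi f <= e%:E)%E.
  move=> xxi xg fg; apply: (le_trans (tail_near xi f g)).
  have h1 : (tail xi g <= (e / 4)%:E)%E.
    by apply: (le_trans (tail_nonincreasing (cmeasurable_L2 g) xxi)); exact: ltW.
  have h2 : ((`|f - g| ^+ 2)%:E <= (e / 4)%:E)%E.
    by rewrite lee_fin -r2 lerXn2r ?nnegrE// ltW// ?(le_lt_trans (normr_ge0 _) fg).
  apply: (le_trans (leeD (lee_wpmul2l _ h1) (lee_wpmul2l _ h2))) => //.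
  by rewrite -!EFinM -EFinD four.
exists xi => f Kf; have [j] := Kc f Kf; rewrite -ball_normE /ball_/= distrC => fc.
have [h1 h2] := xi12 j; split; first exact: close h1 (x1P j) fc.
by apply: close h2 (x2P j) _; rewrite -fourierB norm_fourier.
Qed.

End rihaczek_tails.

(** * Finite codes for bounded Lipschitz functions *)

Section quantization.
Context {R : realType}.

Lemma quantization (L s : R) : 0 < s ->
  exists (I : finType) (q : R -> I), forall x y, `|x| <= L -> `|y| <= L ->
    q x = q y -> `|x - y| <= s.
Proof.
move=> s0; pose N := Num.truncn (2 * L / s).
exists 'I_N.+1, (fun x => inord (Num.truncn ((x + L) / s))) => x y xL yL.
have T z : `|z| <= L -> [/\ (Num.truncn ((z + L) / s) <= N)%N,
    (Num.truncn ((z + L) / s))%:R * s <= z + L &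
    z + L < ((Num.truncn ((z + L) / s))%:R + 1) * s].
  rewrite ler_norml => /andP[h1 h2].
  have z0 : 0 <= (z + L) / s by rewrite divr_ge0// ?(ltW s0)//; lra.
  split.
  - by apply: le_truncn; rewrite ler_pM2r ?invr_gt0//; lra.
  - by rewrite -ler_pdivlMr// truncn_le.
  - by rewrite -ltr_pdivrMr// natr1 truncnS_gt.
move=> /(congr1 val); rewrite /= !inordK ?ltnS; [|by have [] := T _ yL|by have [] := T _ xL].
move=> E; have [_ x1 x2] := T _ xL; have [_ y1 y2] := T _ yL.
move: x1 x2 y1 y2; rewrite E; move: (_%:R) => k.
by rewrite mulrDl mul1r ler_norml => *; apply/andP; split; lra.
Qed.

End quantization.

Section equicontinuous.
Context {R : realType} {n : nat}.
Notation RM := (measurableTypeR R).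
Notation Rn := (n.-tuple RM).

(** The Lipschitz condition is stated for the maximum norm of w - w', which is
    the one that rounding each coordinate controls. *)
Definition equilipschitz (L C : R) : set (Rn -> R) :=
  [set phi | (forall w, `|phi w| <= L) /\
    forall w w' (e : R), 0 <= e -> (forall i, `|tnth w i - tnth w' i| <= e) ->
      `|phi w - phi w'| <= C * e].

(** Round the values of the function at one representative of each cell of a grid
    on the ball: functions with the same rounded values are close at the
    representatives, hence on the whole ball by the Lipschitz condition. *)
Lemma equilipschitz_finite_code (xi L C s : R) : 0 <= C -> 0 < s ->
  exists (I : finType) (p : (Rn -> R) -> I), forall phi psi,
    equilipschitz L C phi -> equilipschitz L C psi -> p phi = p psi ->
    forall w, eball xi w -> `|phi w - psi w| <= s.
Proof.
(* Going from w to its representative, then from phi to psi, then back to w,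
   costs at most s / 3 each time; C + 1 avoids dividing by 0. *)
move=> C0 s0; pose e := s / (3 * (C + 1)).
have C1 : 0 < 3 * (C + 1) by rewrite mulr_gt0// ltr_wpDl.
have e0 : 0 < e by rewrite divr_gt0.
have Ce : C * e <= s / 3.
  rewrite /e mulrA ler_pdivrMr// mulrAC mulrA ler_pdivlMr//.
  by have := mulr_ge0 C0 (ltW s0); lra.
have [Q [q qP]] := quantization xi e0.
have s3 : 0 < s / 3 by rewrite divr_gt0.
have [V [v vP]] := quantization L s3.
pose cell (w : Rn) : {ffun 'I_n -> Q} := [ffun i => q (tnth w i)].
pose rep (c : {ffun 'I_n -> Q}) : Rn :=
  xget [tuple 0 | i < n] [set w | eball xi w /\ cell w = c].
exists {ffun {ffun 'I_n -> Q} -> V}, (fun phi => [ffun c => v (phi (rep c))]).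
move=> phi psi [phiL phiC] [psiL psiC] /ffunP E w wxi.
set r := rep (cell w).
have [rxi cr] : eball xi r /\ cell r = cell w.
  by rewrite /r /rep; case: xgetP => [x _ //|/(_ w)]; case.
have wr i : `|tnth w i - tnth r i| <= e.
  apply: qP.
  - exact: le_trans (tnth_le_enorm w i) wxi.
  - exact: le_trans (tnth_le_enorm r i) rxi.
  - by have /ffunP/(_ i) := cr; rewrite !ffunE => ->.
have h1 := le_trans (phiC _ _ _ (ltW e0) wr) Ce.
have h2 := le_trans (psiC _ _ _ (ltW e0) wr) Ce.
have h3 : `|phi r - psi r| <= s / 3.
  by apply: vP => //; have := E (cell w); rewrite !ffunE.
move: h1 h2 h3; rewrite !ler_norml => /andP[? ?] /andP[? ?] /andP[? ?].
by apply/andP; split; lra.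
Qed.

End equicontinuous.

(** * Precompactness from uniform tails *)

Section fourier_of_truncation.
Context {R : realType} {n : nat}.
Notation RM := (measurableTypeR R).
Notation Rn := (n.-tuple RM).
Notation lambda := (@lebesgue_tuple R n).
Notation L2Rn := (L2 lambda).
Notation pi := (@pi R).

Lemma lipschitz1 (f df : R -> R) (a b : R) : (forall x : R, is_derive x 1 f (df x)) ->
  (forall x, `|df x| <= 1) -> `|f a - f b| <= `|a - b|.
Proof.
move=> fdf df1; wlog ab : a b / a <= b => [wl|].
  by have [ab|/ltW ba] := leP a b; [exact: wl|rewrite distrC [leRHS]distrC; exact: wl].
have cf : {within `[a, b], continuous f}.
  apply: continuous_subspaceT => x; apply/differentiable_continuous/derivable1_diffP.
  exact: (@ex_derive _ _ _ _ _ _ _ (fdf x)).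
have [c _ fE] := MVT_segment ab (fun x _ => fdf x) cf.
by rewrite distrC fE normrM [leRHS]distrC ler_piMl.
Qed.

Lemma cos_lipschitz (a b : R) : `|cos a - cos b| <= `|a - b|.
Proof.
apply: (@lipschitz1 cos (fun x => - sin x)) => x.
by rewrite normrN ler_norml sin_geN1 sin_le1.
Qed.

Lemma sin_lipschitz (a b : R) : `|sin a - sin b| <= `|a - b|.
Proof.
apply: (@lipschitz1 sin cos) => x.
by rewrite ler_norml cos_geN1 cos_le1.
Qed.

(** On a ball the phase x . w is Lipschitz in w, uniformly in x: this is why
    functions supported in a ball have Lipschitz transforms. *)
Lemma dot_phase_lipschitz (xi e : R) (x w w' : Rn) : eball xi x -> 0 <= e ->
  (forall i, `|tnth w i - tnth w' i| <= e) ->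
  `|dot_phase (x, w) - dot_phase (x, w')| <= 2 * pi * (xi *+ n) * e.
Proof.
move=> xxi e0 ww; have p0 : 0 <= 2 * pi by rewrite mulr_ge0// pi_ge0.
rewrite /dot_phase -mulrBr normrM (ger0_norm p0) -mulrA ler_wpM2l// /dotp -sumrB.
rewrite (le_trans (ler_norm_sum _ _ _))// -[n in xi *+ n]card_ord -sumr_const mulr_suml.
apply: ler_sum => i _; rewrite -mulrBr normrM ler_pM//.
exact: le_trans (tnth_le_enorm x i) xxi.
Qed.

Lemma equilipschitz_phase_re (xi L : R) (u v : Rn -> R) :
  lambda.-integrable setT (EFin \o u) -> lambda.-integrable setT (EFin \o v) ->
  0 <= xi -> (forall x, ~ eball xi x -> u x = 0 /\ v x = 0) ->
  \int[lambda]_x (`|u x| + `|v x|) <= L ->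
  equilipschitz L (2 * pi * (xi *+ n) * L) (phase_re lambda (@dot_phase R n) u v).
Proof.
move=> iu iv xi0 uv0 uvL.
have mph w : measurable_fun setT (fun x : Rn => dot_phase (x, w)).
  exact: (measurableT_comp (@measurable_dot_phase R n) (measurable_pair2 w)).
have iuv : lambda.-integrable setT (EFin \o (fun x => `|u x| + `|v x|)).
  exact: (@integrableD _ _ _ lambda setT measurableT
    (EFin \o (fun x => `|u x|)) (EFin \o (fun x => `|v x|))
    (integrable_norm iu) (integrable_norm iv)).
have iw w := integrable_phase_re iu iv (mph w).
split=> [w|w w' e e0 ww].
  apply: le_trans uvL; apply: le_trans (le_normr_Rintegral _ (iw w)) _ => //.
  apply: le_Rintegral => //; first exact: integrable_norm (iw w).
  move=> x _; apply: (le_trans (ler_normD _ _)); rewrite !normrM.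
  by apply: lerD; rewrite ler_piMr// ler_norml ?cos_geN1 ?cos_le1 ?sin_geN1 ?sin_le1.
rewrite /phase_re -RintegralB//.
have iB : lambda.-integrable setT (EFin \o (fun x =>
    (u x * cos (dot_phase (x, w)) + v x * sin (dot_phase (x, w))) -
    (u x * cos (dot_phase (x, w')) + v x * sin (dot_phase (x, w'))))).
  exact: (integrableB measurableT (iw w) (iw w')).
apply: le_trans (le_normr_Rintegral _ iB) _ => //.
set C := 2 * pi * (xi *+ n).
have C0 : 0 <= C by rewrite !mulr_ge0// ?pi_ge0// mulrn_wge0.
apply: (@le_trans _ _ (\int[lambda]_x ((C * e) * (`|u x| + `|v x|)))); last first.
  by rewrite RintegralZl// [leRHS]mulrAC ler_wpM2l// mulr_ge0.
apply: le_Rintegral => //.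
- exact: integrable_norm iB.
- exact: (integrableZl measurableT (C * e) iuv).
move=> x _; have [xxi|/uv0[-> ->]] := pselect (eball xi x); last first.
  by rewrite !mul0r !addr0 subrr !normr0 addr0 mulr0.
have -> : u x * cos (dot_phase (x, w)) + v x * sin (dot_phase (x, w)) -
    (u x * cos (dot_phase (x, w')) + v x * sin (dot_phase (x, w'))) =
    u x * (cos (dot_phase (x, w)) - cos (dot_phase (x, w'))) +
    v x * (sin (dot_phase (x, w)) - sin (dot_phase (x, w'))).
  by move: (cos _) (cos _) (sin _) (sin _) => *; ring.
have h := dot_phase_lipschitz xxi e0 ww.
apply: (le_trans (ler_normD _ _)); rewrite !normrM mulrDr; apply: lerD.
  by rewrite mulrC ler_wpM2r// (le_trans (cos_lipschitz _ _)).
by rewrite mulrC ler_wpM2r// (le_trans (sin_lipschitz _ _)).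
Qed.

Lemma equilipschitz_phase_im (xi L : R) (u v : Rn -> R) :
  lambda.-integrable setT (EFin \o u) -> lambda.-integrable setT (EFin \o v) ->
  0 <= xi -> (forall x, ~ eball xi x -> u x = 0 /\ v x = 0) ->
  \int[lambda]_x (`|u x| + `|v x|) <= L ->
  equilipschitz L (2 * pi * (xi *+ n) * L) (phase_im lambda (@dot_phase R n) u v).
Proof.
move=> iu iv xi0 uv0 uvL.
have -> : phase_im lambda (@dot_phase R n) u v =
    phase_re lambda (@dot_phase R n) v (fun x => - u x).
  by apply/funext => w; apply: eq_Rintegral => x _; rewrite mulNr.
apply: equilipschitz_phase_re => //.
- exact: (integrableN iu).
- by move=> x /uv0[-> ->]; rewrite oppr0.
- by under eq_Rintegral do rewrite normrN addrC.
Qed.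

Lemma energy_scaled_le (f : Rn -> R[i]) (s : R) (A : set Rn) : measurable A ->
  cmeasurable f ->
  (forall w, A w -> `|complex.Re (f w)| <= s /\ `|complex.Im (f w)| <= s) ->
  (energy lambda (trunc A f) <= (2 * s ^+ 2)%:E * lambda A)%E.
Proof.
move=> mA mf fs; have mf2 := measurable_cabs_sq mf.
rewrite energy_trunc// -integral_cst//; apply: ge0_le_integral => //.
- by move=> x _; rewrite lee_fin sqr_ge0.
- by apply/measurable_EFinP; exact: measurable_funTS.
move=> x /fs[h1 h2]; rewrite lee_fin cabs_sqE.
rewrite -[X in X + _]real_normK ?num_real// -[X in _ + X]real_normK ?num_real//.
have := lerXn2r 2 _ _ h1; have := lerXn2r 2 _ _ h2.
rewrite !nnegrE (le_trans (normr_ge0 _) h1) !normr_ge0 => /(_ isT isT) + /(_ isT isT).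
by move=> *; lra.
Qed.

Lemma L1norm_trunc_le (f : L2Rn) (A : set Rn) : measurable A -> (lambda A < +oo)%E ->
  \int[lambda]_x (`|complex.Re (trunc A f x)| + `|complex.Im (trunc A f x)|) <=
   fine (lambda A) + `|f| ^+ 2.
Proof.
move=> mA Ay; have mf := cmeasurable_L2 f; have mt := cmeasurable_trunc mA mf.
have Lt := integrable_cabs_trunc mA Ay mf (energy_L2_lty f).
have it := integrableD measurableT (integrable_norm (integrable_Re mt Lt))
  (integrable_norm (integrable_Im mt Lt)).
have iA : lambda.-integrable setT (EFin \o (\1_A : Rn -> R)).
  by apply: integrable_ge0 => //; rewrite integral_indic// setIT.
have if2 : lambda.-integrable setT (EFin \o (fun x => cabs f x ^+ 2)).
  apply: integrable_ge0 => [|x|]; [exact: measurable_cabs_sq|exact: sqr_ge0|].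
  exact: (energy_L2_lty f).
have -> : fine (lambda A) + `|f| ^+ 2 = \int[lambda]_x (\1_A x + cabs f x ^+ 2).
  rewrite RintegralD// /Rintegral; congr (_ + _).
    by rewrite integral_indic// setIT.
  by rewrite -[X in fine X]/(energy lambda f) energyE.
have i12 := integrableD measurableT iA if2.
apply: le_Rintegral => //.
move=> x _; rewrite Re_trunc Im_trunc cabs_sqE indicE.
case: (x \in A); rewrite ?mul1r ?mul0r; last first.
  by rewrite normr0 !add0r addr_ge0 ?sqr_ge0.
move: (complex.Re _) (complex.Im _) => a b.
rewrite -[a ^+ 2]real_normK ?num_real// -[b ^+ 2]real_normK ?num_real//.
have -> : true%:R = 1 :> R by [].
have := sqr_ge0 (`|a| - 2^-1); have := sqr_ge0 (`|b| - 2^-1); lra.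
Qed.

Lemma energyB_le (u v : Rn -> R[i]) : cmeasurable u -> cmeasurable v ->
  (energy lambda (fun x => (u x - v x)%R) <=
   2%:E * energy lambda u + 2%:E * energy lambda v)%E.
Proof.
move=> mu mv; have mNv := cmeasurableN mv.
by have := energyD_le lambda mu mNv; rewrite /energy cabsN.
Qed.

(** The transform of the truncation of f to a ball, as a genuine function given by
    an integral and not as a class: its values at points are meaningful. *)
Definition cutoff_fourier (xi : R) (f : L2Rn) : Rn -> R[i] :=
  fourier_integral (trunc (eball xi) f).

Lemma L1_cutoff xi (f : L2Rn) : L1 (trunc (eball xi) f).
Proof.
apply: integrable_cabs_trunc; [exact: measurable_eball|exact: lambda_eball_lty|..].
  exact: cmeasurable_L2.
exact: energy_L2_lty.
Qed.

Lemma cmeasurable_cutoff xi (f : L2Rn) : cmeasurable (trunc (eball xi) f).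
Proof. by apply: cmeasurable_trunc; [exact: measurable_eball|exact: cmeasurable_L2]. Qed.

(** By isometry, cutting f off costs as much on the Fourier side as it does on the
    side of f. *)
Lemma energy_fourier_cutoff xi (f : L2Rn) :
  energy lambda (fun w => fourier f w - cutoff_fourier xi f w) = tail xi f.
Proof.
have [f1 [f1E f1N]] := ex_trunc f (@measurable_eball R n xi).
have mc := cmeasurable_cutoff xi f; have mf1 := cmeasurable_L2 f1.
have Lf1 : L1 f1 by apply: L1_ae f1E (L1_cutoff xi f).
rewrite /tail -f1N -norm_fourier fourierB -energyB; apply: eq_ae_energy.
- apply: cmeasurableD; first exact: cmeasurable_L2.
  by apply: cmeasurableN; exact: cmeasurable_fourier_integral.
- apply: cmeasurableD; first exact: cmeasurable_L2.
  by apply: cmeasurableN; exact: cmeasurable_L2.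
- apply: filterS (fourier_L1 Lf1) => w ->; congr (_ - _).
  by apply: fourier_integral_ae => //; apply: filterS f1E => x ->.
Qed.

Lemma equilipschitz_cutoff_fourier (xi M : R) (f : L2Rn) : 0 <= xi -> `|f| <= M ->
  let L := fine (lambda (eball xi)) + M ^+ 2 in
  let C := 2 * pi * (xi *+ n) * L in
  equilipschitz L C (fun w => complex.Re (cutoff_fourier xi f w)) /\
  equilipschitz L C (fun w => complex.Im (cutoff_fourier xi f w)).
Proof.
move=> xi0 fM L C.
have mc := cmeasurable_cutoff xi f; have Lc := L1_cutoff xi f.
have out x : ~ eball xi x ->
    complex.Re (trunc (eball xi) f x) = 0 /\ complex.Im (trunc (eball xi) f x) = 0.
  by move=> xxi; rewrite /trunc memNset.
have fL : \int[lambda]_x (`|complex.Re (trunc (eball xi) f x)| +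
    `|complex.Im (trunc (eball xi) f x)|) <= L.
  apply: (le_trans (L1norm_trunc_le f (@measurable_eball R n xi) (@lambda_eball_lty R n xi))).
  by rewrite lerD2l lerXn2r ?nnegrE// (le_trans _ fM).
split.
  under eq_fun do rewrite Re_fourier_integral.
  exact: (equilipschitz_phase_re (integrable_Re mc Lc) (integrable_Im mc Lc)).
under eq_fun do rewrite Im_fourier_integral.
exact: (equilipschitz_phase_im (integrable_Re mc Lc) (integrable_Im mc Lc)).
Qed.

(** Compare f and g through their transforms.  Outside the ball, the transforms
    are small.  Inside, they are close to the transforms of the truncations,
    which are uniformly close to one another. *)
Lemma norm_sub_sq_le (xi s e : R) (f g : L2Rn) :
  (tail xi f <= e%:E)%E -> (tail xi (fourier f) <= e%:E)%E ->
  (tail xi g <= e%:E)%E -> (tail xi (fourier g) <= e%:E)%E ->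
  (forall w, eball xi w ->
    `|complex.Re (cutoff_fourier xi f w) - complex.Re (cutoff_fourier xi g w)| <= s /\
    `|complex.Im (cutoff_fourier xi f w) - complex.Im (cutoff_fourier xi g w)| <= s) ->
  `|f - g| ^+ 2 <= 12 * e + 4 * s ^+ 2 * fine (lambda (eball xi)).
Proof.
have four (t : R) : 2 * t + 2 * t = 4 * t by ring.
have twelve (t u v : R) : 2 * (2 * u * v) + 2 * (4 * t) = 8 * t + 4 * u * v by ring.
have sum (t u : R) : 8 * t + u + 4 * t = 12 * t + u by ring.
move=> fe Ffe ge Fge fgs.
have mB := @measurable_eball R n xi; have mB' := measurableC mB.
have mF := cmeasurable_L2 (fourier f); have mG := cmeasurable_L2 (fourier g).
have mP : cmeasurable (cutoff_fourier xi f).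
  exact: cmeasurable_fourier_integral (cmeasurable_cutoff xi f).
have mQ : cmeasurable (cutoff_fourier xi g).
  exact: cmeasurable_fourier_integral (cmeasurable_cutoff xi g).
have mB2 (u v : Rn -> R[i]) : cmeasurable u -> cmeasurable v ->
    cmeasurable (fun x => u x - v x).
  by move=> mu mv; apply: cmeasurableD => //; exact: cmeasurableN.
rewrite -lee_fin -norm_fourier fourierB -energyB.
rewrite (@energy_trunc_split _ _ _ _ (eball xi))//; last exact: mB2.
have lB : (lambda (eball xi) = (fine (lambda (eball xi)))%:E)%E.
  by rewrite fineK// ge0_fin_numE// lambda_eball_lty.
have inside : (energy lambda (trunc (eball xi) (fun w => (fourier f w - fourier g w)%R))
    <= (8 * e + 4 * s ^+ 2 * fine (lambda (eball xi)))%:E)%E.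
  have -> : trunc (eball xi) (fun w => fourier f w - fourier g w) = (fun w =>
      trunc (eball xi) (fun w => cutoff_fourier xi f w - cutoff_fourier xi g w) w +
      trunc (eball xi) (fun w => (fourier f w - cutoff_fourier xi f w) -
        (fourier g w - cutoff_fourier xi g w)) w).
    apply/funext => w; rewrite /trunc; case: ifP => _; last by rewrite addr0.
    by move: (L2_to_fun _ w) (L2_to_fun _ w) (cutoff_fourier _ _ w) => *; ring.
  have mE := mB2 _ _ mF mP; have mE' := mB2 _ _ mG mQ.
  have mPQ := mB2 _ _ mP mQ; have mEE := mB2 _ _ mE mE'.
  apply: (le_trans (energyD_le lambda (cmeasurable_trunc mB mPQ) (cmeasurable_trunc mB mEE))).
  have h1 : (energy lambda (trunc (eball xi)
      (fun w => (cutoff_fourier xi f w - cutoff_fourier xi g w)%R)) <=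
      (2 * s ^+ 2 * fine (lambda (eball xi)))%:E)%E.
    apply: (le_trans (@energy_scaled_le _ s _ mB mPQ _)); last by rewrite lB.
    by move=> w /fgs; rewrite 2!raddfB.
  have h2 : (energy lambda (trunc (eball xi)
      (fun w => ((fourier f w - cutoff_fourier xi f w) -
        (fourier g w - cutoff_fourier xi g w))%R)) <= (4 * e)%:E)%E.
    apply: (le_trans (energy_trunc_le lambda mEE mB)).
    apply: (le_trans (energyB_le mE mE')); rewrite !energy_fourier_cutoff.
    apply: (le_trans (leeD (lee_wpmul2l _ fe) (lee_wpmul2l _ ge))) => //.
    by rewrite -EFinM -EFinD four.
  apply: (le_trans (leeD (lee_wpmul2l _ h1) (lee_wpmul2l _ h2))) => //.
  by rewrite -!EFinM -EFinD twelve.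
have outside : (energy lambda (trunc (~` eball xi) (fun w => (fourier f w - fourier g w)%R))
    <= (4 * e)%:E)%E.
  have -> : trunc (~` eball xi) (fun w => fourier f w - fourier g w) = (fun w =>
      trunc (~` eball xi) (fourier f) w - trunc (~` eball xi) (fourier g) w).
    by apply/funext => w; rewrite /trunc; case: ifP => // _; rewrite subr0.
  apply: (le_trans (energyB_le (cmeasurable_trunc mB' mF) (cmeasurable_trunc mB' mG))).
  apply: (le_trans (leeD (lee_wpmul2l _ Ffe) (lee_wpmul2l _ Fge))) => //.
  by rewrite -EFinM -EFinD four.
apply: (le_trans (leeD inside outside)).
by rewrite -EFinD sum.
Qed.

(** Code each element of K by the rounded real and imaginary parts of the
    transform of its truncation.  One element of K per occupied code is a net. *)
Lemma precompact_of_uniform_tails (K : set L2Rn) (M : R) :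
  (forall f, K f -> `|f| <= M) ->
  (forall e : R, 0 < e -> exists2 xi, 0 <= xi & forall f, K f ->
    (tail xi f <= e%:E)%E /\ (tail xi (fourier f) <= e%:E)%E) ->
  precompact K.
Proof.
have small (a b : R) : 0 < a -> b <= a / 4 -> 12 * (a / 32) + b < a.
  by move=> *; lra.
move=> KM tails; apply: L2_totally_bounded_precompact => e e0.
have [|xi xi0 Kxi] := tails (e ^+ 2 / 32); first by rewrite divr_gt0// exprn_gt0.
set V := fine (lambda (eball xi)).
have V0 : 0 <= V by rewrite fine_ge0.
(* Then norm_sub_sq_le gives at most 12 e^2 / 32 + e^2 / 4 < e^2. *)
pose s := e / (4 * (V + 1)).
have V1 : 0 < 4 * (V + 1) by rewrite mulr_gt0// ltr_wpDl.
have s0 : 0 < s by rewrite divr_gt0.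
have sV : 4 * s ^+ 2 * V <= e ^+ 2 / 4.
  have es : e = s * (4 * (V + 1)) by rewrite /s divfK// gt_eqF.
  rewrite es; have := mulr_ge0 (sqr_ge0 s) V0.
  by have := mulr_ge0 (sqr_ge0 s) (sqr_ge0 V); have := sqr_ge0 s; lra.
pose L := V + M ^+ 2; pose C := 2 * pi * (xi *+ n) * L.
have C0 : 0 <= C.
  by rewrite !mulr_ge0// ?pi_ge0 ?mulrn_wge0 ?addr_ge0 ?sqr_ge0.
have [J [p pP]] := @equilipschitz_finite_code R n xi L C s C0 s0.
pose code (f : L2Rn) := (p (fun w => complex.Re (cutoff_fourier xi f w)),
  p (fun w => complex.Im (cutoff_fourier xi f w))).
have close f g : K f -> K g -> code f = code g -> `|f - g| < e.
  move=> Kf Kg [pr pi].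
  have [f1 f2] := Kxi f Kf; have [g1 g2] := Kxi g Kg.
  have [fr fi] := equilipschitz_cutoff_fourier xi0 (KM _ Kf).
  have [gr gi] := equilipschitz_cutoff_fourier xi0 (KM _ Kg).
  have := norm_sub_sq_le (s := s) f1 f2 g1 g2.
  rewrite -(@ltr_pXn2r _ 2) ?nnegrE ?(ltW e0)// => h.
  apply: (le_lt_trans (h _)).
    by move=> w wxi; split; [exact: (pP _ _ fr gr pr)|exact: (pP _ _ fi gi pi)].
  exact: small (exprn_gt0 2 e0) sV.
exists (J * J)%type, (fun c => xget 0 [set f | K f /\ code f = c]) => f Kf.
exists (code f); rewrite -ball_normE /ball_/=.
case: xgetP => [g _ [Kg gf]|/(_ f)]; last by case.
exact: close.
Qed.

End fourier_of_truncation.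

Local Close Scope complex_scope.

(** * The compactness criterion *)

(** A supremum is at most e if and only if all its members are, and nonnegative
    quantities tend to 0 as soon as they are eventually below every e > 0. *)
Lemma sup_ge0_cvg0P (R : realType) (T : Type) (K : set T) (r : R -> T -> \bar R) :
  (forall xi f, 0 <= r xi f)%E ->
  sup_ge0 [set r xi f | f in K] @[xi --> +oo] --> 0%E <->
  (forall e : R, 0 < e -> \forall xi \near +oo, forall f, K f -> (r xi f <= e%:E)%E).
Proof.
move=> r0; have sup0 xi : (0 <= sup_ge0 [set r xi f | f in K])%E.
  by apply: ereal_sup_ubound; left.
split => [/(cvge0P sup0) cr e e0|H].
  apply: filterS (cr e e0) => xi /ltW rxi f Kf; apply: le_trans rxi.
  by apply: ereal_sup_ubound; right; exists f.
apply/(cvge0P sup0) => e e0; have e2 : 0 < e / 2 by rewrite divr_gt0.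
apply: filterS (H _ e2) => xi Hxi.
apply: (@le_lt_trans _ _ (e / 2)%:E); last by rewrite lte_fin ltr_pdivrMr// ltr_pMr// ltr1n.
apply: ge_ereal_sup => _ [->|[f Kf <-]]; last exact: Hxi.
by rewrite lee_fin ltW.
Qed.

Theorem theorem3p2 (R : realType) (d : nat) (hd : (0 < d)%N)
    (K : set (L2 (@lebesgue_tuple R d))) (hK : bounded_set K) :
  precompact K <->
  sup_ge0 [set rihaczek_tail xi f | f in K] @[xi --> +oo] --> 0%E.
Proof.
have [M [M0 KM]] : exists M : R, 0 < M /\ forall f, K f -> `|f| <= M.
  by have /ex_strict_bound_gt0[M M0 KM] := hK; exists M; split => // f /KM/ltW.
have rt0 (xi : R) (f : L2 (@lebesgue_tuple R d)) : (0 <= rihaczek_tail xi f)%E.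
  by apply: integral_ge0 => z _; rewrite lee_fin sqr_ge0.
rewrite sup_ge0_cvg0P//; split => [cK e e0|H].
  pose e' := e / (2 * M ^+ 2).
  have e'0 : 0 < e' by rewrite divr_gt0// mulr_gt0// exprn_gt0.
  have [xi0 K0] := precompact_uniform_tails cK e'0.
  exists xi0; split; first exact: num_real.
  move=> xi xi0xi f Kf; have [t1 t2] := K0 f Kf.
  have mono (g : L2 (@lebesgue_tuple R d)) : (tail xi g <= tail xi0 g)%E.
    by apply: tail_nonincreasing; [exact: cmeasurable_L2|exact: ltW].
  have {}t1 := le_trans (mono _) t1; have {}t2 := le_trans (mono _) t2.
  apply: (le_trans (rihaczek_tail_le _ _)).
  have -> : (e%:E = (M ^+ 2)%:E * (e'%:E + e'%:E))%E.
    rewrite -EFinD -EFinM; congr EFin; rewrite /e'; field.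
    by rewrite gt_eqF.
  apply: lee_pmul => //; [by rewrite adde_ge0// tail_ge0| |exact: leeD].
  by rewrite lee_fin lerXn2r ?nnegrE ?(ltW M0)// KM.
apply: (precompact_of_uniform_tails KM) => e e0.
have e20 : 0 < e ^+ 2 / 2 by rewrite divr_gt0// exprn_gt0.
have [xi [xi0 Hxi]] := filter_ex (filterI (nbhs_pinfty_ge (num_real 0)) (H _ e20)).
exists xi => // f Kf.
have : (rihaczek_tail xi f < (e ^+ 2)%:E)%E.
  apply: (le_lt_trans (Hxi f Kf)); rewrite lte_fin ltr_pdivrMr// ltr_pMr ?exprn_gt0//.
  by rewrite ltr1n.
by move=> /(rihaczek_tail_lt e0)[/ltW ? /ltW ?].
Qed.
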